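(* Let $d\in\{2g+1,2g+2\}$ with $g\ge 2$. Let $\alpha$ be a nonzero integer. For every prime $p>P^+(d)$ with $p\nmid\alpha$, the family $\mathcal{C}_\alpha\to\mathcal{S}^\circ$ of genus-$g$ curves $y^2=x^d+\alpha x+t$ is generically ordinary at $p$. In particular, the Katz family $\mathcal{K}: y^2=x^d-dx+t$ is generically ordinary at $p$ for all primes $p>P^+(d)$.
   Context: $P^+(d)=d^2-4d+2$ if $d=2g+1$, and $P^+(d)=(d^2-3d+2)/2$ if $d=2g+2$. $D_\alpha(t)=\mathrm{disc}_x(x^d+\alpha x+t)$ and $\mathcal{S}^\circ=\mathrm{Spec}\,\mathbb{Z}[1/2,t,D_\alpha(t)^{-1}]$. The family $\mathcal{C}_\alpha\to\mathcal{S}^\circ$ is the family of smooth projective hyperelliptic curves of genus $g$ with affine equation $y^2=x^d+\alpha x+t$; the Katz family is $\mathcal{K}=\mathcal{C}_{-d}$. A smooth projective curve of genus $g$ over a field of characteristic $p>0$ is ordinary if its Jacobian is an ordinary abelian variety, i.e. its Newton polygon has only slopes $0$ and $1$. The family is generically ordinary at $p$ if its restriction to the fiber $\mathcal{S}^\circ\times\mathrm{Spec}\,\mathbb{F}_p$ (a nonempty open subscheme of $\mathbb{A}^1_{\mathbb{F}_p}$) has ordinary generic fiber, i.e. the curve $y^2=x^d+\bar\alpha x+t$ over $\mathbb{F}_p(t)$ is ordinary, where $\bar\alpha=\alpha\bmod p$; equivalently, the ordinary locus in this fiber is a nonempty open subset. *)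

(* Defs.v *)
From HB Require Import structures.
From mathcomp Require Import all_boot all_order all_algebra all_field.

Set Implicit Arguments.
Unset Strict Implicit.
Unset Printing Implicit Defensive.

Import Order.TTheory GRing.Theory Num.Theory.
Local Open Scope ring_scope.

(* The subtractions are exact for d >= 4, and (d - 1) * (d - 2) is even. *)
Definition Pplus (d : nat) : nat :=
  if odd d then (d ^ 2 - 4 * d + 2)%N else (d ^ 2 - 3 * d + 2)./2.

Definition trinomial (R : nzRingType) (d : nat) (a t : R) : {poly R} :=
  'X^d + a *: 'X + t%:P.

(* Discriminant of a monic polynomial of degree n:
   (-1)^(n(n-1)/2) Res(f, f'). *)
Definition monic_disc (R : comNzRingType) (f : {poly R}) : R :=
  (-1) ^+ 'C((size f).-1, 2) * resultant f f^`().

(* D_alpha(t) as an element of Z[t]; the inner 'X is t. *)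
Definition Dpoly (d : nat) (alpha : int) : {poly int} :=
  monic_disc (trinomial d (alpha%:P) ('X : {poly int})).

(* The F-valued points of S° = Spec Z[1/2, t, 1/D_alpha(t)]: values t in F at
   which 2 and D_alpha are invertible. *)
Definition base_point (d : nat) (alpha : int) (F : fieldType) (t : F) : bool :=
  (2%:R != 0 :> F) && ((map_poly intr (Dpoly d alpha)).[t] != 0).

(* Number of K-points of the smooth projective model of y^2 = f(x), where
   deg f is 2g+1 or 2g+2.  The model is glued from y^2 = f(x) and
   v^2 = u^(2g+2) f(1/u) along u = 1/x, v = y / x^(g+1); its points at
   infinity are the points with u = 0 of the second chart, i.e. the solutions
   of v^2 = f_(2g+2): one if deg f = 2g+1, and, for f monic of degree 2g+2 in
   odd characteristic, two. *)
Definition hyperelliptic_card (g : nat) (K : finFieldType) (f : {poly K}) :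
    nat :=
  (#|[set P : K * K | (P.2 ^+ 2 == f.[P.1])%R]|
   + #|[set v : K | (v ^+ 2 == f`_(2 * g + 2))%R]|)%N.

(* L is the numerator of the zeta function of the curve C of genus g over F
   with affine equation y^2 = f(x), i.e. the reversed characteristic
   polynomial of Frobenius on the Jacobian of C: L = \prod_i (1 - a_i T), with
   2g factors, where #C(F_(q^n)) = q^n + 1 - \sum_i a_i^n for all n >= 1.
   These conditions determine L. *)
Definition is_Lpoly (g : nat) (F : finFieldType) (f : {poly F})
    (L : {poly int}) : Prop :=
  exists a : 'I_(2 * g) -> algC,
    map_poly intr L = \prod_(i < 2 * g) (1 - a i *: 'X) /\
    forall (n : nat) (K : finFieldType) (iota : {rmorphism F -> K}),
      (0 < n)%N -> #|K| = (#|F| ^ n)%N ->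
      (hyperelliptic_card g (map_poly iota f))%:R
        = (#|F| ^ n)%:R + 1 - \sum_(i < 2 * g) a i ^+ n.

(* The valuation v_q on Z (q a power of p), normalized by v_q(q) = 1; it is
   only meaningful on nonzero integers. *)
Definition qval (p q : nat) (x : int) : rat :=
  (logn p `|x|%N)%:R / (logn p q)%:R.

(* s is the slope of an edge of the q-adic Newton polygon of L, the lower
   convex hull of the points (k, v_q(L_k)) with L_k != 0: some line of slope s
   passes through two of these points and lies above none of them. *)
Definition newton_slope (p q : nat) (L : {poly int}) (s : rat) : Prop :=
  exists i j : nat,
    [/\ (i < j)%N, L`_i != 0, L`_j != 0,
        qval p q L`_j = qval p q L`_i + s * (j%:R - i%:R) &
        forall k : nat, L`_k != 0 ->
          qval p q L`_i + s * (k%:R - i%:R) <= qval p q L`_k].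

(* Ordinarity of the Jacobian of y^2 = f(x) over a finite field F of
   characteristic p.  The slopes of the Newton polygon of the Jacobian are the
   q-adic slopes of L, q = #|F|. *)
Definition ordinary (p g : nat) (F : finFieldType) (f : {poly F}) : Prop :=
  exists L : {poly int},
    is_Lpoly g f L /\
    forall s : rat, newton_slope p #|F| L s -> s = 0 \/ s = 1.

(* A closed point of the fiber of S° at p is given by a finite extension
   iota : 'F_p -> F and a value t in F; the open subsets of this fiber are its
   intersections with the loci h != 0, for h in F_p[t].
   The family y^2 = x^d + alpha x + t is generically ordinary at p when the
   ordinary locus in the fiber is open and nonempty. *)
Definition generically_ordinary (g d : nat) (alpha : int) (p : nat) : Prop :=
  let in_locus (F : finFieldType) (t : F) :=
    base_point d alpha t /\ ordinary p g (trinomial d alpha%:~R t) in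
  (exists h : {poly 'F_p},
     forall (F : finFieldType) (iota : {rmorphism 'F_p -> F}) (t : F),
       base_point d alpha t ->
       (in_locus F t <-> (map_poly iota h).[t] != 0)) /\
  (exists (F : finFieldType) (iota : {rmorphism 'F_p -> F}) (t : F),
     in_locus F t).

(* Main.v *)
Require Import Defs.
From HB Require Import structures.
From mathcomp Require Import all_boot all_order all_algebra all_field.
From mathcomp Require Import fingroup perm cyclic pgroup abelian.
From mathcomp Require Import zify ring lra.

Set Implicit Arguments.
Unset Strict Implicit.
Unset Printing Implicit Defensive.

Import Order.TTheory GRing.Theory FinRing.Theory Num.Theory.
Local Open Scope ring_scope.

(* The character chi(m) = (Res(f, m) / q) of F_q[x] is periodic modulo f, so its
   L-function is a polynomial; its Euler product counts the points of
   y^2 = f(x), and Poisson summation on F_q[x]/f gives the functional equation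
   relating the coefficients of T^i and T^(2g-i).  Modulo p the point counts are
   traces of powers of the Hasse-Witt matrix A, and p > 2g, so by Newton's
   identities L = det(1 - T A) mod p; with the functional equation, the curve is
   ordinary if and only if det A <> 0, and det A is the norm to F_p of the
   determinant attached to f^((p-1)/2).  For f = x^d + alpha x + t the determinant of the
   latter is a polynomial in t.  The exponents of t in each of its entries are
   congruent modulo d - 1, and the lowest coefficients form a matrix which, up to
   row and column factors, evaluates g polynomials of degree g - 1 at g
   distinct points; these polynomials are independent as soon as
   p > P^+(d), which also excludes degenerate lowest coefficients. *)

(** * Finite fields *)

(** Summing over m requires periodicity modulo f, while counting points requires the values of f at
    the roots of m; so the character is built from the norm of F[x]/f and compared with the point
    counts by reciprocity for resultants. The congruence modulo p does not give the Newton polygon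
    by itself: as A has size g, it yields p | L_k for k > g and decides whether p | L_g. The
    functional equation adds v(L_k) >= k - g, and with v(L_g) = 0 this forces the polygon with
    vertices (0,0), (g,0), (2g,g). For d = 2g+1 the bound P^+(d) is d(2g-3) + 2, the largest of the
    integers that must be nonzero modulo p for the g polynomials to be independent. For d = 2g+2 it
    is g(2g+1): the formal exponent of alpha x in the lowest terms of the first column has to be
    nonnegative, and the estimate for this needs p >= g(2g+1). *)

Section QuadraticCharacter.

Variable F : finFieldType.
Implicit Types x y : F.

(** Euler's criterion serves as the definition, so that a character sum reduces in F to a sum of
    powers; the values are integers because those sums count points. *)
Definition qchar x : int :=
  if x == 0 then 0 else if x ^+ (#|F|.-1./2) == 1 then 1 else -1.

Lemma qchar0 : qchar 0 = 0. Proof. by rewrite /qchar eqxx. Qed.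

Lemma qchar1 : qchar 1 = 1.
Proof. by rewrite /qchar oner_eq0 expr1n eqxx. Qed.

Lemma expf_card_pred x : x != 0 -> x ^+ #|F|.-1 = 1.
Proof.
move=> nx; apply: (mulfI nx); rewrite -exprS mulr1 prednK ?expf_card //.
by rewrite (cardD1 x).
Qed.

Hypothesis F2 : 2%:R != 0 :> F.

Lemma odd_card_finField : odd #|F|.
Proof.
apply/negPn/negP => ev.
have d2 : (2 %| #|[set: F]|)%N by rewrite cardsT dvdn2.
have [x _ ox] := Cauchy (isT : prime 2) d2.
have x0 : x != 0.
  by apply/eqP => x0; move: ox; rewrite x0 -[0]/(1%g) order1.
have : x *+ 2 = 0 by rewrite -zmodXgE -ox expg_order.
by move/eqP; rewrite -mulr_natl mulf_eq0 (negPf F2) (negPf x0).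
Qed.

Lemma card_finField_half : #|F| = (#|F|.-1./2).*2.+1.
Proof.
by have := odd_card_finField; case: #|F| => //= n ev; rewrite even_halfK.
Qed.

Lemma card_finField_pred : #|F|.-1 = (#|F|.-1./2).*2.
Proof. by rewrite {1}card_finField_half. Qed.

Lemma half_card_gt0 : (0 < #|F|.-1./2)%N.
Proof.
have : (1 < #|F|)%N := finNzRing_gt1 F.
by rewrite {1}card_finField_half ltnS double_gt0.
Qed.

(** The exponent [\sum_(i < n) #|F| ^ i] is that of the norm from the extension of degree n: the
    quadratic character of the extension is that of F composed with the norm. *)
Lemma geometric_half_card n :
  ((\sum_(i < n) #|F| ^ i) * (#|F|.-1./2) = (#|F| ^ n).-1./2)%N.
Proof.
have geo k : (#|F| ^ k = (\sum_(i < k) #|F| ^ i) * (#|F|.-1) + 1)%N.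
  elim: k => [|k IH]; first by rewrite big_ord0.
  rewrite big_ord_recr /= mulnDl addnAC -IH expnS.
  by rewrite -{1}[#|F|]prednK ?mulSn 1?mulnC // (ltn_trans _ (finNzRing_gt1 F)).
by rewrite geo addn1 /= [in RHS]card_finField_pred -doubleMr doubleK.
Qed.

Lemma expf_half x : x != 0 -> x ^+ (#|F|.-1./2) = 1 \/ x ^+ (#|F|.-1./2) = -1.
Proof.
move=> nx; have : (x ^+ (#|F|.-1./2)) ^+ 2 = 1.
  rewrite -exprM muln2 -[RHS](expf_card_pred nx); congr (_ ^+ _).
  by rewrite -card_finField_pred.
by move/eqP; rewrite sqrf_eq1 => /orP[]/eqP; [left|right].
Qed.

Lemma opp1_neq1 : -1 != 1 :> F.
Proof. by rewrite eq_sym -subr_eq0 opprK. Qed.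

Lemma qchar_intr x : (qchar x)%:~R = x ^+ (#|F|.-1./2).
Proof.
rewrite /qchar; have [->|nx] := eqVneq x 0.
  by rewrite expr0n; have := half_card_gt0; case: _./2.
by have [->|->] := expf_half nx; rewrite ?eqxx ?(negPf opp1_neq1).
Qed.

Lemma qchar_val x : [\/ qchar x = 0, qchar x = 1 | qchar x = -1].
Proof.
rewrite /qchar; case: ifP => _; first by constructor 1.
by case: ifP => _; [constructor 2|constructor 3].
Qed.

Lemma qchar_inj x (n : int) :
  [\/ n = 0, n = 1 | n = -1] -> n%:~R = x ^+ (#|F|.-1./2) -> qchar x = n.
Proof.
rewrite -qchar_intr.
have [->|->|->] := qchar_val x; case=> -> //= /eqP;
  by rewrite ?mulrNz ?mulr1z ?mulr0z ?[0 == _]eq_sym ?oppr_eq0 ?oner_eq0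
    ?(negPf opp1_neq1) // eq_sym (negPf opp1_neq1).
Qed.

Lemma qcharM x y : qchar (x * y) = qchar x * qchar y.
Proof.
apply: qchar_inj; last by rewrite intrM (qchar_intr x) (qchar_intr y) exprMn.
by case: (qchar_val x) => ->; case: (qchar_val y) => ->;
  solve [by constructor 1 | by constructor 2 | by constructor 3].
Qed.

Lemma qcharX x n : qchar (x ^+ n) = qchar x ^+ n.
Proof. by elim: n => [|n IH]; rewrite ?expr0 ?qchar1 // !exprS qcharM IH. Qed.

Lemma qchar_eq0 x : (qchar x == 0) = (x == 0).
Proof. by rewrite /qchar; case: (x == 0) => //; case: ifP. Qed.

Lemma qchar_sqr x : x != 0 -> qchar x * qchar x = 1.
Proof. by rewrite -qchar_eq0; have [->|->|->] := qchar_val x. Qed.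

Lemma card_unity_le (m : nat) : (0 < m)%N -> (#|[set x : F | (x ^+ m == 1)%R]| <= m)%N.
Proof.
move=> m0; have szp : size ('X^m - 1 : {poly F}) = m.+1 by rewrite size_XnsubC.
rewrite cardE -ltnS -szp; apply: max_poly_roots; rewrite ?enum_uniq //.
- by rewrite -size_poly_eq0 szp.
- by apply/allP => x; rewrite mem_enum inE rootE !hornerE subr_eq0.
Qed.

Lemma nonsquare_exists : exists x, qchar x = -1.
Proof.
case: (pickP (fun x => qchar x == -1)) => [x /eqP|H]; first by exists x.
have : (#|F|.-1 <= #|F|.-1./2)%N.
  apply: leq_trans (card_unity_le half_card_gt0).
  rewrite -[X in (X <= _)%N](cardC1 (0 : F)); apply: subset_leq_card.
  apply/subsetP => x.
  rewrite !inE => nx; have /= := H x; rewrite /qchar (negPf nx).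
  by case: ifP.
by rewrite [X in (X <= _)%N]card_finField_pred; have := half_card_gt0; lia.
Qed.

(** Squaring maps the q - 1 nonzero elements into the at most (q - 1)/2 elements with [qchar] equal
    to 1, with fibres of at most two elements; hence every such fibre has exactly two. *)
Lemma card_sqrt x : (#|[set v : F | (v ^+ 2 == x)%R]|)%:Z = 1 + qchar x.
Proof.
pose c (y : F) := #|[set v : F | (v ^+ 2 == y)%R]|; rewrite -/(c x).
have le2 y : (c y <= 2)%N.
  have szp : size ('X^2 - y%:P : {poly F}) = 3%N by rewrite size_XnsubC.
  rewrite /c cardE -ltnS -szp; apply: max_poly_roots; rewrite ?enum_uniq //.
  - by rewrite -size_poly_eq0 szp.
  - by apply/allP => v; rewrite mem_enum inE rootE !hornerE subr_eq0.
have c0 : c 0 = 1%N.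
  rewrite -(cards1 (0 : F)) /c; congr #|pred_of_set _|; apply/setP => v.
  by rewrite !inE expf_eq0.
have [->|nx] := eqVneq x 0; first by rewrite c0 qchar0.
have [qx|qx] : qchar x = 1 \/ qchar x = -1.
- by move: nx; rewrite -qchar_eq0; have [->|->|->] := qchar_val x; auto.
- rewrite qx; apply/eqP.
  pose A := [set y : F | y ^+ (#|F|.-1./2) == 1].
  have cA : (#|A| <= #|F|.-1./2)%N by apply: card_unity_le half_card_gt0.
  have sumA : (#|F|.-1 = \sum_(y in A) c y)%N.
    rewrite -[LHS](cardC1 (0 : F)) -sum1_card.
    rewrite (partition_big (fun v : F => v ^+ 2) (mem A)) /=; last first.
      move=> v; rewrite !inE => nv; rewrite -exprM -(expf_card_pred nv).
      by rewrite mulnC muln2 -card_finField_pred.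
    apply: eq_bigr => y; rewrite inE => yA; rewrite sum1_card.
    apply: eq_card => v; rewrite !inE.
    change ((v != 0) && (v ^+ 2 == y) = (v ^+ 2 == y)).
    apply: andb_idl => /eqP e.
    apply: contraTneq yA => v0; rewrite -e v0 expr0n /= expr0n.
    by have := half_card_gt0; case: _./2 => //= n _; rewrite eq_sym oner_eq0.
  have xA : x \in A by rewrite inE -qchar_intr qx.
  have : (\sum_(y in A) c y
            <= c x + 2 * (#|A|.-1))%N.
    rewrite (bigD1 x) //= leq_add2l.
    apply: leq_trans (_ : \sum_(i in A | i != x) 2 <= _)%N.
      by apply: leq_sum => i _; apply: le2.
    rewrite sum_nat_const mulnC leq_mul2l /= (cardD1 x A) xA /=.
    apply: subset_leq_card; apply/subsetP => y /andP[yA nyx].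
    by rewrite inE nyx.
  rewrite -sumA; have := le2 x.
  have A0 : (0 < #|A|)%N by rewrite (cardD1 x) xA.
  by have := card_finField_pred; lia.
- rewrite qx /c; suff -> : [set v : F | (v ^+ 2 == x)%R] = set0 by rewrite cards0.
  apply/setP => v; rewrite !inE; apply/negP => /eqP e; move: qx.
  have nv : v != 0 by apply: contraNneq nx => v0; rewrite -e v0 expr0n.
  by rewrite -e expr2 qcharM qchar_sqr.
Qed.

End QuadraticCharacter.

Lemma card_char (F : finFieldType) : #|F|%:R = 0 :> F.
Proof.
have [p pr_p chp] := finPcharP F.
have := expg_cardG (in_setT (1 : F)); rewrite cardsT zmodXgE => e.
exact: e.
Qed.

Lemma card_finField_pchar (F : finFieldType) p :
  p \in [pchar F] -> exists2 m, (0 < m)%N & #|F| = (p ^ m)%N.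
Proof.
move=> chp; have F_gt1 : (1 < #|F|)%N := finNzRing_gt1 F.
have := card_pgroup (abelem_pgroup (fin_ring_pchar_abelem chp)); rewrite cardsT => cF.
exists (logn p #|F|) => //; rewrite lt0n; apply: contraTneq F_gt1 => l0.
by rewrite cF l0.
Qed.

(** The roots of X^m - X, m = q^n, in its splitting field are the fixed points of the n-th power of
    Frobenius; they form a field, hence the whole splitting field, and there are m of them because
    the derivative is -1. *)
Lemma finField_extension (F : finFieldType) n : (0 < n)%N ->
  exists (K : finFieldType) (iota : {rmorphism F -> K}), #|K| = (#|F| ^ n)%N.
Proof.
move=> n_gt0; have F_gt1 : (1 < #|F|)%N := finNzRing_gt1 F.
pose m := (#|F| ^ n)%N; have m_gt1 : (1 < m)%N by rewrite -(exp1n n) ltn_exp2r.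
pose q (R : nzRingType) : {poly R} := 'X^m - 'X.
have szq R : size (q R) = m.+1.
  by rewrite size_polyDl ?size_polyXn // size_polyN size_polyX ltnS.
have q0 : q F != 0 by rewrite -size_poly_eq0 szq.
have [L [zs Dq defL]] := FinSplittingFieldFor q0.
pose K := FinFieldExtType L; exists K, (in_alg L).
rewrite rmorphB rmorphXn /= map_polyX -/(q L) in Dq.
have Uzs : uniq zs.
  rewrite -separable_prod_XsubC -(eqp_separable Dq) unlock /q.
  have mL0 : m%:R = 0 :> L.
    rewrite /m natrX -(rmorph_nat (in_alg L)) card_char rmorph0 expr0n.
    by rewrite -[n]prednK.
  by rewrite derivB derivXn derivX -mulr_natl -polyC_natr mL0 mul0r
    sub0r /separable_poly -(scaleN1r (1 : {poly L}))
    coprimepZr ?oppr_eq0 ?oner_eq0 // coprimep1.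
have [a _ Da] := finField_galois_generator (sub1v {:L}).
rewrite dimv1 expn1 in Da.
pose Em := fixedSpace (a ^+ n)%g.
have in_zs : zs =i Em.
  move=> z; rewrite -root_prod_XsubC -(eqp_root Dq) (sameP fixedSpaceP eqP).
  rewrite rootE /q !hornerE subr_eq0; congr (_ == z).
  rewrite /m; elim: (n) => [|i IHi]; first by rewrite gal_id.
  by rewrite expgSr expnSr exprM IHi galM ?Da ?memvf.
have defEm : Em = {:L}%VS.
  apply/eqP; rewrite eqEsubv subvf -defL -[Em]subfield_closed agenvS //.
  by rewrite subv_add sub1v; apply/span_subvP=> z; rewrite in_zs.
have /eq_card -> : K =i zs by move=> z; rewrite in_zs defEm memvf.
apply: succn_inj; rewrite (card_uniqP _) //= -(size_prod_XsubC _ id).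
by rewrite -(eqp_size Dq) szq.
Qed.

(** * Frobenius orbits and irreducible polynomials *)

Section FiniteExtension.

Variables (F K : finFieldType) (iota : {rmorphism F -> K}).
Local Notation q := #|F|.
Implicit Types (x y : K) (P M : {poly F}).

Lemma frob_iota c : iota c ^+ q = iota c.
Proof. by rewrite -rmorphXn expf_card. Qed.

Lemma frob_fixed y : y ^+ q = y -> exists c, iota c = y.
Proof.
move=> fy; have : root (map_poly iota ('X^q - 'X)) y.
  by rewrite rmorphB rmorphXn /= map_polyX rootE !hornerE fy subrr.
rewrite finField_genPoly rmorph_prod /= (eq_bigr (fun c => 'X - (iota c)%:P)).
  rewrite -(big_map iota xpredT (fun c => 'X - c%:P)) root_prod_XsubC.
  by case/mapP => c _ ->; exists c.
by move=> c _; rewrite rmorphB /= map_polyX map_polyC.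
Qed.

Lemma descend_poly (p : {poly K}) :
  (forall i, p`_i ^+ q = p`_i) -> exists P, map_poly iota P = p.
Proof.
move=> fp; have /fin_all_exists [c Dc] (i : 'I_(size p)) := frob_fixed (fp i).
exists (\poly_(i < size p) if insub i is Some j then c j else 0).
apply/polyP => i; rewrite coef_map coef_poly.
have [lt|le] := ltnP i (size p); last by rewrite raddf0 nth_default.
by rewrite (insubT (fun i => i < size p)%N lt) /= Dc.
Qed.

Lemma card_pcharnat : [pchar K].-nat q.
Proof.
have [r pr_r chr] := finPcharP F.
have chK : r \in [pchar K] by rewrite (fmorph_pchar iota).
rewrite (eq_pnat _ (pcharf_eq chK)) -cardsT.
exact: abelem_pgroup (fin_ring_pchar_abelem chr).
Qed.

Definition frob x := x ^+ q.

Fact frob_is_zmod_morphism : zmod_morphism frob.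
Proof.
move=> x y; apply/eqP; rewrite eq_sym subr_eq /frob -exprDn_pchar ?subrK //.
exact: card_pcharnat.
Qed.

Fact frob_is_monoid_morphism : monoid_morphism frob.
Proof. by split=> [|x y]; rewrite /frob ?expr1n ?exprMn. Qed.

HB.instance Definition _ :=
  GRing.isZmodMorphism.Build K K frob frob_is_zmod_morphism.
HB.instance Definition _ :=
  GRing.isMonoidMorphism.Build K K frob frob_is_monoid_morphism.

Lemma map_poly_frob P : map_poly frob (map_poly iota P) = map_poly iota P.
Proof. by apply/polyP => i; rewrite !coef_map /= /frob frob_iota. Qed.

Lemma horner_frob P x i :
  (map_poly iota P).[x ^+ (q ^ i)] = (map_poly iota P).[x] ^+ (q ^ i).
Proof.
elim: i => [|i IH]; first by rewrite !expr1.
rewrite expnSr !exprM -IH -[_ ^+ q in LHS]/(frob _) -[_ ^+ q in RHS]/(frob _).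
by rewrite -{1}map_poly_frob horner_map.
Qed.

(** Conjugates are repeated when k exceeds the degree of x: for k a multiple of that degree this is
    a power of the minimal polynomial of x over F. *)
Definition frob_orbit k x := \prod_(i < k) ('X - (x ^+ (q ^ i))%:P).

Lemma frob_orbit_monic k x : frob_orbit k x \is monic.
Proof. by apply: monic_prod => i _; apply: monicXsubC. Qed.

Lemma size_frob_orbit k x : size (frob_orbit k x) = k.+1.
Proof. by rewrite size_prod_XsubC /index_enum -enumT size_enum_ord. Qed.

(** Frobenius permutes the k factors cyclically, so it fixes the coefficients, which therefore come
    from F. *)
Lemma frob_orbit_descends k x : (0 < k)%N -> x ^+ (q ^ k) = x ->
  exists2 M, M \is monic & map_poly iota M = frob_orbit k x.
Proof.
case: k => // k _ fx.
have fixed : map_poly frob (frob_orbit k.+1 x) = frob_orbit k.+1 x.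
  rewrite rmorph_prod /= (eq_bigr (fun i : 'I__ => 'X - (x ^+ (q ^ i.+1))%:P)).
    rewrite big_ord_recr /= fx mulrC /frob_orbit big_ord_recl expr1.
    by congr (_ * _); apply: eq_bigr => i _; rewrite lift0.
  move=> i _; rewrite rmorphB /= map_polyX map_polyC /=.
  by rewrite /frob -exprM -expnSr.
have [i|M DM] := @descend_poly (frob_orbit k.+1 x).
  by rewrite -[in RHS]fixed coef_map.
exists M => //; rewrite -(map_monic iota) DM; exact: frob_orbit_monic.
Qed.

Lemma frob_orbitM k e x : x ^+ (q ^ k) = x ->
  frob_orbit (k * e) x = frob_orbit k x ^+ e.
Proof.
move=> fx; elim: e => [|e IH]; first by rewrite muln0 expr0 /frob_orbit big_ord0.
rewrite mulnS exprS -IH /frob_orbit big_split_ord /=.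
congr (_ * _); apply: eq_bigr => i _; do 2![congr (_ - _) || congr (_%:P)].
by rewrite expnD exprM fx.
Qed.

End FiniteExtension.

Lemma irreducible_dvd_genPoly (F : finFieldType) (P : {poly F}) :
  irreducible_poly P -> P \is monic -> P %| 'X^(#|F| ^ (size P).-1) - 'X.
Proof.
move=> irrP monP; have hI : monic_irreducible_poly P by split.
have := @expf_card {poly %/ P with hI} (in_qpoly P 'X).
rewrite card_qfpoly => e.
have {}e : in_qpoly P ('X^(#|F| ^ (size P).-1) - 'X) = 0.
  by rewrite rmorphB rmorphXn /=; apply/eqP; rewrite subr_eq0; apply/eqP.
move/(congr1 val): e => /= /eqP.
by rewrite -Pdiv.IdomainMonic.modpE ?monic_mk_monic // /mk_monic irrP.1 monP.
Qed.

Lemma irreducible_factor (F : finFieldType) (M : {poly F}) :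
  M \is monic -> (1 < size M)%N ->
  exists P, [/\ irreducible_poly P, P \is monic & P %| M].
Proof.
have [n] := ubnP (size M); elim: n M => // n IH M; rewrite ltnS => szM monM M1.
have [irr|] := irreducibleP M; first by exists M.
case: (boolP (irreducibleb M)) => [/irreducibleP //|].
rewrite /irreducibleb M1 /= negb_forall => /existsP[r].
rewrite negb_imply -Pdiv.Idomain.dvdpE -ltnNge => /andP[rM r1] _.
have r0 : lead_coef r != 0 by rewrite lead_coef_eq0 -size_poly_gt0 ltnW.
have szr : (size r < n)%N.
  apply: leq_ltn_trans (size_npoly r) _.
  by rewrite -ltnS prednK ?(ltn_trans _ M1) // (leq_trans _ szM) // ltnS.
have [|||P [irrP monP Pr]] := IH ((lead_coef r)^-1 *: (r : {poly F})).
- by rewrite size_scale ?invr_eq0.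
- by rewrite monicE lead_coefZ mulVf.
- by rewrite size_scale ?invr_eq0.
exists P; split => //; apply: dvdp_trans rM.
by apply: dvdp_trans Pr _; rewrite dvdpZl ?invr_eq0.
Qed.

Section IrreducibleRoots.

Variables (F K : finFieldType) (iota : {rmorphism F -> K}).
Local Notation q := #|F|.
Implicit Types (x y : K) (P M : {poly F}).

Lemma irreducible_root_dvd P M x : irreducible_poly P ->
  root (map_poly iota P) x -> root (map_poly iota M) x -> P %| M.
Proof.
move=> irrP Px Mx; have [g1|] := irredp_XsubCP irrP (dvdp_gcdl P M); last first.
  by move=> e; rewrite -(eqp_dvdl _ e) dvdp_gcdr.
have : root (map_poly iota (gcdp P M)) x.
  by rewrite gcdp_map root_gcd Px.
rewrite -(eqp_map iota) rmorph1 in g1.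
by rewrite (eqp_root g1) rootE -polyC1 hornerC oner_eq0.
Qed.

Lemma irreducible_root_frob_orbit P x :
  irreducible_poly P -> P \is monic -> root (map_poly iota P) x ->
  x ^+ (q ^ (size P).-1) = x /\ map_poly iota P = frob_orbit F (size P).-1 x.
Proof.
move=> irrP monP Px; have k0 : (0 < (size P).-1)%N by have := irrP.1; case: size => [|[]].
have fx : x ^+ (q ^ (size P).-1) = x.
  have := irreducible_dvd_genPoly irrP monP.
  rewrite -(dvdp_map iota) rmorphB rmorphXn /= map_polyX => dv.
  rewrite -dvdp_XsubCl in Px.
  by have := dvdp_trans Px dv; rewrite dvdp_XsubCl rootE !hornerE subr_eq0 => /eqP.
split=> //; have [M monM DM] := frob_orbit_descends iota k0 fx.
have PM : P %| M.
  apply: irreducible_root_dvd irrP Px _; rewrite DM.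
  by rewrite -dvdp_XsubCl /frob_orbit -(prednK k0) big_ord_recl expr1 dvdp_mulr.
have szM : size M = (size P).-1.+1.
  by rewrite -(size_frob_orbit F (size P).-1 x) -DM size_map_poly.
have szP : size P = size M by rewrite szM prednK // ltnW // irrP.1.
by move/eqP: szP; rewrite dvdp_size_eqp // eqp_monic // => /eqP e; rewrite -DM -e.
Qed.

Variable j : nat.
Hypotheses (j0 : (0 < j)%N) (cK : #|K| = (q ^ j)%N).

Lemma frob_iter_card x : x ^+ (q ^ j) = x.
Proof. by rewrite -cK expf_card. Qed.

Lemma exists_irreducible_root (x : K) :
  exists P, [/\ irreducible_poly P, P \is monic & root (map_poly iota P) x].
Proof.
have [M monM DM] := frob_orbit_descends iota j0 (frob_iter_card x).
have : root (map_poly iota M) x.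
  by rewrite DM -dvdp_XsubCl /frob_orbit -(prednK j0) big_ord_recl expr1 dvdp_mulr.
have [n] := ubnP (size M).
elim: n M monM {DM} => // n IH M monM; rewrite ltnS => szM Mx.
have M1 : (1 < size M)%N.
  rewrite ltnNge; apply: contraL Mx => le.
  have M1 : M = 1.
    have := monM; rewrite (size1_polyC le) monicE lead_coefC => /eqP ->.
    by rewrite polyC1.
  by rewrite M1 rmorph1 rootE -polyC1 hornerC oner_eq0.
have [P [irrP monP /dvdpP[s Ds]]] := irreducible_factor monM M1.
have : root (map_poly iota s) x || root (map_poly iota P) x.
  by rewrite -rootM -rmorphM -Ds.
case/orP=> [sx|Px]; last by exists P.
have mons : s \is monic by rewrite -(monicMr s monP) -Ds.
apply: IH sx => //; apply: leq_trans szM.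
rewrite Ds size_Mmonic ?monic_neq0 //.
have lt a b : (0 < a -> 1 < b -> a < (a + b).-1)%N by lia.
by apply: lt irrP.1; rewrite size_poly_gt0 monic_neq0.
Qed.

Lemma irreducible_root_uniq P1 P2 x :
  irreducible_poly P1 -> P1 \is monic -> root (map_poly iota P1) x ->
  irreducible_poly P2 -> P2 \is monic -> root (map_poly iota P2) x -> P1 = P2.
Proof.
move=> irr1 mon1 r1 irr2 mon2 r2; apply/eqP.
rewrite -eqp_monic // /eqp (irreducible_root_dvd irr1 r1 r2).
exact: irreducible_root_dvd irr2 r2 r1.
Qed.

(** Otherwise x is fixed by the Frobenius power of exponent r = j mod deg P, and its orbit
    polynomial of length r would be a multiple of P of smaller degree. *)
Lemma irreducible_root_deg P x :
  irreducible_poly P -> P \is monic -> root (map_poly iota P) x ->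
  ((size P).-1 %| j)%N.
Proof.
move=> irrP monP Px; have k0 : (0 < (size P).-1)%N by have := irrP.1; case: size => [|[]].
have [fx _] := irreducible_root_frob_orbit irrP monP Px.
have fxm n : x ^+ (q ^ ((size P).-1 * n)) = x.
  by elim: n => [|n IH]; rewrite ?muln0 ?expr1 // mulnS expnD exprM fx.
pose r := (j %% (size P).-1)%N.
have fr : x ^+ (q ^ r) = x.
  have := frob_iter_card x; rewrite {1}(divn_eq j (size P).-1) mulnC.
  by rewrite expnD exprM fxm.
rewrite /dvdn -/r; apply/negPn/negP; rewrite -lt0n => r0.
have [M monM DM] := frob_orbit_descends iota r0 fr.
have PM : P %| M.
  apply: irreducible_root_dvd irrP Px _; rewrite DM.
  by rewrite -dvdp_XsubCl /frob_orbit -(prednK r0) big_ord_recl expr1 dvdp_mulr.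
have := dvdp_leq (monic_neq0 monM) PM.
rewrite -(size_map_poly iota M) DM size_frob_orbit.
have : (r < (size P).-1)%N by rewrite ltn_mod.
have lt a b : (a < b.-1 -> 1 < b -> b <= a.+1 -> False)%N by lia.
by move=> h1 h2; apply: lt h1 irrP.1 h2.
Qed.

(** P divides X^(q^j) - X, the product of all X - x with x in K, so its roots in K are simple and
    all present. *)
Lemma card_irreducible_roots P :
  irreducible_poly P -> P \is monic -> ((size P).-1 %| j)%N ->
  #|[set x | root (map_poly iota P) x]| = (size P).-1.
Proof.
move=> irrP monP /dvdnP[e De].
have dvd : map_poly iota P %| \prod_(x : K) ('X - x%:P).
  rewrite -finField_genPoly.
  apply: dvdp_trans (_ : 'X^(q ^ (size P).-1) - 'X %| _).
    have := irreducible_dvd_genPoly irrP monP.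
    by rewrite -(dvdp_map iota) rmorphB rmorphXn /= map_polyX.
  rewrite cK De mulnC; elim: e {De} => [|e IH].
    by rewrite muln0 expr1 subrr dvdp0.
  have nat_q : [pchar {poly K}].-nat (q ^ ((size P).-1 * e))%N.
    have := card_pcharnat iota => h.
    rewrite pnatX; apply/orP; left.
    move: h; rewrite /pnat => /andP[-> /allP h] /=; apply/allP => l /h.
    rewrite !inE => /andP[-> ] /=; rewrite -polyC_natr => /eqP ->.
    by rewrite eqxx.
  rewrite mulnS expnD exprM.
  have -> : 'X^(q ^ (size P).-1) ^+ (q ^ ((size P).-1 * e)) - 'X =
    ('X^(q ^ (size P).-1) - 'X) ^+ (q ^ ((size P).-1 * e)) +
    ('X^(q ^ ((size P).-1 * e)) - 'X) :> {poly K}.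
    rewrite addrA; congr (_ - _); rewrite -exprDn_pchar ?subrK //.
  rewrite dvdp_addl ?IH //; apply: dvdp_exp => //.
  by rewrite expn_gt0 (ltn_trans _ (finNzRing_gt1 F)).
have [m Dm] := dvdp_prod_XsubC dvd.
have Em : map_poly iota P = \prod_(x <- mask m (index_enum K)) ('X - x%:P).
  by apply/eqP; rewrite -eqp_monic ?monic_prod_XsubC ?map_monic.
have szm : size (mask m (index_enum K)) = (size P).-1.
  by rewrite -(size_map_poly iota P) Em size_prod_XsubC.
rewrite -szm cardE; apply/perm_size/uniq_perm; rewrite ?enum_uniq //.
  by rewrite mask_uniq // index_enum_uniq.
by move=> x; rewrite mem_enum inE Em root_prod_XsubC.
Qed.

End IrreducibleRoots.

(** * The Euler product *)

Section EulerProduct.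

Variable F : finFieldType.
Implicit Types (P m s : {poly F}).

Definition polys n : seq {poly F} := [seq rVpoly v | v <- enum 'rV[F]_n].

Lemma mem_polys n p : (p \in polys n) = (size p <= n)%N.
Proof.
apply/mapP/idP => [[v _ ->]|le]; first exact: size_poly.
by exists (poly_rV p); rewrite ?mem_enum // poly_rV_K.
Qed.

Lemma polys_uniq n : uniq (polys n).
Proof. by rewrite map_inj_uniq ?enum_uniq //; apply: can_inj rVpolyK. Qed.

Definition monics n : seq {poly F} := [seq 'X^n + r | r <- polys n].

Lemma mem_monics n p : (p \in monics n) = (p \is monic) && (size p == n.+1).
Proof.
apply/mapP/andP => [[r]|[monp /eqP szp]].
  rewrite mem_polys -ltnS -(size_polyXn F n) => lt ->.
  by rewrite size_polyDl // size_polyXn eqxx monicE lead_coefDl // lead_coefXn.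
exists (p - 'X^n); last by rewrite addrC subrK.
rewrite mem_polys; apply/leq_sizeP => i; rewrite leq_eqVlt coefB coefXn.
case/predU1P => [<-|lt].
  by move: monp; rewrite monicE lead_coefE szp => /eqP ->; rewrite eqxx subrr.
by rewrite gtn_eqF // subr0 nth_default // szp.
Qed.

Lemma monics_uniq n : uniq (monics n).
Proof. by rewrite map_inj_uniq ?polys_uniq //; apply: addrI. Qed.

Definition irrs n := [seq P <- polys n.+1 | (P \is monic) && irreducibleb P].

Lemma mem_irrs n P : P \in irrs n =
  [&& P \is monic, irreducibleb P & ((size P).-1 <= n)%N].
Proof. by rewrite mem_filter mem_polys -andbA -subn1 leq_subLR add1n. Qed.

Lemma irrs_uniq n : uniq (irrs n).
Proof. by rewrite filter_uniq ?polys_uniq. Qed.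

Lemma irrsP n P : P \in irrs n ->
  [/\ irreducible_poly P, P \is monic & ((size P).-1 <= n)%N].
Proof. by rewrite mem_irrs => /and3P[? /irreducibleP]. Qed.

Lemma irreducible_exp_dvd_mul N P P0 s e :
  P \in irrs N -> P0 \in irrs N -> P != P0 -> (P ^+ e %| s * P0) = (P ^+ e %| s).
Proof.
move=> /irrsP[irrP monP _] /irrsP[irr0 mon0 _] ne.
rewrite Gauss_dvdpl // coprimep_expl //.
have [g1|g2] := irredp_XsubCP irrP (dvdp_gcdl P P0); first by rewrite /coprimep size_poly_eq1.
have PP0 : P %| P0 by rewrite -(eqp_dvdl _ g2) dvdp_gcdr.
have [|e2] := irredp_XsubCP irr0 PP0.
  by move/eqp_size; rewrite size_poly1 => s1; have := irrP.1; rewrite s1.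
by move: ne; rewrite -eqp_monic // e2.
Qed.

(* [deg m] as the sum of the von Mangoldt function over the divisors of [m]. *)
Lemma count_prime_powers N m : m \is monic -> (size m <= N.+1)%N ->
  (\sum_(P <- irrs N) (\sum_(1 <= e < N.+1) (P ^+ e %| m)%R) * (size P).-1
     = (size m).-1)%N.
Proof.
have [n] := ubnP (size m); elim: n m => // n IH m; rewrite ltnS => szm monm le_m.
have [m1|m1] := leqP (size m) 1.
  have -> : m = 1.
    have := monm; rewrite (size1_polyC m1) monicE lead_coefC => /eqP ->.
    by rewrite polyC1.
  rewrite size_poly1 big_seq big1 // => P /irrsP[irrP monP _].
  rewrite big_nat big1 // => e /andP[e0 _].
  have : (0 < (size P).-1 * e)%N.
    by rewrite muln_gt0 e0; have := irrP.1; case: size => [|[]].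
  by rewrite dvdp1 -size_exp; case: eqP => // ->.
have [P0 [irr0 mon0 /dvdpP[s Ds]]] := irreducible_factor monm m1.
have mons : s \is monic by rewrite -(monicMr s mon0) -Ds.
have s0 : (0 < size s)%N by rewrite size_poly_gt0 monic_neq0.
have szD : size m = (size s + (size P0).-1)%N.
  rewrite Ds size_Mmonic ?monic_neq0 //.
  have e2 a b : (1 < b -> (a + b).-1 = a + b.-1)%N by lia.
  exact: e2 irr0.1.
have P0_gt0 : (0 < (size P0).-1)%N by have := irr0.1; case: size => [|[]].
have lt_s : (size s < size m)%N by rewrite szD -[X in (X < _)%N]addn0 ltn_add2l.
have irr0N : P0 \in irrs N.
  rewrite mem_irrs mon0 (introT (irreducibleP _)) //=.
  by rewrite -ltnS (leq_trans _ le_m) // szD -[X in (X < _)%N]add0n ltn_add2r.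
have {}IH := IH s (leq_trans lt_s szm) mons (leq_trans (ltnW lt_s) le_m).
have N0 : (0 < N)%N.
  by move: irr0N => /irrsP[_ _]; apply: leq_trans.
have cnt P : P \in irrs N -> (\sum_(1 <= e < N.+1) (P ^+ e %| m)%R =
    \sum_(1 <= e < N.+1) (P ^+ e %| s)%R + (P == P0))%N.
  move=> PN; have [->|ne] := eqVneq P P0; last first.
    rewrite addn0; apply: eq_bigr => e _.
    by rewrite Ds (irreducible_exp_dvd_mul _ _ PN irr0N).
  rewrite big_add1 /= (eq_bigr (fun e => (P0 ^+ e %| s)%R : nat)); last first.
    by move=> e _; rewrite Ds exprSr dvdp_mul2r // monic_neq0.
  rewrite -[N in LHS]prednK // big_nat_recl // expr0 dvd1p addn1 -add1n.
  rewrite add1n [in RHS]big_nat_recr //=.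
  (* [P0 ^+ N] has degree at least N, more than the degree of s, so truncating the exponents at N
     loses nothing. *)
  have -> : (P0 ^+ N %| s) = false.
    apply/negP => /(dvdp_leq (monic_neq0 mons)).
    rewrite leqNgt; move/negP; apply.
    rewrite -ltnS; apply: leq_trans (_ : N.+1 < _)%N.
      by rewrite ltnS (leq_trans lt_s le_m).
    have : (N <= (size (P0 ^+ N)).-1)%N by rewrite size_exp leq_pmull.
    have : (0 < size (P0 ^+ N))%N by rewrite size_poly_gt0 monic_neq0 ?monic_exp.
    by move=> h1 h2; rewrite !ltnS -(prednK h1) ltnS.
  by rewrite addn0 add1n [in RHS]big_add1.
rewrite big_seq (eq_bigr (fun P => (\sum_(1 <= e < N.+1) (P ^+ e %| s)%R)
   * (size P).-1 + (P == P0) * (size P).-1)%N); last first.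
  by move=> P PN; rewrite cnt // mulnDl.
rewrite -big_seq big_split /= IH [X in (_ + X)%N](bigD1_seq P0) ?irrs_uniq //=.
rewrite eqxx mul1n big1 ?addn0; last by move=> P /negPf ->.
by rewrite szD; case: (size s) s0.
Qed.

Variable chi : {poly F} -> int.
Hypotheses (chi1 : chi 1 = 1) (chiM : {morph chi : p q / p * q}).

Lemma chiX P e : chi (P ^+ e) = chi P ^+ e.
Proof. by elim: e => [|e IH]; rewrite ?expr0 ?chi1 // !exprS chiM IH. Qed.

Definition dirichlet_coef n := \sum_(m <- monics n) chi m.

Lemma dirichlet_coef0 : dirichlet_coef 0 = 1.
Proof.
rewrite /dirichlet_coef (perm_big [:: 1]) ?big_seq1 ?chi1 //.
apply: uniq_perm; rewrite ?monics_uniq // => p.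
rewrite mem_monics inE; apply/andP/eqP => [[monp /eqP szp]|->]; last first.
  by rewrite monic1 size_poly1.
have le1 : (size p <= 1)%N by rewrite szp.
have := monp; rewrite (size1_polyC le1) monicE lead_coefC => /eqP ->.
by rewrite polyC1.
Qed.

Lemma sum_monics_dvd n P : P \is monic ->
  \sum_(m <- monics n | P %| m) chi m =
    if ((size P).-1 <= n)%N then chi P * dirichlet_coef (n - (size P).-1) else 0.
Proof.
move=> monP; have szP : (0 < size P)%N by rewrite size_poly_gt0 monic_neq0.
case: leqP => [le|gt]; last first.
  rewrite big_seq_cond big1 // => m; rewrite mem_monics => /andP[/andP[monm /eqP szm]].
  move/(dvdp_leq (monic_neq0 monm)); rewrite szm leqNgt.
  by rewrite -(prednK szP) ltnS gt.
rewrite mulr_sumr -big_filter (perm_big [seq P * s | s <- monics (n - (size P).-1)]).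
  by rewrite big_map; apply: eq_bigr => s _; rewrite chiM.
apply: uniq_perm; rewrite ?filter_uniq ?monics_uniq //.
  by rewrite map_inj_uniq ?monics_uniq //; apply: mulfI; rewrite monic_neq0.
move=> m; rewrite mem_filter mem_monics; apply/and3P/mapP.
  case=> /dvdpP[s ->] monm /eqP szm; exists s; last by rewrite mulrC.
  have mons : s \is monic by rewrite -(monicMr s monP).
  rewrite mem_monics mons /=; move: szm.
  rewrite size_Mmonic ?monic_neq0 //.
  have ar a b : (0 < b -> b.-1 <= n -> (a + b).-1 = n.+1 -> a == (n - b.-1).+1)%N by lia.
  exact: ar.
case=> s; rewrite mem_monics => /andP[mons /eqP szs] ->.
rewrite dvdp_mulr // monicMl // mons mulrC size_Mmonic ?monic_neq0 // szs.
split=> //.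
have ar b : (0 < b -> b.-1 <= n -> ((n - b.-1).+1 + b).-1 == n.+1)%N by lia.
exact: ar.
Qed.

(** This is T L' = L \sum_j S_j T^j, the logarithmic derivative of the Euler product.
    Coefficientwise: in the sum of (deg m) chi(m), expand deg m over the prime powers P^e dividing
    m, and collect m = P^e m'. *)
Lemma dirichlet_coef_rec n (S : nat -> int) :
  (forall j, (0 < j <= n)%N -> S j = \sum_(P <- irrs n | ((size P).-1 %| j)%N)
      chi P ^+ (j %/ (size P).-1) *+ (size P).-1) ->
  dirichlet_coef n *+ n = \sum_(1 <= j < n.+1) S j * dirichlet_coef (n - j).
Proof.
move=> HS; transitivity (\sum_(P <- irrs n) \sum_(1 <= e < n.+1)
   (if (e * (size P).-1 <= n)%N
    then chi P ^+ e * dirichlet_coef (n - e * (size P).-1) else 0) *+ (size P).-1).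
  transitivity (\sum_(m <- monics n) \sum_(P <- irrs n) \sum_(1 <= e < n.+1 | P ^+ e %| m)
     chi m *+ (size P).-1).
    rewrite /dirichlet_coef -sumrMnl big_seq [RHS]big_seq; apply: eq_bigr => m.
    rewrite mem_monics => /andP[monm /eqP szm].
    rewrite -[X in _ *+ X](_ : (size m).-1 = n); last by rewrite szm.
    rewrite -(@count_prime_powers n) ?szm // -sumrMnr.
    apply: eq_bigr => P _; rewrite mulnC mulrnA -sumrMnr [RHS]big_mkcond /=.
    by apply: eq_bigr => e _; case: (_ %| _); rewrite ?mulr1n ?mulr0n.
  rewrite exchange_big big_seq [RHS]big_seq; apply: eq_bigr => P /irrsP[irrP monP _].
  rewrite (exchange_big_dep xpredT) //=; apply: eq_bigr => e _.
  by rewrite sumrMnl sum_monics_dvd ?monic_exp // size_exp mulnC chiX.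
rewrite [RHS]big_nat (eq_bigr (fun j => \sum_(P <- irrs n | ((size P).-1 %| j)%N)
      chi P ^+ (j %/ (size P).-1) * dirichlet_coef (n - j) *+ (size P).-1)); last first.
  move=> j jn; rewrite HS // mulr_suml; apply: eq_bigr => P _.
  by rewrite mulrnAl.
rewrite -big_nat [RHS](exchange_big_dep xpredT) //= big_seq [RHS]big_seq.
apply: eq_bigr => P /irrsP[irrP monP _].
have P_gt0 : (0 < (size P).-1)%N by have := irrP.1; case: size => [|[]].
set k := (size P).-1 in P_gt0 *.
rewrite -[RHS]big_filter [RHS](perm_big
  [seq (e * k)%N | e <- index_iota 1 n.+1 & (e * k <= n)%N]); last first.
  apply: uniq_perm; rewrite ?filter_uniq ?iota_uniq //.
    by rewrite map_inj_uniq ?filter_uniq ?iota_uniq // => a b /eqP; rewrite eqn_pmul2r // => /eqP.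
  move=> j; rewrite mem_filter mem_index_iota; apply/and3P/mapP.
    case=> /dvdnP[e ->]; rewrite muln_gt0 ltnS => /andP[e0 _] le.
    exists e => //; rewrite mem_filter le mem_index_iota e0 ltnS.
    by apply: leq_trans le; apply: leq_pmulr.
  case=> e; rewrite mem_filter mem_index_iota => /and3P[le e0 _] ->.
  by rewrite dvdn_mull // muln_gt0 e0 P_gt0 ltnS.
rewrite big_map big_filter [RHS]big_mkcond /=; apply: eq_bigr => e _.
by case: ifP => _; rewrite ?mulnK // mul0rn.
Qed.

(** The elements of K are grouped by their minimal polynomials over F. *)
Lemma sum_over_extension (K : finFieldType) (iota : {rmorphism F -> K}) n j
    (a : K -> int) :
  (0 < j <= n)%N -> #|K| = (#|F| ^ j)%N ->
  (forall P x, irreducible_poly P -> P \is monic -> root (map_poly iota P) x ->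
     a x = chi P ^+ (j %/ (size P).-1)) ->
  \sum_x a x = \sum_(P <- irrs n | ((size P).-1 %| j)%N)
      chi P ^+ (j %/ (size P).-1) *+ (size P).-1.
Proof.
move=> /andP[j0 jn] cK Ha.
transitivity (\sum_x \sum_(P <- irrs n | root (map_poly iota P) x) a x).
  apply: eq_bigr => x _.
  have [Q [irrQ monQ Qx]] := exists_irreducible_root iota j0 cK x.
  have Qn : Q \in irrs n.
    rewrite mem_irrs monQ (introT (irreducibleP _)) //=; apply: leq_trans jn.
    by apply: (dvdn_leq j0); apply: (irreducible_root_deg j0 cK irrQ monQ Qx).
  rewrite -big_filter (perm_big [:: Q]) ?big_seq1 //.
  apply: uniq_perm; rewrite ?(filter_uniq _ (irrs_uniq n)) // => P.
  rewrite mem_filter inE; apply/andP/eqP => [[Px /irrsP[irrP monP _]]|->] //.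
  exact: (irreducible_root_uniq irrP monP Px irrQ monQ Qx).
rewrite (exchange_big_dep xpredT) //= [RHS]big_mkcond big_seq [RHS]big_seq.
apply: eq_bigr => P /irrsP[irrP monP _].
case: ifP => [dv|ndv]; last first.
  rewrite big1 // => x Px.
  by rewrite (irreducible_root_deg j0 cK irrP monP Px) in ndv.
rewrite (eq_bigr (fun=> chi P ^+ (j %/ (size P).-1))); last first.
  by move=> x Px; apply: Ha.
rewrite sumr_const -(card_irreducible_roots iota cK irrP monP dv).
by congr (_ *+ _); apply: eq_card => x; rewrite inE.
Qed.

End EulerProduct.

(** * Newton's identities *)

Section NewtonIdentities.

Variable R : comNzRingType.

Lemma newton_prod (s : seq R) (L := \prod_(b <- s) (1 - b *: 'X)) n :
  L`_n *+ n = - \sum_(1 <= j < n.+1) (\sum_(b <- s) b ^+ j) * L`_(n - j).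
Proof.
rewrite {}/L; elim: s n => [|b s IH] n.
  rewrite big_nil coef1; case: n => [|n]; first by rewrite big_geq ?mulr0n ?oppr0.
  by rewrite mul0rn big1 ?oppr0 // => j _; rewrite !big_nil mul0r.
rewrite big_cons; set L := \prod_(c <- s) _ in IH *.
case: n => [|n]; first by rewrite big_geq ?mulr0n ?oppr0.
have coefM k : ((1 - b *: 'X) * L)`_k.+1 = L`_k.+1 - b * L`_k.
  by rewrite mulrBl mul1r -scalerAl coefB coefZ coefXM.
have coefM0 : ((1 - b *: 'X) * L)`_0 = L`_0.
  by rewrite mulrBl mul1r -scalerAl coefB coefZ coefXM mulr0 subr0.
(* \sum_(j > 0) b^j T^j times (1 - bT) L collapses to bT L. *)
have tele k : \sum_(1 <= j < k.+2) b ^+ j * ((1 - b *: 'X) * L)`_(k.+1 - j)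
    = b * L`_k.
  elim: k => [|k IHk]; first by rewrite big_nat1 subnn coefM0.
  rewrite big_nat_recl // subSS subn0 coefM.
  have -> : \sum_(1 <= i < k.+2) b ^+ i.+1 * ((1 - b *: 'X) * L)`_(k.+2 - i.+1)
     = b * (b * L`_k).
    rewrite -IHk mulr_sumr; apply: eq_bigr => i _.
    by rewrite subSS exprS mulrA.
  by rewrite expr1 mulrBr subrK.
have main : \sum_(1 <= j < n.+2) (\sum_(c <- s) c ^+ j) * ((1 - b *: 'X) * L)`_(n.+1 - j)
   = - (L`_n.+1 *+ n.+1) + b * (L`_n *+ n).
  rewrite (IH n) (IH n.+1) opprK mulrN mulr_sumr.
  rewrite !(big_nat_recr n.+1) //= subnn coefM0.
  rewrite addrAC -sumrB; congr (_ + _).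
  apply: eq_big_nat => i /andP[_ lt].
  by rewrite subSn // coefM; ring.
rewrite coefM (eq_bigr (fun j => b ^+ j * ((1 - b *: 'X) * L)`_(n.+1 - j) +
   (\sum_(c <- s) c ^+ j) * ((1 - b *: 'X) * L)`_(n.+1 - j))); last first.
  by move=> j _; rewrite big_cons mulrDl.
rewrite big_split /= tele main mulrnBl -mulrnAr.
by rewrite [L`_n *+ n.+1]mulrS; ring.
Qed.

Lemma deriv_prod_ord n (f : 'I_n -> {poly R}) :
  (\prod_i f i)^`() = \sum_i (f i)^`() * \prod_(k | i != k) f k.
Proof.
elim: n f => [|n IH] f; first by rewrite !big_ord0 -polyC1 derivC.
rewrite !big_ord_recl derivM IH mulr_sumr; congr (_ + _).
  congr (_ * _); rewrite [RHS]big_mkcond big_ord_recl /= mul1r.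
  by apply: eq_bigr => i _.
apply: eq_bigr => i _; rewrite mulrCA; congr (_ * _).
rewrite [RHS]big_mkcond big_ord_recl /=; congr (_ * _).
by rewrite big_mkcond; apply: eq_bigr => k _; rewrite (inj_eq lift_inj).
Qed.

Section Matrix.

Variables (N : nat) (A : 'M[R]_N.+1).
Local Notation M := (char_poly_mx A).

(** Jacobi's formula: only the diagonal entries of X - A depend on X, with derivative 1, so
    differentiating the determinant leaves the principal cofactors. *)
Lemma trace_adj_char_poly_mx : \tr (\adj M) = (char_poly A)^`().
Proof.
rewrite /char_poly /determinant raddf_sum /mxtrace.
rewrite (eq_bigr (fun s : {perm 'I_N.+1} => \sum_i (s i == i)%:R * ((-1) ^+ s *
    \prod_(k | i != k) M k (s k)))); last first.
  move=> s _; rewrite -signr_odd; case: (odd_perm s) => /=.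
    rewrite expr1 mulN1r derivN deriv_prod_ord -sumrN; apply: eq_bigr => i _.
    rewrite mulN1r mulrN; congr (- (_ * _)); rewrite !mxE derivB derivC subr0 derivMn derivX.
    by rewrite eq_sym.
  rewrite expr0 mul1r deriv_prod_ord; apply: eq_bigr => i _.
  rewrite mul1r; congr (_ * _); rewrite !mxE derivB derivC subr0 derivMn derivX.
  by rewrite eq_sym.
rewrite exchange_big /=; apply: eq_bigr => i _.
rewrite mxE expand_cofactor big_mkcond /=; apply: eq_bigr => s _.
by case: eqP; rewrite ?mul1r ?mul0r.
Qed.

(* The coefficients of [det (1 - T A)]. *)
Definition rev_char_poly_coef n :=
  if (n <= N.+1)%N then (char_poly A)`_(N.+1 - n) else 0.
Local Notation e := rev_char_poly_coef.

(** Coefficient matrices of adj(X - A); comparing powers of X in adj(X - A) (X - A) = det(X - A)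
    gives the Faddeev-LeVerrier recursion. *)
Let B k := map_mx (coefp k) (\adj M).

Let B_rec k : B k = B k.+1 *m A + ((char_poly A)`_k.+1)%:M.
Proof.
have := mul_adj_mx M; rewrite -/(char_poly A).
move/(congr1 (map_mx (coefp k.+1))); rewrite /char_poly_mx mulmxBr.
rewrite mul_mx_scalar.
have -> : map_mx (coefp k.+1) ('X *: \adj M - \adj M *m map_mx polyC A) =
    B k - B k.+1 *m A.
  apply/matrixP => i j; rewrite !mxE /= coefB coefXM /= coef_sum.
  congr (_ - _); apply: eq_bigr => l _; rewrite !mxE coefMC //.
move=> E; apply/eqP; rewrite addrC -subr_eq E; apply/eqP/matrixP => i j.
by rewrite !mxE /= coefMn.
Qed.

Let B0 : B 0 *m A + ((char_poly A)`_0)%:M = 0.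
Proof.
have := mul_adj_mx M; rewrite -/(char_poly A).
move/(congr1 (map_mx (coefp 0))); rewrite /char_poly_mx mulmxBr mul_mx_scalar.
have -> : map_mx (coefp 0) ('X *: \adj M - \adj M *m map_mx polyC A) =
    - (B 0 *m A).
  apply/matrixP => i j; rewrite !mxE /= coefB coefXM /= coef_sum sub0r.
  by congr (- _); apply: eq_bigr => l _; rewrite !mxE coefMC.
move=> E; apply/eqP; rewrite addrC addr_eq0 E; apply/eqP/matrixP => i j.
by rewrite !mxE /= coefMn.
Qed.

(** Above degree N the characteristic polynomial no longer contributes to the recursion, so
    vanishing propagates downwards from any bound on the degrees of the entries. *)
Let B_big k : (N < k)%N -> B k = 0.
Proof.
pose m := \max_(p : 'I_N.+1 * 'I_N.+1) size ((\adj M) p.1 p.2).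
have Bm i : (m <= i)%N -> B i = 0.
  move=> le; apply/matrixP => a b; rewrite !mxE /= nth_default //.
  have := leq_trans (leq_bigmax (a, b)) le; rewrite /= mxE; exact.
move=> ltk; have : B (k + m) = 0 by rewrite Bm // leq_addl.
elim: (m) => [|t IH]; rewrite ?addn0 // addnS => Bt; apply: IH.
rewrite B_rec Bt mul0mx nth_default ?size_char_poly ?ltnS ?ltn_addr //.
by rewrite -scalemx1 scale0r addr0.
Qed.

(** Coefficient of T^n in adj(1 - TA), which equals det(1 - TA) \sum_i T^i A^i. *)
Let D n := if (n <= N)%N then B (N - n) else 0.

Let D_rec n : D n.+1 = D n *m A + (e n.+1)%:M.
Proof.
rewrite /D /e ltnS subSS; case: ltngtP => [lt|lt|->].
- by rewrite B_rec subnSK.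
- by rewrite mul0mx add0r -scalemx1 scale0r.
- by rewrite subnn B0.
Qed.

Let D_sum n : D n = \sum_(i < n.+1) e (n - i) *: A ^+ i.
Proof.
elim: n => [|n IH].
  rewrite big_ord1 /D /e /= !subn0 B_rec B_big // mul0mx add0r expr0.
  by rewrite -[in LHS]scalemx1.
rewrite D_rec IH [in RHS]big_ord_recl subn0 expr0 addrC -scalemx1.
congr (_ + _).
rewrite mulmx_suml; apply: eq_bigr => i _.
by rewrite lift0 subSS -scalemxAl exprSr.
Qed.

(** The trace of [D n] is computed twice: as a coefficient of the derivative of the characteristic
    polynomial, giving N + 1 - n times [e n], and from the expansion of [D n] in powers of A. *)
Lemma newton_char_poly n :
  e n *+ n = - \sum_(1 <= j < n.+1) \tr (A ^+ j) * e (n - j).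
Proof.
have trD : \tr (D n) + e n *+ n = e n *+ N.+1.
  rewrite /D /e; case: ltngtP => [lt|lt|->].
  - have -> : \tr (B (N - n)) = ((char_poly A)^`())`_(N - n).
      rewrite -trace_adj_char_poly_mx /mxtrace coef_sum.
      by apply: eq_bigr => i _; rewrite mxE.
    rewrite (leqW (ltnW lt)) coef_deriv -subSn ?(ltnW lt) // -mulrnDr subnK //.
    by rewrite (leqW (ltnW lt)).
  - case: ifP => [le|_]; last by rewrite mxtrace0 !mul0rn addr0.
    by rewrite mxtrace0 add0r; congr (_ *+ _); apply/eqP; rewrite eqn_leq le.
  - have -> : \tr (B (N - N)) = ((char_poly A)^`())`_(N - N).
      rewrite -trace_adj_char_poly_mx /mxtrace coef_sum.
      by apply: eq_bigr => i _; rewrite mxE.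
    by rewrite leqnSn coef_deriv -subSn // -mulrnDr subnK.
have : \tr (D n) = e n *+ N.+1 + \sum_(1 <= j < n.+1) \tr (A ^+ j) * e (n - j).
  rewrite D_sum linear_sum /= -(big_mkord xpredT (fun i => \tr (e (n - i) *: A ^+ i))).
  rewrite big_ltn // subn0 expr0 linearZ /= mxtrace1 mulr_natr; congr (_ + _).
  by apply: eq_bigr => j _; rewrite linearZ /= mulrC.
move=> E; move: trD; rewrite E -addrA => /(canRL (addKr _)).
by rewrite addNr => /eqP; rewrite addrC addr_eq0 => /eqP.
Qed.

Lemma rev_char_poly_coef0 : e 0 = 1.
Proof.
have := monicP (char_poly_monic A).
by rewrite lead_coefE size_char_poly /e subn0.
Qed.

End Matrix.

Lemma newton_unique (e1 e2 p : nat -> R) N :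
  (forall n, (0 < n <= N)%N -> GRing.lreg (n%:R : R)) ->
  e1 0 = e2 0 ->
  (forall n, (0 < n <= N)%N ->
     e1 n *+ n = - \sum_(1 <= j < n.+1) p j * e1 (n - j)%N) ->
  (forall n, (0 < n <= N)%N ->
     e2 n *+ n = - \sum_(1 <= j < n.+1) p j * e2 (n - j)%N) ->
  forall n, (n <= N)%N -> e1 n = e2 n.
Proof.
move=> reg e0 H1 H2; elim/ltn_ind => -[|n] IH le //.
apply: (reg n.+1); rewrite ?ltnS // !mulr_natl H1 ?H2 //.
congr (- _); apply: eq_big_nat => j /andP[j0 _].
by rewrite IH // ?ltn_subrL ?j0 // leq_subLR (leq_trans le) // leq_addl.
Qed.

Lemma newton_unique_power_sums (e p1 p2 : nat -> R) N :
  e 0 = 1 ->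
  (forall n, (0 < n <= N)%N ->
     e n *+ n = - \sum_(1 <= j < n.+1) p1 j * e (n - j)%N) ->
  (forall n, (0 < n <= N)%N ->
     e n *+ n = - \sum_(1 <= j < n.+1) p2 j * e (n - j)%N) ->
  forall n, (0 < n <= N)%N -> p1 n = p2 n.
Proof.
move=> e0 H1 H2; elim/ltn_ind => -[|n] IH //= le.
have := H1 n.+1 le; rewrite H2 // => /oppr_inj.
rewrite !(big_nat_recr n.+1) //= subnn e0 !mulr1.
rewrite (eq_big_nat _ _ (F2 := fun j => p1 j * e (n.+1 - j)%N)); last first.
  by move=> j /andP[j0 jn]; rewrite (IH j) // j0 (leq_trans (ltnW jn)).
by move/addrI.
Qed.

End NewtonIdentities.

(** * The quadratic character of F[x]/f *)

Lemma exists_companion (R : comNzRingType) (f : {poly R}) n :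
  f \is monic -> size f = n.+1 -> exists C : 'M[R]_n, char_poly C = f.
Proof.
move=> monf szf; have -> : n = (size f).-1 by rewrite szf.
by exists (companionmx f); rewrite companionmxK.
Qed.

Section NormCharacter.

Variables (F : finFieldType) (n' : nat) (C : 'M[F]_n'.+1).
Local Notation d := n'.+1.
Local Notation f := (char_poly C).
Implicit Types (m r P : {poly F}).

(** The norm from F[x]/f, equivalently Res(f, r): f is presented as the characteristic polynomial of
    C, so that the norm is a determinant and Cayley-Hamilton gives periodicity modulo f. *)
Definition cnorm r := \det (horner_mx C r).

Lemma cnormM r s : cnorm (r * s) = cnorm r * cnorm s.
Proof. by rewrite /cnorm rmorphM /= det_mulmx. Qed.

Lemma cnorm1 : cnorm 1 = 1. Proof. by rewrite /cnorm rmorph1 det1. Qed.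

Lemma cnormC c : cnorm c%:P = c ^+ d.
Proof. by rewrite /cnorm horner_mx_C det_scalar. Qed.

Lemma cnorm_mod r : cnorm (r %% f) = cnorm r.
Proof.
rewrite {2}(divp_eq r f) /cnorm rmorphD rmorphM /=.
by rewrite Cayley_Hamilton mulr0 add0r.
Qed.

Lemma cnorm_unit r : coprimep f r -> cnorm r != 0.
Proof.
case/Bezout_eq1_coprimepP=> -[u v] /= e; have := cnorm1.
rewrite -e /cnorm rmorphD rmorphM /= Cayley_Hamilton mulr0 add0r rmorphM /=.
rewrite det_mulmx => e1; apply/eqP => e0; move/eqP: e1.
by rewrite /cnorm in e0; rewrite e0 mulr0 eq_sym oner_eq0.
Qed.

Definition rchar r : int := if coprimep f r then qchar (cnorm r) else 0.

Lemma size_charf : size f = d.+1. Proof. exact: size_char_poly. Qed.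

Lemma rchar_mod r : rchar (r %% f) = rchar r.
Proof. by rewrite /rchar cnorm_mod coprimep_modr. Qed.

Lemma rchar0 : rchar 0 = 0.
Proof. by rewrite /rchar coprimep0 -size_poly_eq1 size_charf. Qed.

Hypothesis F2 : 2%:R != 0 :> F.

Lemma rcharM r s : rchar (r * s) = rchar r * rchar s.
Proof.
rewrite /rchar coprimepMr cnormM; case: coprimep; last by rewrite mul0r.
by case: coprimep; rewrite ?mulr0 //= qcharM.
Qed.

Lemma rchar1 : rchar 1 = 1.
Proof. by rewrite /rchar coprimep1 cnorm1 qchar1. Qed.

Lemma rchar_sqr r : coprimep f r -> rchar r * rchar r = 1.
Proof. by move=> co; rewrite /rchar co qchar_sqr ?cnorm_unit. Qed.

(* The sign makes [fchar m] the product of the quadratic characters of the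
   values of [f] at the roots of [m], by reciprocity for resultants. *)
Definition fchar m : int := qchar ((-1) ^+ (d * (size m).-1) : F) * rchar m.

Lemma fcharM m r : fchar (m * r) = fchar m * fchar r.
Proof.
rewrite /fchar rcharM.
have [->|m0] := eqVneq m 0; first by rewrite rchar0 !(mul0r, mulr0).
have [->|r0] := eqVneq r 0; first by rewrite rchar0 !(mul0r, mulr0).
have -> : (size (m * r)).-1 = ((size m).-1 + (size r).-1)%N.
  rewrite size_mul //.
  have ar a b : (0 < a -> 0 < b -> (a + b).-1.-1 = a.-1 + b.-1)%N by lia.
  by rewrite ar ?size_poly_gt0.
by rewrite mulnDr exprD qcharM // mulrACA.
Qed.

Lemma fchar1 : fchar 1 = 1.
Proof. by rewrite /fchar rchar1 size_poly1 muln0 expr0 qchar1. Qed.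

(** M = P^(j / deg P) is the product of the X - x^(q^i) for i < j. Each factor contributes det(C -
    x^(q^i)) = (-1)^d f(x^(q^i)), so the norm of M is, up to the sign built into [fchar], the norm
    of f(x) from K to F. *)
Lemma fchar_root (K : finFieldType) (iota : {rmorphism F -> K}) j P x :
  (0 < j)%N -> #|K| = (#|F| ^ j)%N ->
  irreducible_poly P -> P \is monic -> root (map_poly iota P) x ->
  qchar (map_poly iota f).[x] = fchar P ^+ (j %/ (size P).-1).
Proof.
move=> j0 cK irrP monP Px.
have K2 : 2%:R != 0 :> K by rewrite -(rmorph_nat iota) fmorph_eq0.
have fchar_exp e : fchar (P ^+ e) = fchar P ^+ e.
  by elim: e => [|e IH]; rewrite ?expr0 ?fchar1 // !exprS fcharM IH.
rewrite -fchar_exp; set M := P ^+ _.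
have [fx oP] := irreducible_root_frob_orbit irrP monP Px.
have dj := irreducible_root_deg j0 cK irrP monP Px.
have oM : map_poly iota M = frob_orbit F j x.
  by rewrite rmorphXn /= oP -frob_orbitM // mulnC divnK.
have szM : (size M).-1 = j by rewrite -(size_map_poly iota) oM size_frob_orbit.
have P1 : (1 < size P)%N := irrP.1.
have e0 : (0 < j %/ (size P).-1)%N.
  by rewrite divn_gt0 ?(dvdn_leq j0 dj) //; move: P1; case: size => [|[]].
have [fx0|fx0] := eqVneq (map_poly iota f).[x] 0.
  rewrite fx0 qchar0 /fchar /rchar.
  suff /negPf -> : ~~ coprimep f M by rewrite mulr0.
  rewrite coprimep_pexpr //; apply/negP; rewrite coprimep_sym -(coprimep_map iota).
  by move/coprimep_root/(_ Px); rewrite fx0 eqxx.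
have coM : coprimep f M.
  apply: coprimep_expr.
  have [|e2] := irredp_XsubCP irrP (dvdp_gcdl P f).
    by rewrite coprimep_sym /coprimep size_poly_eq1.
  have Pf : P %| f by rewrite -(eqp_dvdl _ e2) dvdp_gcdr.
  move: Pf; rewrite -(dvdp_map iota) => /dvdpP[s fs].
  by move: fx0; rewrite fs hornerM (rootP Px) mulr0 eqxx.
rewrite /fchar /rchar coM -qcharM // szM.
apply: qchar_inj => //; first by apply: qchar_val.
rewrite -(rmorph_int iota) qchar_intr // rmorphXn rmorphM rmorphXn rmorphN1 /=.
have -> : iota (cnorm M) = (-1) ^+ (d * j) *
    (map_poly iota f).[x] ^+ (\sum_(i < j) #|F| ^ i)%N.
  rewrite /cnorm -det_map_mx map_horner_mx /= oM rmorph_prod /=.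
  rewrite (big_morph _ (@det_mulmx _ _) (det1 _ _)) /= expr_sum exprM.
  have -> : (-1) ^+ d ^+ j = \prod_(i < j) ((-1) ^+ d : K).
    by rewrite prodr_const card_ord.
  rewrite -big_split /=.
  apply: eq_bigr => i _; rewrite -horner_frob map_char_poly.
  rewrite rmorphB /= horner_mx_X horner_mx_C -opprB.
  rewrite -[- (_ - _)]scaleN1r detZ; congr (_ * _).
  rewrite /char_poly -[RHS]horner_evalE -det_map_mx; congr (\det _).
  apply/matrixP => a b; rewrite !mxE /= horner_evalE hornerD hornerN hornerC hornerMn hornerX.
  by [].
rewrite mulrA -exprD addnn -muln2 mulnC exprM sqrrN !expr1n mul1r -exprM.
by rewrite cK geometric_half_card.
Qed.

End NormCharacter.

Lemma finField_splitting (F : finFieldType) (p : {poly F}) : p != 0 ->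
  exists (K : finFieldType) (iota : {rmorphism F -> K}) (s : seq K),
    map_poly iota p %= \prod_(z <- s) ('X - z%:P).
Proof.
move=> p0; have [L [s Ds _]] := FinSplittingFieldFor p0.
by exists (FinFieldExtType L), (in_alg L), s.
Qed.

Section NormRoots.

Variables (F : finFieldType) (n' : nat) (C : 'M[F]_n'.+1).
Local Notation d := n'.+1.
Local Notation f := (char_poly C).

Lemma cnorm_split (K : finFieldType) (iota : {rmorphism F -> K}) u c s :
  map_poly iota u = c *: \prod_(z <- s) ('X - z%:P) ->
  iota (cnorm C u) = c ^+ d * \prod_(z <- s) ((-1) ^+ d * (map_poly iota f).[z]).
Proof.
move=> Du; rewrite /cnorm -det_map_mx map_horner_mx /= Du.
rewrite -mul_polyC rmorphM /= horner_mx_C det_mulmx det_scalar; congr (_ * _).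
rewrite rmorph_prod /= (big_morph _ (@det_mulmx _ _) (det1 _ _)) /=.
apply: eq_bigr => z _; rewrite map_char_poly.
rewrite rmorphB /= horner_mx_X horner_mx_C -opprB.
rewrite -[- (_ - _)]scaleN1r detZ; congr (_ * _).
rewrite /char_poly -[RHS]horner_evalE -det_map_mx; congr (\det _).
apply/matrixP => a b; rewrite !mxE /= horner_evalE hornerD hornerN hornerC.
by rewrite hornerMn hornerX.
Qed.

(* The resultant of two split polynomials computed from either side. *)
Lemma resultant_roots (K : fieldType) (p u : {poly K}) c (s t : seq K) :
  p = \prod_(b <- t) ('X - b%:P) -> u = c *: \prod_(z <- s) ('X - z%:P) ->
  c ^+ size t * \prod_(z <- s) ((-1) ^+ size t * p.[z]) = \prod_(b <- t) u.[b].
Proof.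
move=> -> ->; elim: t => [|b t IH].
  by rewrite !big_nil expr0 mul1r big1 // => z _; rewrite expr0 mul1r -polyC1 hornerC.
rewrite [in RHS]big_cons -IH hornerZ horner_prod /= exprS.
under eq_bigr do rewrite big_cons hornerM hornerXsubC exprS mulrACA mulN1r opprB.
rewrite big_split /= mulrACA; congr (_ * _ * _).
by apply: eq_bigr => z _; rewrite hornerXsubC.
Qed.

Hypothesis F2 : 2%:R != 0 :> F.
Hypothesis sepf : coprimep f f^`().

Lemma nonsquare_mod_irreducible (P : {poly F}) :
  irreducible_poly P -> P \is monic ->
  exists rho, P %| rho ^+ ((#|F| ^ (size P).-1).-1./2) + 1.
Proof.
move=> irrP monP; have hI : monic_irreducible_poly P by split.
pose T : finFieldType := {poly %/ P with hI}.
have T2 : 2%:R != 0 :> T.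
  have -> : 2%:R = qpolyC P 2%:R :> {poly %/ P} by rewrite rmorph_nat.
  by rewrite fmorph_eq0.
have [rho qrho] := nonsquare_exists T2.
pose rhoQ : {poly %/ P} := rho; pose r : {poly F} := rhoQ; exists r.
have := qchar_intr T2 rho; rewrite qrho card_qfpoly => E.
have {}E : in_qpoly P (r ^+
    ((#|F| ^ (size P).-1).-1./2) + 1) = 0.
  rewrite rmorphD rmorphXn rmorph1 /=.
  have -> : in_qpoly P r = rhoQ.
    by apply: val_inj; apply: in_qpoly_small; apply: size_mk_monic.
  have -> : rhoQ ^+ ((#|F| ^ (size P).-1).-1./2) = -1.
    by apply: etrans (esym E) _; rewrite mulrNz mulr1z.
  by rewrite addNr.
move/(congr1 val): E => /= /eqP.
by rewrite -Pdiv.IdomainMonic.modpE ?monic_mk_monic // /mk_monic irrP.1 monP.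
Qed.

(** Let P be an irreducible common factor of f and w, and f = QP. As f is separable, the Chinese
    remainder theorem gives u congruent to 1 modulo Q and to a nonsquare modulo P. Then f divides (u
    - 1) w, and the norm of u is that of a nonsquare of F[x]/P, hence a nonsquare of F. *)
Lemma nonsquare_stabilizer w : ~~ coprimep f w ->
  exists u, [/\ coprimep f u, f %| (u - 1) * w & rchar C u = -1].
Proof.
move=> nco; have f0 : f != 0 by rewrite monic_neq0 ?char_poly_monic.
have g0 : gcdp f w != 0 by rewrite gcdp_eq0 negb_and f0.
have [||P [irrP monP Pg]] := @irreducible_factor F ((lead_coef (gcdp f w))^-1 *: gcdp f w).
- by rewrite monicE lead_coefZ mulVf ?lead_coef_eq0.
- rewrite size_scale ?invr_eq0 ?lead_coef_eq0 // ltn_neqAle size_poly_gt0 g0.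
  by rewrite eq_sym; move: nco; rewrite /coprimep => ->.
rewrite dvdpZr ?invr_eq0 ?lead_coef_eq0 // dvdp_gcd in Pg.
case/andP: Pg => /dvdpP[Q Df] Pw.
have monQ : Q \is monic by rewrite -(monicMr Q monP) -Df char_poly_monic.
have coQP : coprimep Q P by apply: (separable_coprime _ (p := f)); rewrite ?unlock // Df.
have [[A B] /= AB] := Bezout_eq1_coprimepP _ _ coQP.
have [rho Prho] := nonsquare_mod_irreducible irrP monP.
set M := (_.-1./2) in Prho.
pose u := 1 + Q * (A * (rho - 1)).
have uP : exists t, u = rho + P * t.
  exists (- B * (rho - 1)).
  have e : Q * A = 1 - B * P by rewrite -AB mulrC addrK.
  by rewrite /u mulrA e; ring.
have q_gt1 : (1 < #|F|)%N := finNzRing_gt1 F.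
have k_gt0 : (0 < (size P).-1)%N by have := irrP.1; case: size => [|[]].
have M_gt0 : (0 < M)%N.
  have : (2 < #|F| ^ (size P).-1)%N.
    apply: (@leq_trans #|F|); last by rewrite -{1}(expn1 #|F|) leq_pexp2l // ltnW.
    rewrite ltn_neqAle q_gt1 andbT; apply/eqP => e.
    by have := odd_card_finField F2; rewrite -e.
  by rewrite /M; case: (_ ^ _)%N => [|[|[|]]].
have coP : coprimep P u.
  case: uP => t ->; case/dvdpP: Prho => r Er.
  apply/Bezout_eq1_coprimepP; exists (r + rho ^+ M.-1 * t, - rho ^+ M.-1) => /=.
  have : rho ^+ M = rho ^+ M.-1 * rho by rewrite -exprSr prednK.
  move: Er => /(canRL (addrK _)) -> e.
  by rewrite mulrDl mulNr mulrDr -e; ring.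
have coQ : coprimep Q u by rewrite /u addrC mulrC coprimep_addl_mul coprimep1.
have cof : coprimep f u by rewrite Df coprimepMl coQ coP.
exists u; split=> //.
  have -> : (u - 1) * w = Q * w * (A * (rho - 1)) by rewrite /u; ring.
  by rewrite Df dvdp_mulr // dvdp_mul.
rewrite /rchar cof; apply: qchar_inj => //; first by constructor 3.
have u0 : u != 0.
  by apply: contraTneq cof => ->; rewrite coprimep0 -size_poly_eq1 size_charf.
(* Over a splitting field of f u the norm of u is the product of its values at the roots of f: the
   roots of Q give 1, and those of P form one Frobenius orbit. *)
have [K [iota [zs Dzs]]] := finField_splitting (mulf_neq0 f0 u0).
apply: (fmorph_inj iota); rewrite rmorphXn rmorph_int /=.
have splits p : p != 0 -> p %| f * u -> exists s, map_poly iota p =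
    iota (lead_coef p) *: \prod_(z <- s) ('X - z%:P).
  move=> p0 dvp; have : map_poly iota p %| \prod_(z <- zs) ('X - z%:P).
    by rewrite -(eqp_dvdr _ Dzs) dvdp_map.
  case/dvdp_prod_XsubC => m Dm; exists (mask m zs).
  have := eqp_eq Dm; rewrite (monicP (monic_prod_XsubC _ _ _)) scale1r => ->.
  by rewrite lead_coef_map.
have [su Dsu] := splits u u0 (dvdp_mull _ (dvdpp _)).
have [sQ] : exists s, map_poly iota Q = iota (lead_coef Q) *: \prod_(z <- s) ('X - z%:P).
  by apply: splits; rewrite ?monic_neq0 // Df -mulrA dvdp_mulr.
rewrite (monicP monQ) rmorph1 scale1r => DsQ.
have [sP] : exists s, map_poly iota P = iota (lead_coef P) *: \prod_(z <- s) ('X - z%:P).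
  by apply: splits; rewrite ?monic_neq0 // Df -mulrA mulrCA dvdp_mulr.
rewrite (monicP monP) rmorph1 scale1r => DsP.
have [b bP] : exists b, b \in sP.
  have := size_map_poly iota P; rewrite DsP size_prod_XsubC => e.
  by case: (sP) e => [|b s] e; [have := irrP.1; rewrite -e | exists b; rewrite inE eqxx].
have Pb : root (map_poly iota P) b by rewrite DsP root_prod_XsubC.
have [fb oP] := irreducible_root_frob_orbit irrP monP Pb.
pose t := [seq b ^+ (#|F| ^ i) | i <- index_iota 0 (size P).-1].
have Dt : map_poly iota P = \prod_(z <- t) ('X - z%:P).
  by rewrite oP /frob_orbit big_map big_mkord.
have Dft : map_poly iota f = \prod_(z <- t ++ sQ) ('X - z%:P).
  by rewrite Df rmorphM /= mulrC DsQ Dt big_cat.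
rewrite (cnorm_split Dsu).
have szt : size (t ++ sQ) = d.
  apply: succn_inj; rewrite -(size_prod_XsubC _ id) -Dft size_map_poly.
  exact: size_charf.
have := resultant_roots Dft Dsu; rewrite szt => ->; rewrite big_cat /=.
rewrite [X in _ * X](_ : _ = 1) ?mulr1; last first.
  rewrite big_seq big1 // => z zQ.
  have Qz : root (map_poly iota Q) z by rewrite DsQ root_prod_XsubC.
  rewrite /u rmorphD rmorphM rmorph1 /= hornerD hornerM (rootP Qz) mul0r.
  by rewrite -polyC1 hornerC addr0.
have -> : \prod_(z <- t) (map_poly iota u).[z] =
    (map_poly iota rho).[b] ^+ (\sum_(i < (size P).-1) #|F| ^ i)%N.
  have ub : (map_poly iota u).[b] = (map_poly iota rho).[b].
    case: uP => x ->; rewrite rmorphD rmorphM /= hornerD hornerM (rootP Pb).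
    by rewrite mul0r addr0.
  rewrite big_map big_mkord expr_sum; apply: eq_bigr => i _.
  by rewrite horner_frob ub.
rewrite -exprM geometric_half_card // -/M -horner_exp -rmorphXn /=.
case/dvdpP: Prho => r /(canRL (addrK _)) ->.
rewrite rmorphB rmorphM rmorph1 /= hornerD hornerM (rootP Pb) mulr0 add0r.
by rewrite hornerN -polyC1 hornerC mulrNz mulr1z.
Qed.

End NormRoots.

(** * The functional equation *)

HB.instance Definition _ (R S : finComUnitRingType) := Finite.on (R * S)%type.

(* Poisson summation for a real character [X] of a finite ring, with the
   additive characters replaced by the orthogonality relation
   [tau (v * w) = 0], which keeps every sum in the integers. *)
Section CharacterDuality.

Variables (R : finComUnitRingType) (F : finFieldType) (tau : R -> F).
Variable X : R -> int.
Hypotheses (tau0 : tau 0 = 0) (XM : {morph X : x y / x * y}).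
Hypothesis Xunit : forall x, x \is a GRing.unit -> X x * X x = 1.
Hypothesis Xnonunit : forall x, x \isn't a GRing.unit -> X x = 0.
Hypothesis stabilizer : forall w, w \isn't a GRing.unit ->
  exists u, [/\ u \is a GRing.unit, u * w = w & X u = -1].

Let H := \sum_(v | tau v == 0) X v.

(** [H] takes the place of the Gauss sum. For a unit w substitute v / w for v; for a nonunit,
    multiplication by the stabilizing u keeps the condition and reverses the sign of the sum. *)
Lemma sum_orthogonal w : \sum_(v | tau (v * w) == 0) X v = H * X w.
Proof.
have [Uw|nUw] := boolP (w \is a GRing.unit).
  rewrite (reindex_inj (mulIr (_ : w^-1 \is a GRing.unit))) ?unitrV //=.
  rewrite (eq_bigl (fun v => tau v == 0)); last by move=> v; rewrite divrK.
  rewrite mulr_suml; apply: eq_bigr => v _; rewrite XM; congr (_ * _).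
  have X1 : X 1 = 1 by rewrite -(mul1r 1) XM Xunit ?unitr1.
  by rewrite -[LHS]mul1r -(Xunit Uw) -mulrA -XM divrr // X1 mulr1.
rewrite Xnonunit // mulr0; have [u [Uu uw Xu]] := stabilizer nUw.
set s := \sum_(v | _) _; have : s = - s.
  rewrite {1}/s (reindex_inj (mulIr Uu)) /= -sumrN.
  rewrite (eq_bigl (fun v => tau (v * w) == 0)); last by move=> v; rewrite -mulrA uw.
  by apply: eq_bigr => v _; rewrite XM Xu mulrN1.
lia.
Qed.

Lemma sum_character : \sum_v X v = 0.
Proof.
have := sum_orthogonal 0; rewrite (Xnonunit (_ : 0 \isn't a GRing.unit)) ?unitr0 //.
by rewrite mulr0; under eq_bigl do rewrite mulr0 tau0 eqxx.
Qed.

(** After exchanging the sums, v is weighted by the number of w in U orthogonal to it: c in general,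
    with (q - 1) c more on U', the orthogonal of U. The constant part drops out because X sums to
    zero. *)
Lemma character_duality (U U' : {pred R}) (c : nat) :
  (forall v, #|[pred w in U | tau (v * w) == 0%R]|
     = (if v \in U' then #|F| * c else c)%N) ->
  H * (\sum_(w in U) X w) = (#|F|.-1 * c)%:Z * \sum_(v in U') X v.
Proof.
move=> card_perp; rewrite mulr_sumr; under eq_bigr do rewrite -sum_orthogonal.
rewrite (exchange_big_dep xpredT) //=.
rewrite (eq_bigr (fun v => X v *+ c + (if v \in U' then (#|F|.-1 * c)%:Z * X v else 0))).
  rewrite big_split /= sumrMnl sum_character mul0rn add0r -big_mkcond /=.
  by rewrite mulr_sumr.
move=> v _; rewrite sumr_const (eq_card (B := [pred w in U | tau (v * w) == 0])) //.
rewrite card_perp; case: ifP => _; last by rewrite addr0.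
have q_gt0 : (0 < #|F|)%N by rewrite (ltn_trans _ (finNzRing_gt1 F)).
by rewrite -{1}(prednK q_gt0) mulSn mulrnDr -[X in _ + X = _]mulr_natl natz.
Qed.

End CharacterDuality.

Section Hyperplane.

Variables (F : finFieldType) (k : nat) (l : 'I_k.+1 -> F).
Local Notation form b := (\sum_i (b : 'rV[F]_k.+1) 0 i * l i).

Lemma card_hyperplane :
  #|[set b : 'rV[F]_k.+1 | form b == 0]| =
  (if [forall i, (l i == 0)%R] then #|F| * #|F| ^ k else #|F| ^ k)%N.
Proof.
case: ifP => [/forallP l0|/negbT].
  rewrite -expnS -[X in (_ ^ X)%N]mul1n -card_mx; apply: eq_card => b.
  rewrite !inE; apply/eqP/big1 => i _.
  by rewrite (eqP (l0 i)) mulr0.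
rewrite negb_forall => /existsP[j lj].
apply/eqP; rewrite -(eqn_pmul2l (_ : 0 < #|F|)%N); last first.
  by rewrite (ltn_trans _ (finNzRing_gt1 F)).
rewrite -expnS -[X in (_ ^ X)%N]mul1n -card_mx -[X in _ == X]sum1_card.
rewrite [X in _ == X](partition_big (fun b => form b) xpredT) //=.
rewrite (eq_bigr (fun=> #|[set b : 'rV[F]_k.+1 | form b == 0]|)).
  by rewrite sum_nat_const; apply/eqP.
move=> y _; rewrite sum1_card.
pose e : 'rV[F]_k.+1 := (y / l j) *: delta_mx 0 j.
have fe : form e = y.
  rewrite (bigD1 j) //= big1 => [|i ne]; rewrite !mxE !eqxx /=.
    by rewrite mulr1 addr0 divfK.
  by rewrite (negPf ne) mulr0 mul0r.
rewrite -[RHS](card_imset _ (addrI e)); apply: eq_card => b.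
apply/idP/imsetP.
  move=> /eqP fb; exists (b - e); last by rewrite addrCA subrr addr0.
  rewrite inE; under eq_bigr do rewrite 2!mxE mulrBl.
  by rewrite sumrB fe fb subrr.
case=> a; rewrite inE => /eqP fa ->; apply/eqP.
under eq_bigr do rewrite mxE mulrDl.
by rewrite big_split /= fe fa addr0.
Qed.

End Hyperplane.

Section FunctionalEquation.

Variables (F : finFieldType) (n' : nat) (C : 'M[F]_n'.+1).
Local Notation d := n'.+1.
Local Notation f := (char_poly C).
Local Notation Q := {poly %/ f}.
Local Notation qX i := (in_qpoly f 'X^i).

Let q_gt0 : (0 < #|F|)%N. Proof. by rewrite (ltn_trans _ (finNzRing_gt1 F)). Qed.

Lemma mk_monic_char_poly : mk_monic f = f.
Proof. by rewrite /mk_monic size_char_poly char_poly_monic. Qed.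

Lemma in_qpolyE (p : {poly F}) : in_qpoly f p = p %% f :> {poly F}.
Proof. by rewrite /= -Pdiv.IdomainMonic.modpE ?monic_mk_monic // mk_monic_char_poly. Qed.

Lemma qpolyME (a b : Q) : a * b = ((a : {poly F}) * b) %% f :> {poly F}.
Proof. exact: in_qpolyE. Qed.

Lemma in_qpolyK (a : Q) : in_qpoly f a = a.
Proof. by apply: val_inj; apply: in_qpoly_small; apply: size_mk_monic. Qed.

Lemma size_qpoly (a : Q) : (size a <= d)%N.
Proof.
have e : size (mk_monic f) = d.+1 by rewrite mk_monic_char_poly size_char_poly.
exact: leq_trans (size_mk_monic a) (eq_leq e).
Qed.

Lemma in_qpoly_id (p : {poly F}) : (size p <= d)%N -> in_qpoly f p = p :> {poly F}.
Proof.
by move=> le; apply: in_qpoly_small; rewrite mk_monic_char_poly size_char_poly.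
Qed.

(** Up to sign the residue at infinity of a dx / f. Under the pairing that sends (v, w) to the
    residue of v w, the polynomials of degree < k have those of degree < d - k as orthogonal. *)
Definition residue (a : Q) : F := (a : {poly F})`_n'.

Lemma residueD a b : residue (a + b) = residue a + residue b.
Proof. by rewrite /residue -coefD. Qed.

Lemma residue0 : residue 0 = 0.
Proof. by rewrite /residue -[RHS](coef0 _ n'). Qed.

Lemma residueZ c a : residue (c *: a) = c * residue a.
Proof. by rewrite /residue -coefZ. Qed.

Lemma residue_mulXn (v : Q) i :
  (size v + i <= d)%N -> residue (v * qX i) = (v : {poly F})`_(n' - i).
Proof.
move=> le; have le_i : (i <= d)%N by rewrite (leq_trans _ le) ?leq_addl.
have [e|ne] := eqVneq i d.
  have : (size v <= 0)%N by rewrite -(leq_add2r i) add0n {2}e.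
  rewrite leqn0 size_poly_eq0 => /eqP v0.
  have -> : v = 0 by apply: val_inj.
  by rewrite mul0r residue0 coef0.
have lt_i : (i <= n')%N by rewrite -ltnS ltn_neqAle ne.
rewrite /residue qpolyME in_qpoly_id ?size_polyXn // modp_small.
  by rewrite coefMXn ltnNge lt_i.
rewrite size_char_poly ltnS; have [->|v0] := eqVneq (v : {poly F}) 0.
  by rewrite mul0r size_poly0.
by rewrite size_mulXn // addnC.
Qed.

(** Once the top i coefficients of v are known to vanish, v x^i needs no reduction modulo f and its
    residue is the next coefficient. *)
Lemma residue_size (v : Q) k : (k <= d)%N ->
  (forall i, (i < k)%N -> residue (v * qX i) = 0) -> (size v <= d - k)%N.
Proof.
elim: k => [|k IH] le H; first by rewrite subn0 size_qpoly.
have sv : (size v <= d - k)%N by apply: IH (ltnW le) _ => i /leqW /H.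
have := H k (leqnn _); rewrite residue_mulXn; last by rewrite addnC -(leq_subRL _ (ltnW le)).
move=> vk; apply/leq_sizeP => i; rewrite leq_eqVlt => /predU1P[<-|lt].
  by rewrite subSS.
have ar a : (k < a -> a - k.+1 < i -> a - k <= i)%N by lia.
by rewrite nth_default // (leq_trans sv) // ar.
Qed.

Definition qpoly_rV k (b : 'rV[F]_k) : Q := in_qpoly f (rVpoly b).

Lemma qpoly_rVE k (b : 'rV[F]_k) : (k <= d)%N -> qpoly_rV b = rVpoly b :> {poly F}.
Proof. by move=> le; rewrite in_qpoly_id // (leq_trans (size_poly _ _)). Qed.

Lemma qpoly_rVK k (w : Q) : (k <= d)%N -> (size w <= k)%N ->
  qpoly_rV (poly_rV w : 'rV[F]_k) = w.
Proof.
move=> le sw; apply: val_inj; apply: etrans (qpoly_rVE _ le) _.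
exact: poly_rV_K.
Qed.

Lemma qpoly_rV_inj k : (k <= d)%N -> injective (@qpoly_rV k).
Proof.
move=> le b b' /(congr1 (fun a : Q => a : {poly F})).
by rewrite !qpoly_rVE // => /(can_inj rVpolyK).
Qed.

Lemma residue_qpoly_rV k (v : Q) (b : 'rV[F]_k) :
  residue (v * qpoly_rV b) = \sum_i b 0 i * residue (v * qX i).
Proof.
have -> : qpoly_rV b = \sum_i b 0 i *: qX i.
  rewrite /qpoly_rV.
  transitivity (in_qpoly f (\sum_(i < k) b 0 i *: 'X^i)).
    congr (in_qpoly f _); apply/polyP => j; rewrite coef_rVpoly coef_sum.
    case: insubP => [i _ ij|ge].
      rewrite (bigD1 i) //= coefZ coefXn ij eqxx mulr1 big1 ?addr0 // => i' ne.
      rewrite coefZ coefXn -ij (inj_eq val_inj) eq_sym (negPf ne) mulr0 //.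
    rewrite big1 // => i _; rewrite coefZ coefXn gtn_eqF ?mulr0 //.
    by rewrite (leq_trans (ltn_ord i)) // leqNgt.
  by rewrite linear_sum; apply: eq_bigr => i _; rewrite linearZ.
rewrite mulr_sumr (big_morph residue residueD residue0); apply: eq_bigr => i _.
by rewrite -scalerAr residueZ.
Qed.

Lemma sum_qpoly_size k (g : {poly F} -> int) : (k <= d)%N ->
  \sum_(w : Q | (size w <= k)%N) g w = \sum_(a <- polys F k) g a.
Proof.
move=> le; rewrite -[LHS]big_filter.
rewrite -(big_map (fun w : Q => w : {poly F}) xpredT g); apply: perm_big.
apply: uniq_perm; rewrite ?polys_uniq //.
  by rewrite map_inj_uniq ?filter_uniq ?index_enum_uniq //; apply: val_inj.
move=> a; rewrite mem_polys; apply/mapP/idP => [[w]|sa].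
  by rewrite mem_filter => /andP[sw _] ->.
exists (in_qpoly f a); last by rewrite in_qpoly_id ?(leq_trans sa).
by rewrite mem_filter mem_index_enum in_qpoly_id ?(leq_trans sa) // sa.
Qed.

Hypotheses (F2 : 2%:R != 0 :> F) (sepf : coprimep f f^`()).

Let X (a : Q) := rchar C a.

Let unitE (a : Q) : (a \is a GRing.unit) = coprimep f a.
Proof. exact: (congr1 (fun p => coprimep p a) mk_monic_char_poly). Qed.

Let XM : {morph X : a b / a * b}.
Proof. by move=> a b; rewrite /X qpolyME rchar_mod rcharM. Qed.

Let Xunit a : a \is a GRing.unit -> X a * X a = 1.
Proof. by rewrite unitE; apply: rchar_sqr. Qed.

Let Xnonunit a : a \isn't a GRing.unit -> X a = 0.
Proof. by rewrite unitE /X /rchar => /negPf ->. Qed.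

Let stabilizer w : w \isn't a GRing.unit ->
  exists u, [/\ u \is a GRing.unit, u * w = w & X u = -1].
Proof.
rewrite unitE => /(nonsquare_stabilizer F2 sepf) [u [cu dv Xu]].
exists (in_qpoly f u); rewrite unitE in_qpolyE coprimep_modr cu /X in_qpolyE rchar_mod.
split=> //; apply/eqP; rewrite -subr_eq0 -{2}[w]mul1r -mulrBl.
apply/eqP; have -> : in_qpoly f u - 1 = in_qpoly f (u - 1) by rewrite rmorphB rmorph1.
rewrite -{1}(in_qpolyK w) -rmorphM; apply: val_inj.
by apply: etrans (in_qpolyE _) _; apply/modp_eq0P.
Qed.

Lemma rchar_poly_duality : exists H : int,
  (forall k, (k < d)%N -> H * \sum_(a <- polys F k.+1) rchar C a =
     (#|F|.-1 * #|F| ^ k)%:Z * \sum_(a <- polys F (n' - k)) rchar C a) /\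
  \sum_(a <- polys F d) rchar C a = 0.
Proof.
exists (\sum_(v | residue v == 0) X v); split; last first.
  rewrite -sum_qpoly_size // -[RHS](sum_character residue0 XM Xunit Xnonunit stabilizer).
  by apply: eq_bigl => w; rewrite size_qpoly.
move=> k lt; have le : (n' - k <= d)%N by rewrite (leq_trans (leq_subr _ _)).
rewrite -(sum_qpoly_size _ lt) -(sum_qpoly_size _ le).
apply: (character_duality residue0 XM Xunit Xnonunit stabilizer
  (U := [pred w : Q | (size w <= k.+1)%N])
  (U' := [pred w : Q | (size w <= n' - k)%N])) => v.
rewrite -(_ : [forall i : 'I_k.+1, residue (v * qX i) == 0] = (v \in _)).
  rewrite -(card_hyperplane (fun i : 'I_k.+1 => residue (v * qX i))).
  rewrite -(card_imset _ (qpoly_rV_inj lt)); apply: eq_card => w.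
  rewrite !inE; apply/andP/imsetP => [[sw vw]|[b]].
    by exists (poly_rV w); rewrite ?inE -?residue_qpoly_rV qpoly_rVK.
  rewrite inE -residue_qpoly_rV => vb ->; split=> //.
  by rewrite qpoly_rVE // size_poly.
rewrite inE; apply/forallP/idP => [H|sv i].
  have := @residue_size v k.+1 lt; rewrite subSS; apply=> i lti.
  by have /eqP := H (Ordinal lti).
rewrite residue_mulXn; last first.
  by have := ltn_ord i; move: sv lt; lia.
by rewrite nth_default // (leq_trans sv) // leq_sub2l // -ltnS.
Qed.

(** For d odd, scaling by c multiplies [rchar] by [qchar c], so its sums over all polynomials of
    bounded degree vanish. Weighting by [qchar] of the leading coefficient restores the sums over
    monic polynomials; the weight corresponds to the ramified place at infinity, entered as a second
    factor F of the ring. *)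
Let X2 (w : Q * F) : int := rchar C w.1 * qchar w.2.
Let tau2 (w : Q * F) : F := residue w.1 - w.2.

Let tau2_0 : tau2 0 = 0. Proof. by rewrite /tau2 residue0 subrr. Qed.

Let X2M : {morph X2 : a b / a * b}.
Proof.
move=> a b; rewrite /X2 -[rchar C _]/(X (a.1 * b.1)) XM.
by rewrite -[(a * b).2]/(a.2 * b.2) qcharM // mulrACA.
Qed.

Let unit2E (w : Q * F) : (w \is a GRing.unit) = (w.1 \is a GRing.unit) && (w.2 != 0).
Proof. by rewrite -unitfE. Qed.

Let X2unit w : w \is a GRing.unit -> X2 w * X2 w = 1.
Proof.
rewrite unit2E => /andP[U1 U2].
by rewrite /X2 mulrACA qchar_sqr // -/(X _) Xunit // mulr1.
Qed.

Let X2nonunit w : w \isn't a GRing.unit -> X2 w = 0.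
Proof.
rewrite unit2E negb_and negbK /X2 => /orP[/Xnonunit|/eqP ->].
  by rewrite /X => ->; rewrite mul0r.
by rewrite qchar0 mulr0.
Qed.

Let stabilizer2 w : w \isn't a GRing.unit ->
  exists u, [/\ u \is a GRing.unit, u * w = w & X2 u = -1].
Proof.
case: w => a c; rewrite unit2E negb_and negbK /= => /orP[/stabilizer[u [Uu ua Xu]]|/eqP ->].
  exists (u, 1); rewrite unit2E Uu oner_eq0 /X2 /= qchar1 mulr1; split=> //.
  by rewrite -[RHS]/(a, c) -{2}ua -{2}(mul1r c).
have [u qu] := nonsquare_exists F2.
exists (1, u); rewrite unit2E unitr1 -qchar_eq0 // qu /X2 /= qu; split=> //.
  by rewrite -{2}[a]mul1r -{2}(mulr0 u).
by rewrite -/(X 1) /X -[RHS]mul1r; congr (_ * _); rewrite -[RHS](rchar1 C).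
Qed.

Lemma sum_qpoly_pair k (g : {poly F} -> F -> int) : (k <= d)%N ->
  \sum_(w : Q * F | (size w.1 <= k)%N && (w.2 == (w.1 : {poly F})`_k.-1)) g w.1 w.2
    = \sum_(a <- polys F k) g a a`_k.-1.
Proof.
move=> le; rewrite -(sum_qpoly_size (fun a => g a a`_k.-1)) //.
rewrite -(pair_big_dep (fun a : Q => size a <= k)%N
  (fun (a : Q) c => c == (a : {poly F})`_k.-1) (fun (a : Q) c => g a c)) /=.
by apply: eq_bigr => a _; rewrite big_pred1_eq.
Qed.

(** A polynomial of degree at most k is paired with its coefficient of x^k; owing to the difference
    in [tau2] the orthogonal is again of this shape, for degree at most d - 1 - k. *)
Lemma rchar_twisted_duality : exists H : int,
  forall k, (k < d)%N ->
  H * \sum_(a <- polys F k.+1) rchar C a * qchar a`_k =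
     (#|F|.-1 * #|F| ^ k)%:Z * \sum_(a <- polys F (d - k)) rchar C a * qchar a`_(n' - k).
Proof.
exists (\sum_(v | tau2 v == 0) X2 v) => k lt.
have := @character_duality _ _ tau2 X2 tau2_0 X2M X2unit X2nonunit stabilizer2
  [pred w : Q * F | (size w.1 <= k.+1)%N && (w.2 == (w.1 : {poly F})`_k)]
  [pred w : Q * F | (size w.1 <= d - k)%N && (w.2 == (w.1 : {poly F})`_(d - k).-1)]
  (#|F| ^ k)%N.
rewrite (sum_qpoly_pair (k := k.+1) (fun a c => rchar C a * qchar c) lt).
rewrite (sum_qpoly_pair (k := d - k) (fun a c => rchar C a * qchar c)) ?leq_subr //.
have e : (d - k).-1 = (n' - k)%N by rewrite subSn.
rewrite !e; apply=> v.
(* Orthogonality to x^i for i < k bounds the degree of v; the index k equates the second component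
   with the top coefficient. *)
pose l (i : 'I_k.+1) := residue (v.1 * qX i) - v.2 * (i == ord_max)%:R.
have form b : tau2 (v * (qpoly_rV b, (b : 'rV[F]_k.+1) 0 ord_max)) = \sum_i b 0 i * l i.
  rewrite /tau2 /= residue_qpoly_rV; under [RHS]eq_bigr do rewrite mulrBr.
  rewrite sumrB; congr (_ - _); rewrite (bigD1 ord_max) //= eqxx mulr1 mulrC.
  by rewrite big1 ?addr0 // => i /negPf ->; rewrite !mulr0.
rewrite -(_ : [forall i, l i == 0] = (v \in _)).
  rewrite -(card_hyperplane l).
  have inj : injective (fun b : 'rV[F]_k.+1 => (qpoly_rV b, b 0 ord_max)).
    by move=> b b' bb'; apply: (qpoly_rV_inj lt); apply: (congr1 fst bb').
  rewrite -(card_imset _ inj); apply: eq_card => -[w c].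
  have coefK (b : 'rV[F]_k.+1) : (qpoly_rV b : {poly F})`_k = b 0 ord_max.
    rewrite qpoly_rVE // coef_rVpoly; case: insubP => [i _ ik|]; last by rewrite ltnSn.
    by congr (b 0 _); apply: val_inj.
  rewrite !inE /=; apply/andP/imsetP => [[/andP[sw /eqP Dc] vw]|[b]].
    have wE : qpoly_rV (poly_rV w : 'rV[F]_k.+1) = w by rewrite qpoly_rVK.
    exists (poly_rV w); last by rewrite wE Dc -coefK wE.
    by rewrite inE -form wE -coefK wE -Dc.
  rewrite inE -form => vb [-> ->]; split=> //.
  by rewrite coefK eqxx qpoly_rVE // size_poly.
rewrite inE; apply/forallP/andP => [H|[sv /eqP vc] i].
  have sv : (size v.1 <= d - k)%N.
    apply: residue_size (ltnW lt) _ => i lti.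
    have /eqP := H (inord i); rewrite /l inordK ?(leqW lti) //.
    by rewrite -val_eqE /= inordK ?(leqW lti) // ltn_eqF // mulr0 subr0.
  split=> //; have /eqP := H ord_max; rewrite /l eqxx mulr1 => /eqP.
  rewrite subr_eq0 residue_mulXn; first by rewrite eq_sym.
  by rewrite addnC -(leq_subRL _ (ltnW lt)).
have lti := ltn_ord i; rewrite /l residue_mulXn; last first.
  apply: (@leq_trans (size v.1 + k)); first by rewrite leq_add2l -ltnS.
  by rewrite addnC -(leq_subRL _ (ltnW lt)).
have [->|ne] := eqVneq i ord_max; first by rewrite mulr1 vc subrr.
rewrite mulr0 subr0 nth_default // (leq_trans sv) //.
have : (i < k)%N by rewrite ltn_neqAle -ltnS lti andbT.
by move: lt; lia.
Qed.

End FunctionalEquation.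

(** * Coefficients of the L-function *)

Lemma perm_polysS (F : finFieldType) k :
  perm_eq (polys F k.+1) (polys F k ++
     [seq c *: m | c <- enum (predC1 (0 : F)), m <- monics F k]).
Proof.
apply: uniq_perm; first exact: polys_uniq.
  rewrite cat_uniq polys_uniq /=; apply/andP; split.
    apply/hasPn => a /allpairsP[[c m] /= [c0 mm ->]].
    move: c0 mm; rewrite mem_enum !inE mem_monics => c0 /andP[_ /eqP szm].
    by rewrite mem_polys size_scale // szm ltnn.
  apply: allpairs_uniq; rewrite ?enum_uniq ?monics_uniq //.
  move=> [c m] [c' m'] /allpairsP[[c1 m1] /= [c0 mm [-> ->]]].
  move=> /allpairsP[[c2 m2] /= [c0' mm' [-> ->]]] e.
  move: mm mm'; rewrite !mem_monics => /andP[/monicP mon1 _] /andP[/monicP mon2 _].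
  have ec : c1 = c2.
    by have := congr1 lead_coef e; rewrite !lead_coefZ mon1 mon2 !mulr1.
  rewrite ec in e *; congr (_, _).
  move: c0'; rewrite mem_enum inE => c0'; exact: (scalerI c0').
move=> a; rewrite mem_cat !mem_polys; apply/idP/orP.
  rewrite leq_eqVlt ltnS => /orP[/eqP sza|->]; last by left.
  have a0 : lead_coef a != 0 by rewrite lead_coef_eq0 -size_poly_eq0 sza.
  right; apply/allpairsP; exists (lead_coef a, (lead_coef a)^-1 *: a) => /=.
  rewrite mem_enum inE a0 scalerA divff // scale1r mem_monics; split=> //.
  by rewrite monicE lead_coefZ mulVf // size_scale ?invr_eq0 // sza !eqxx.
case=> [/leqW //|/allpairsP[[c m] /= [c0 + ->]]].
rewrite mem_monics => /andP[_ /eqP <-]; exact: size_scale_leq.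
Qed.

Lemma sum_polysS (F : finFieldType) k (h : {poly F} -> int) :
  \sum_(a <- polys F k.+1) h a = \sum_(a <- polys F k) h a +
     \sum_(c | c != 0) \sum_(m <- monics F k) h (c *: m).
Proof.
rewrite (perm_big _ (perm_polysS F k)) big_cat big_allpairs_dep /=.
by congr (_ + _); rewrite big_enum.
Qed.

Section LCoefficients.

Variables (F : finFieldType) (n' : nat) (C : 'M[F]_n'.+1).
Local Notation d := n'.+1.
Local Notation f := (char_poly C).
Hypotheses (F2 : 2%:R != 0 :> F) (sepf : coprimep f f^`()).

Lemma rcharZ c m : c != 0 -> rchar C (c *: m) = qchar c ^+ d * rchar C m.
Proof.
move=> c0; rewrite /rchar coprimepZr //; case: ifP => _; last by rewrite mulr0.
by rewrite -mul_polyC cnormM cnormC qcharM // qcharX.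
Qed.

Lemma sum_nonzero_const (x : int) : \sum_(c : F | c != 0) x = #|F|.-1%:Z * x.
Proof. by rewrite sumr_const cardC1 -mulr_natl natz. Qed.

Let c k := \sum_(m <- monics F k) rchar C m.

Lemma sum_polys0 (h : {poly F} -> int) : h 0 = 0 -> \sum_(a <- polys F 0) h a = 0.
Proof.
move=> h0; rewrite big_seq big1 // => a; rewrite mem_polys leqn0 size_poly_eq0.
by move/eqP => ->.
Qed.

Lemma sum_rchar_even k : ~~ odd d ->
  \sum_(a <- polys F k) rchar C a = #|F|.-1%:Z * \sum_(i < k) c i.
Proof.
move=> ev; elim: k => [|k IH].
  by rewrite sum_polys0 ?rchar0 // big_ord0 mulr0.
rewrite sum_polysS IH big_ord_recr mulrDr /=; congr (_ + _).
rewrite -sum_nonzero_const; apply: eq_bigr => b b0; apply: eq_bigr => m _.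
rewrite rcharZ // -(odd_double_half d) (negPf ev) add0n -mul2n exprM.
by rewrite expr2 qchar_sqr // expr1n mul1r.
Qed.

Lemma sum_rchar_odd k : odd d ->
  \sum_(a <- polys F k.+1) rchar C a * qchar a`_k = #|F|.-1%:Z * c k.
Proof.
move=> od; rewrite sum_polysS big_seq big1 ?add0r; last first.
  by move=> a; rewrite mem_polys => /leq_sizeP/(_ k (leqnn _)) ->; rewrite qchar0 mulr0.
rewrite -sum_nonzero_const; apply: eq_bigr => b b0; rewrite /c.
rewrite big_seq [RHS]big_seq; apply: eq_bigr => m.
rewrite mem_monics => /andP[/monicP monm /eqP szm].
have mk : m`_k = 1 by rewrite -monm lead_coefE szm.
rewrite rcharZ // coefZ mk mulr1 -mulrA mulrCA.
rewrite -(odd_double_half d) od -mul2n exprD exprM expr2 qchar_sqr // expr1n mulr1.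
by rewrite expr1 qchar_sqr // mulr1.
Qed.

(** For n >= d division by f distributes the monic polynomials of degree n evenly over the residue
    classes modulo f, and the character sums to zero over these. *)
Lemma rchar_sum_vanish n : (d <= n)%N -> c n = 0.
Proof.
move=> le; have [H [_ tot]] := rchar_poly_duality F2 sepf.
have f0 : f != 0 by rewrite monic_neq0 ?char_poly_monic.
rewrite /c /monics big_map (perm_big [seq t * f + u | t <- polys F (n - d), u <- polys F d]); last first.
  apply: uniq_perm; first exact: polys_uniq.
    apply: allpairs_uniq; rewrite ?polys_uniq //.
    move=> [t u] [t' u'] /allpairsP[[t1 u1] /= [_ su [-> ->]]].
    move=> /allpairsP[[t2 u2] /= [_ su' [-> ->]]].
    rewrite !mem_polys in su su'.
    move=> e; have := congr1 (fun p => p %% f) e; have := congr1 (fun p => p %/ f) e.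
    by rewrite /= !modp_addl_mul_small ?divp_addl_mul_small ?size_char_poly ?ltnS // => -> ->.
  move=> a; rewrite mem_polys; apply/idP/allpairsP => [sa|[[t u] /= []]].
    exists (a %/ f, a %% f); rewrite /= !mem_polys -divp_eq; split=> //.
      by rewrite size_divp // size_char_poly /= leq_sub2r.
    by rewrite -ltnS -(size_char_poly C) ltn_modp.
  rewrite !mem_polys => st su ->; apply: leq_trans (size_polyD _ _) _.
  rewrite geq_max (leq_trans su le) andbT; apply: leq_trans (size_polyMleq _ _) _.
  by rewrite size_char_poly addnS /= -(subnK le) leq_add2r.
rewrite big_allpairs_dep big1 // => t _.
pose r := 'X^n %% f; have sr : (size r <= d)%N by rewrite -ltnS -(size_char_poly C) ltn_modp.
rewrite (eq_bigr (fun u => rchar C (r + u))); last first.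
  move=> u _; rewrite -rchar_mod -[RHS]rchar_mod; congr (rchar C _).
  by rewrite !modpD modp_mull add0r /r modp_id.
rewrite -[RHS]tot -(big_map (fun u => r + u) xpredT); apply: perm_big.
apply: uniq_perm; rewrite ?polys_uniq //.
  by rewrite map_inj_uniq ?polys_uniq //; apply: addrI.
move=> a; rewrite mem_polys; apply/mapP/idP => [[u]|sa].
  rewrite mem_polys => su ->; apply: leq_trans (size_polyD _ _) _.
  by rewrite geq_max sr.
exists (a - r); last by rewrite addrC subrK.
rewrite mem_polys; apply: leq_trans (size_polyD _ _) _.
by rewrite size_polyN geq_max sa.
Qed.

Let l k := if odd d then c k else \sum_(i < k.+1) c i.

Let c0 : c 0 = 1.
Proof. exact: (@dirichlet_coef0 _ (rchar C) (rchar1 C)). Qed.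

(** The dualities carry an unknown factor H; their instance k = 0, where [l 0] is 1, identifies it
    as q - 1 times the coefficient in the top degree d + odd d - 2, which is 2g in both parities. *)
Lemma l_functional_equation k : (k.+2 <= d + odd d)%N ->
  l (d + odd d - 2) * l k = (#|F| ^ k)%:Z * l (d + odd d - 2 - k).
Proof.
have q1 : #|F|.-1%:Z != 0.
  by have := finNzRing_gt1 F; case: #|F| => [|[]].
rewrite /l; have [od|ev] := boolP (odd d).
  rewrite addn1 !subSS subn0 => le.
  have [H HH] := rchar_twisted_duality F2 sepf.
  have HE j : (j < d)%N -> H * c j = (#|F|.-1 * #|F| ^ j)%:Z * c (n' - j)%N.
    move=> lt; have := HH j lt; rewrite sum_rchar_odd // subSn // sum_rchar_odd //.
    rewrite mulrCA [RHS]mulrCA => /(mulfI q1); exact.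
  have := HE 0%N isT; rewrite c0 mulr1 expn0 muln1 subn0 => EH.
  have := HE k; rewrite EH PoszM -!mulrA => e; apply: (mulfI q1); rewrite e //.
rewrite addn0 /= => le.
have [H [HH _]] := rchar_poly_duality F2 sepf.
have HE j : (j.+1 < d)%N -> H * \sum_(i < j.+1) c i =
    (#|F|.-1 * #|F| ^ j)%:Z * \sum_(i < (n'.-1 - j).+1) c i.
  move=> lt; have := HH j (ltnW lt); rewrite !sum_rchar_even //.
  rewrite mulrCA [RHS]mulrCA => /(mulfI q1) ->; congr (_ * _).
  have -> : (n' - j = (n'.-1 - j).+1)%N by move: lt; lia.
  by [].
have d2 : (2 <= d)%N by apply: leq_trans le.
have := HE 0%N d2; rewrite big_ord1 c0 mulr1 expn0 muln1 subn0 => EH.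
have := HE k le; rewrite EH PoszM -!mulrA => /(mulfI q1).
have -> : (n'.+1 - 2 = n'.-1)%N by lia.
by [].
Qed.

Lemma l_vanish k : (d + odd d - 2 < k)%N -> l k = 0.
Proof.
rewrite /l; have [od|ev] := boolP (odd d).
  by rewrite addn1 !subSS subn0 => lt; rewrite rchar_sum_vanish.
rewrite addn0 => lt.
have tot : \sum_(i < d) c i = 0.
  have [H [_ tot]] := rchar_poly_duality F2 sepf.
  have := sum_rchar_even d ev; rewrite tot => /esym/eqP; rewrite mulf_eq0.
  by have := finNzRing_gt1 F; case: #|F| => [|[]] //= m _ /eqP.
have le : (d <= k.+1)%N by move: lt; lia.
rewrite -(subnK le) addnC big_split_ord /= tot add0r big1 // => i _.
by rewrite rchar_sum_vanish // leq_addr.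
Qed.

(** The sign of [fchar] in degree one; its square is 1, so twisting the coefficients by its powers
    preserves the functional equation. *)
Let eps : int := qchar ((-1) ^+ d : F).
Let L k := eps ^+ k * l k.
Let Cf := dirichlet_coef (fchar C).

Let CfE k : Cf k = eps ^+ k * c k.
Proof.
rewrite /Cf /dirichlet_coef /c mulr_sumr big_seq [RHS]big_seq.
apply: eq_bigr => m; rewrite mem_monics => /andP[_ /eqP szm].
by rewrite /fchar szm exprM qcharX.
Qed.

Let epsK : eps * eps = 1.
Proof. by rewrite qchar_sqr // expf_neq0 // oppr_eq0 oner_eq0. Qed.

Let eps_even : ~~ odd d -> eps = 1.
Proof. by move=> ev; rewrite /eps -signr_odd (negPf ev) expr0 qchar1. Qed.

(* For [d] even the L-function of the character has the trivial factor [1 - T],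
   coming from the two points at infinity; dividing by it turns the coefficients
   into partial sums. *)
Theorem L_coefficients :
  exists (a S : nat -> int),
  [/\ a 0%N = 1,
      forall k, (d + odd d - 2 < k)%N -> a k = 0,
      forall k, (k <= d + odd d - 2)%N ->
        a (d + odd d - 2)%N * a k = (#|F| ^ k)%:Z * a (d + odd d - 2 - k)%N,
      forall n, a n *+ n = \sum_(1 <= j < n.+1) (S j + ~~ odd d) * a (n - j)%N
    & forall j (K : finFieldType) (iota : {rmorphism F -> K}), (0 < j)%N ->
        #|K| = (#|F| ^ j)%N -> \sum_x qchar (map_poly iota f).[x] = S j].
Proof.
pose irrsum n j := \sum_(P <- irrs F n | ((size P).-1 %| j)%N)
      fchar C P ^+ (j %/ (size P).-1) *+ (size P).-1.
have sumE n j (K : finFieldType) (iota : {rmorphism F -> K}) : (0 < j <= n)%N ->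
    #|K| = (#|F| ^ j)%N -> \sum_x qchar (map_poly iota f).[x] = irrsum n j.
  move=> jn cK; apply: (sum_over_extension (chi := fchar C) (iota := iota) jn cK) => P x irrP monP Px.
  by case/andP: jn => j0 _; apply: fchar_root.
have irrsumE n j : (0 < j <= n)%N -> irrsum j j = irrsum n j.
  move=> jn; have j0 : (0 < j)%N by case/andP: jn.
  have [K [iota cK]] := finField_extension F j0.
  by rewrite -(sumE n j K iota) // (sumE j j K iota) // j0 leqnn.
pose S j := irrsum j j.
have Crec n : Cf n *+ n = \sum_(1 <= j < n.+1) S j * Cf (n - j)%N.
  apply: dirichlet_coef_rec (fchar1 C) (fcharM C F2) _ _ _ => j jn.
  exact: irrsumE.
have d_gt1 : (2 <= d + odd d)%N by rewrite /=; case: (n') => [|[|m]] //=; lia.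
exists L, S; split.
- rewrite /L expr0 mul1r /l big_ord1 c0; by case: ifP.
- by move=> k lt; rewrite /L l_vanish ?mulr0.
- move=> k le; rewrite /L mulrACA l_functional_equation; last by move: le d_gt1; lia.
  rewrite mulrCA; congr (_ * _); congr (_ * _).
  rewrite -{1}(subnK le) exprD -!mulrA -exprMn epsK expr1n mulr1 //.
- move=> n; have [od|ev] := boolP (odd d).
    have LE k : L k = Cf k by rewrite /L /l od CfE.
    rewrite LE Crec; apply: eq_bigr => j _; by rewrite LE addr0.
  have LE k : L k = \sum_(i < k.+1) Cf i.
    rewrite /L /l (negPf ev) eps_even // expr1n mul1r; apply: eq_bigr => i _.
    by rewrite CfE eps_even // expr1n mul1r.
  have LS k : L k.+1 = L k + Cf k.+1 by rewrite !LE big_ord_recr.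
  (* For d even L is [Cf] divided by 1 - T, so its logarithmic derivative gains \sum_(j > 0) T^j:
     each [S j] is increased by 1. *)
  transitivity (\sum_(1 <= j < n.+1) S j * L (n - j)%N + \sum_(i < n) L i).
    elim: n => [|n IH]; first by rewrite big_geq // big_ord0 mulr0n addr0.
    rewrite LS mulrnDl Crec mulrS IH big_ord_recr /=.
    rewrite !(big_nat_recr n.+1) //= subnn.
    have -> : \sum_(1 <= i < n.+1) S i * L (n.+1 - i)%N =
      \sum_(1 <= i < n.+1) S i * L (n - i)%N + \sum_(1 <= i < n.+1) S i * Cf (n.+1 - i)%N.
      rewrite -big_split /=; apply: eq_big_nat => i /andP[_ lt].
      by rewrite subSn // LS mulrDr.
    have -> : L 0%N = Cf 0%N by rewrite LE big_ord1.
    ring.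
  rewrite [RHS](eq_bigr (fun j => S j * L (n - j)%N + L (n - j)%N)); last first.
    by move=> j _; rewrite /= mulrDl mul1r.
  rewrite big_split /=; congr (_ + _); rewrite [RHS]big_add1 /= big_mkord.
  by rewrite (reindex_inj rev_ord_inj) /=; apply: eq_bigr => i _.
- by move=> j K iota j0 cK; apply: sumE => //; rewrite j0 leqnn.
Qed.

End LCoefficients.

(** * The Hasse-Witt matrix *)

Lemma sum_expf_finField (K : finFieldType) m :
  \sum_(x : K) x ^+ m = if (0 < m)%N && (#|K|.-1 %| m)%N then -1 else 0.
Proof.
have K1 : (1 < #|K|)%N := finNzRing_gt1 K.
case: posnP => [->|m0] /=.
  under eq_bigr do rewrite expr0.
  by rewrite sumr_const card_char.
case: ifP => [/dvdnP[k Dm]|nd].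
  rewrite (bigD1 0) //= expr0n gtn_eqF // add0r.
  rewrite (eq_bigr (fun=> 1)) => [|x x0]; last by rewrite Dm mulnC exprM expf_card_pred // expr1n.
  rewrite sumr_const cardC1; apply/eqP; rewrite -addr_eq0 -mulrSr prednK ?card_char //.
  exact: ltnW.
have r_gt0 : (0 < m %% #|K|.-1)%N by rewrite lt0n; apply/negbT.
have [y y0 ym] : exists2 y : K, y != 0 & y ^+ m != 1.
  case: (pickP (fun y : K => (y != 0) && (y ^+ m != 1))) => [y /andP[]|none]; first by exists y.
  have : (#|K|.-1 <= m %% #|K|.-1)%N.
    apply: leq_trans (card_unity_le K r_gt0).
    rewrite -[X in (X <= _)%N](cardC1 (0 : K)); apply: subset_leq_card.
    apply/subsetP => x; rewrite !inE => x0; have := none x; rewrite /= x0 /=.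
    move/negbFE; rewrite {1}(divn_eq m #|K|.-1) exprD mulnC exprM.
    by rewrite expf_card_pred // expr1n mul1r.
  by rewrite leqNgt ltn_mod -subn1 subn_gt0 K1.
set s := \sum_x _; have : s = y ^+ m * s.
  rewrite mulr_sumr {1}/s (reindex_inj (mulfI y0)) /=.
  by apply: eq_bigr => x _; rewrite exprMn.
move/eqP; rewrite -subr_eq0 -{1}[s]mul1r -mulrBl mulf_eq0 subr_eq0 eq_sym.
by rewrite (negPf ym) => /eqP.
Qed.

Section HasseWitt.

(* With rows and columns numbered from 1, the [(i, j)] entry is the coefficient
   of [x^(Q i - j)]. *)
Definition hasse_witt (R : nzRingType) g Q (u : {poly R}) : 'M[R]_g :=
  \matrix_(i, j) u`_(Q * i.+1 - j.+1).

Lemma map_hasse_witt (R S : nzRingType) (h : {rmorphism R -> S}) g Q (u : {poly R}) :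
  map_mx h (hasse_witt g Q u) = hasse_witt g Q (map_poly h u).
Proof. by apply/matrixP => i j; rewrite !mxE coef_map. Qed.

Variables (F : fieldType) (g : nat) (f : {poly F}).
Hypothesis szf : (size f <= 2 * g + 3)%N.

Local Notation hw Q := (hasse_witt g Q (f ^+ (Q.-1./2))).

Lemma size_half_exp Q : odd Q -> (size (f ^+ Q.-1./2) <= g.+1 * Q.-1 + 1)%N.
Proof.
move=> oQ; have [->|f0] := eqVneq f 0.
  rewrite expr0n; case: eqP => _; first by rewrite size_poly1 addn1.
  by rewrite size_poly0.
have le : ((size f).-1 * Q.-1./2 <= g.+1 * Q.-1)%N.
  have e : Q.-1 = (Q.-1./2).*2.
    by move: oQ; case: Q => //= Q eQ; rewrite even_halfK.
  rewrite [X in (_ <= _ * X)%N]e -mul2n mulnA leq_mul2r; apply/orP; right.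
  by move: szf; case: size => //= n; lia.
by rewrite addn1 -(prednK (_ : 0 < size (f ^+ _)))%N ?ltnS ?size_exp // size_poly_gt0 expf_neq0.
Qed.

Lemma pchar_polyX Q (u : {poly F}) : [pchar F].-nat Q ->
  u ^+ Q = \sum_(m < size u) (u`_m ^+ Q) *: 'X^(m * Q).
Proof.
move=> pQ.
have pQ' : [pchar {poly F}].-nat Q.
  move: pQ; rewrite /pnat => /andP[-> /allP h] /=; apply/allP => l /h.
  by rewrite !inE => /andP[-> ] /=; rewrite -polyC_natr => /eqP ->; rewrite eqxx.
rewrite -{1}(coefK u) poly_def.
rewrite (big_morph (fun v : {poly F} => v ^+ Q) (id1 := 0) (op1 := +%R)).
- by apply: eq_bigr => m _; rewrite exprZn exprM.
- by move=> v w; apply: exprDn_pchar.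
- by rewrite expr0n gtn_eqF //; case/andP: pQ.
Qed.

(** f^((Q1 Q2 - 1)/2) is the product of f^((Q1 - 1)/2) and the Q1-th power of f^((Q2 - 1)/2), a
    polynomial in x^Q1. The coefficient of x^(Q1 Q2 i - j) is thus a sum over k of products of the
    entries (i, k) and (k, j), the former raised to the power Q1. *)
Lemma hasse_wittM Q1 Q2 : odd Q1 -> odd Q2 -> (g <= Q1)%N -> (g <= Q2)%N ->
  [pchar F].-nat Q1 ->
  hw (Q1 * Q2)%N = map_mx (fun x => x ^+ Q1) (hw Q2) *m hw Q1.
Proof.
move=> o1 o2 g1 g2 pQ.
have half Q : odd Q -> Q = (Q.-1./2).*2.+1.
  by case: Q => //= Q eQ; rewrite even_halfK.
have Dexp : ((Q1 * Q2).-1./2 = Q1.-1./2 + Q2.-1./2 * Q1)%N.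
  have -> : (Q1 * Q2)%N = ((Q1.-1./2 + Q2.-1./2 * Q1).*2).+1.
    rewrite {1}(half Q2 o2) mulnS -doubleMr mulnC doubleD.
    by have := half Q1 o1; lia.
  by rewrite /= doubleK.
rewrite Dexp exprD exprM; set u1 := f ^+ Q1.-1./2; set u2 := f ^+ Q2.-1./2.
have Q1_gt0 : (0 < Q1)%N by case: Q1 o1 {half Dexp u1 pQ g1}.
have Q2_gt0 : (0 < Q2)%N by case: Q2 o2 {half Dexp u2 g2}.
apply/matrixP => i j; rewrite !mxE (pchar_polyX _ pQ) mulr_sumr coef_sum.
set M := (Q2 * i.+1)%N; set N := (Q1 * Q2 * i.+1 - j.+1)%N.
have jQ1 : (j.+1 <= Q1)%N by rewrite (leq_trans (ltn_ord j)).
pose G m := if (m < M)%N then u2`_m ^+ Q1 * u1`_(N - m * Q1) else 0.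
transitivity (\sum_(m < size u2) G m).
  apply: eq_bigr => m _; rewrite -scalerAr coefZ coefMXn /G.
  have -> : (N < m * Q1)%N = ~~ (m < M)%N.
    rewrite -leqNgt /N -mulnA -/M; apply/idP/idP => [lt|le].
      rewrite leqNgt; apply/negP => ltm; move: lt.
      have : (m * Q1 + Q1 <= Q1 * M)%N by rewrite addnC -mulSn mulnC leq_mul2l ltm orbT.
      by move: jQ1; lia.
    have : (Q1 * M <= m * Q1)%N by rewrite mulnC leq_mul2r le orbT.
    have : (0 < Q1 * M)%N by rewrite muln_gt0 Q1_gt0 muln_gt0 Q2_gt0.
    by lia.
  by case: (m < M)%N; rewrite ?mulr0.
transitivity (\sum_(m < M) G m).
  have big n1 n2 : (forall m, (n1 <= m)%N -> G m = 0) ->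
      (n1 <= n2)%N -> \sum_(m < n2) G m = \sum_(m < n1) G m.
    move=> G0 le; rewrite -!(big_mkord xpredT G) (big_cat_nat (n := n1)) //=.
    rewrite [X in _ + X]big_nat [X in _ + X]big1 ?addr0 // => m /andP[le' _].
    exact: G0.
  have GM m : (M <= m)%N -> G m = 0 by rewrite /G ltnNge => ->.
  have Gs m : (size u2 <= m)%N -> G m = 0.
    rewrite /G; case: ifP => // _ le; rewrite nth_default //.
    by rewrite expr0n eqn0Ngt Q1_gt0 mul0r.
  by have [le|/ltnW le] := leqP (size u2) M; [rewrite (big _ _ Gs le)|rewrite (big _ _ GM le)].
rewrite (reindex_inj rev_ord_inj) /=.
have gM : (g <= M)%N by rewrite (leq_trans g2) // leq_pmulr.
pose G' k := u2`_(M - k.+1) ^+ Q1 * u1`_(Q1 * k.+1 - j.+1).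
transitivity (\sum_(k < M) G' k).
  apply: eq_bigr => k _; have ltk := ltn_ord k; rewrite /G' /G.
  have -> : (M - k.+1 < M)%N by move: ltk; lia.
  congr (_ * u1`_ _); rewrite /N -mulnA -/M.
  have : ((M - k.+1) * Q1 + Q1 * k.+1 = Q1 * M)%N.
    by rewrite [X in (X + _)%N]mulnC -mulnDr subnK.
  have : (Q1 <= Q1 * k.+1)%N by rewrite leq_pmulr.
  by move: jQ1; lia.
rewrite -(big_mkord xpredT G') (big_cat_nat (n := g)) //= big_mkord.
(* For a middle index beyond g the exponent in [u1] exceeds (g + 1)(Q1 - 1), which bounds the degree
   of [u1]. *)
rewrite [X in _ + X]big_nat [X in _ + X]big1 ?addr0; last first.
  move=> k /andP[gk kM]; rewrite /G' [u1`_ _]nth_default ?mulr0 //.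
  apply: leq_trans (size_half_exp o1) _.
  have := ltn_ord j.
  have : (Q1 * g.+1 <= Q1 * k.+1)%N by rewrite leq_mul2l ltnS gk orbT.
  have : (g.+1 * Q1 = g.+1 * Q1.-1 + g.+1)%N by rewrite -mulnSr prednK.
  by rewrite (mulnC Q1 g.+1); lia.
by apply: eq_bigr => k _; rewrite !mxE.
Qed.

End HasseWitt.

Lemma sum_multiples (R : nmodType) (G : nat -> R) n s : (0 < s)%N ->
  \sum_(m < n * s + 1 | (0 < m)%N && (s %| m)%N) G m = \sum_(k < n) G (k.+1 * s)%N.
Proof.
move=> s0; rewrite -(big_mkord (fun m => (0 < m)%N && (s %| m)%N) G).
rewrite -(big_mkord xpredT (fun k => G (k.+1 * s)%N)) -[LHS]big_filter.
rewrite (perm_big [seq (k.+1 * s)%N | k <- index_iota 0 n]) ?big_map //.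
apply: uniq_perm; rewrite ?filter_uniq ?iota_uniq //.
  by rewrite map_inj_uniq ?iota_uniq // => a b /eqP; rewrite eqn_pmul2r // eqSS => /eqP.
move=> m; rewrite mem_filter mem_index_iota /= addn1 ltnS.
apply/andP/mapP => [[/andP[m0 /dvdnP[k Dk]] le]|[k + ->]].
  exists k.-1; last by rewrite prednK // -(ltn_pmul2r s0) mul0n -Dk.
  rewrite mem_index_iota /= prednK.
    by rewrite -(leq_pmul2r s0) -Dk.
  by rewrite -(ltn_pmul2r s0) mul0n -Dk.
by rewrite mem_index_iota /= => lt; rewrite dvdn_mull // muln_gt0 s0 leq_pmul2r.
Qed.

Definition genus_degree g d := d = (2 * g + 1)%N \/ d = (2 * g + 2)%N.

(** Summing over x kills every power of x except the positive multiples of |K| - 1. The first g of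
    these give the diagonal entries; the (g + 1)-th gives the leading coefficient 1 if d = 2g + 2
    and exceeds the degree if d = 2g + 1. *)
Lemma sum_half_power (K : finFieldType) g d (f : {poly K}) :
  2%:R != 0 :> K -> genus_degree g d -> f \is monic -> size f = d.+1 ->
  \sum_x f.[x] ^+ (#|K|.-1./2) =
    - \tr (hasse_witt g #|K| (f ^+ (#|K|.-1./2))) - (~~ odd d)%:R.
Proof.
move=> K2 gd monf szf; set h := _./2; set u := f ^+ h.
have q2 : #|K|.-1 = h.*2 by apply: card_finField_pred.
have h0 : (0 < h)%N by apply: half_card_gt0.
have szu : size u = (d * h + 1)%N.
  rewrite /u addn1 -(prednK (_ : 0 < size (f ^+ h)))%N ?size_exp ?szf //.
  by rewrite size_poly_gt0 monic_neq0 ?monic_exp.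
have le_u : (size u <= g.+1 * #|K|.-1 + 1)%N.
  rewrite szu q2 -mul2n mulnA leq_add2r leq_mul2r; apply/orP; right.
  by case: gd => ->; lia.
transitivity (\sum_(m < g.+1 * #|K|.-1 + 1) u`_m * \sum_(x : K) x ^+ m).
  under [RHS]eq_bigr do rewrite mulr_sumr.
  rewrite exchange_big /=; apply: eq_bigr => x _.
  by rewrite -horner_exp (horner_coef_wide _ le_u).
transitivity (- \sum_(m < g.+1 * #|K|.-1 + 1 | (0 < m)%N && (#|K|.-1 %| m)%N) u`_m).
  rewrite [in RHS]big_mkcond -sumrN; apply: eq_bigr => m _.
  by rewrite sum_expf_finField; case: ifP => _; rewrite ?mulrN1 ?mulr0 ?oppr0.
rewrite (sum_multiples (fun m => u`_m)); last by rewrite q2 double_gt0.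
rewrite big_ord_recr /= opprD; congr (- _ - _).
  apply: eq_bigr => i _; rewrite mxE; congr (u`_ _).
  by rewrite -subn1 mulnBr muln1 mulnC.
case: gd => Dd.
  rewrite nth_default; first by rewrite Dd oddD oddM.
  by rewrite szu q2 Dd addn1 -mul2n mulnA ltn_pmul2r //; lia.
have -> : odd d = false by rewrite Dd oddD oddM.
have -> : (g.+1 * #|K|.-1 = (size u).-1)%N.
  by rewrite szu addn1 /= q2 Dd -mul2n mulnA; congr (_ * _)%N; lia.
by rewrite -lead_coefE; apply/eqP; rewrite -monicE monic_exp.
Qed.

Section HasseWittCongruence.

Variables (F : finFieldType) (n' : nat) (C : 'M[F]_n'.+1) (g' : nat).
Local Notation d := n'.+1.
Local Notation g := g'.+1.
Local Notation f := (char_poly C).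
Hypotheses (F2 : 2%:R != 0 :> F) (gd : genus_degree g d) (gq : (g <= #|F|)%N).

Local Notation hw Q := (hasse_witt g Q (f ^+ (Q.-1./2))).

Let szf : (size f <= 2 * g + 3)%N.
Proof. by rewrite size_char_poly; case: gd => ->; rewrite ?addn1 ?addn2 ?addn3. Qed.

Lemma hasse_witt_pow n : (0 < n)%N -> hw (#|F| ^ n)%N = hw #|F| ^+ n.
Proof.
case: n => // n _; elim: n => [|n IH]; first by rewrite expn1 expr1.
have oq : odd #|F| := odd_card_finField F2.
have q_gt0 : (0 < #|F|)%N by case: #|F| oq.
rewrite expnS hasse_wittM ?oddX ?oq ?orbT //.
- rewrite [RHS]exprSr -IH -mulmxE; congr (_ *m _).
  by apply/matrixP => i j; rewrite mxE expf_card.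
- by rewrite (leq_trans gq) // -{1}(expn1 #|F|) leq_pexp2l.
- exact: (card_pcharnat idfun).
Qed.

Lemma qchar_sum_mod (K : finFieldType) (iota : {rmorphism F -> K}) j :
  (0 < j)%N -> #|K| = (#|F| ^ j)%N ->
  (\sum_x qchar (map_poly iota f).[x])%:~R = - \tr (hw #|F| ^+ j) - (~~ odd d)%:R :> F.
Proof.
move=> j0 cK; have K2 : 2%:R != 0 :> K by rewrite -(rmorph_nat iota) fmorph_eq0.
apply: (fmorph_inj iota); rewrite rmorph_int rmorph_sum /=.
under eq_bigr do rewrite qchar_intr //.
rewrite (@sum_half_power _ g d) // ?map_monic ?char_poly_monic //; last first.
  by rewrite size_map_poly size_char_poly.
rewrite rmorphB rmorphN rmorph_nat -hasse_witt_pow //= -cK; congr (- _ - _).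
rewrite -rmorphXn -map_hasse_witt /mxtrace rmorph_sum.
by apply: eq_bigr => i _; rewrite mxE.
Qed.

Hypothesis p_big : forall n, (0 < n <= 2 * g)%N -> n%:R != 0 :> F.

Lemma coefficients_mod (a S : nat -> int) :
  a 0%N = 1 ->
  (forall n, a n *+ n = \sum_(1 <= j < n.+1) (S j + ~~ odd d) * a (n - j)%N) ->
  (forall j (K : finFieldType) (iota : {rmorphism F -> K}), (0 < j)%N ->
        #|K| = (#|F| ^ j)%N -> \sum_x qchar (map_poly iota f).[x] = S j) ->
  forall n, (n <= 2 * g)%N -> (a n)%:~R = rev_char_poly_coef (hw #|F|) n :> F.
Proof.
move=> a0 arec HS; apply: (newton_unique (p := fun j => \tr (hw #|F| ^+ j))).
- move=> n ng x y /(mulfI _); apply; exact: p_big.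
- by rewrite a0 rev_char_poly_coef0.
- move=> n ng; rewrite -[LHS]rmorphMn arec rmorph_sum -sumrN big_nat [RHS]big_nat.
  apply: eq_bigr => j /andP[j0 _]; rewrite rmorphM rmorphD /= -pmulrn.
  have [K [iota cK]] := finField_extension F j0.
  by rewrite -(HS j K iota j0 cK) (qchar_sum_mod iota j0 cK) subrK mulNr.
- by move=> n ng; rewrite newton_char_poly.
Qed.

End HasseWittCongruence.

(** * Slopes *)

Section Slopes.

Variables (p m g : nat) (L : {poly int}).
Hypotheses (p_pr : prime p) (m_gt0 : (0 < m)%N) (g_gt0 : (0 < g)%N).
Local Notation q := (p ^ m)%N.
Hypothesis L0 : L`_0 = 1.
Hypothesis L_big : forall k, (2 * g < k)%N -> L`_k = 0.
Hypothesis L_fe : forall k, (k <= 2 * g)%N ->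
  L`_(2 * g) * L`_k = (q ^ k)%:Z * L`_(2 * g - k).
Hypothesis L_mod : forall k, (g < k <= 2 * g)%N -> (p%:Z %| L`_k)%Z.

Let w k := logn p (absz L`_k).
Let v k : rat := qval p q L`_k.

Let p_gt0 : (0 < p)%N. Proof. exact: prime_gt0. Qed.

Let lognq k : logn p (q ^ k) = (m * k)%N.
Proof. by rewrite -expnM lognX logn_prime // eqxx muln1. Qed.

Let vE k : v k = (w k)%:R / m%:R.
Proof. by rewrite /v /qval -[q]expn1 lognq muln1. Qed.

Let m0 : m%:R != 0 :> rat. Proof. by rewrite pnatr_eq0 -lt0n. Qed.

Let Ltop : absz L`_(2 * g) = (q ^ g)%N.
Proof.
have := L_fe (leqnn _); rewrite subnn L0 mulr1 => /(congr1 absz).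
rewrite abszM absz_nat => e; apply/eqP; rewrite -(eqn_exp2r _ _ (isT : (0 < 2)%N)).
by rewrite -mulnn e mulnC expnM.
Qed.

Let Ltop0 : L`_(2 * g) != 0.
Proof. by rewrite -absz_eq0 Ltop -lt0n !expn_gt0 p_gt0. Qed.

Let w_fe k : (k <= 2 * g)%N -> L`_k != 0 ->
  L`_(2 * g - k) != 0 /\ (m * g + w k = m * k + w (2 * g - k))%N.
Proof.
move=> le Lk; have := congr1 absz (L_fe le); rewrite !abszM absz_nat Ltop => e.
have Lk' : L`_(2 * g - k) != 0.
  apply: contraTneq isT => z; move: e; rewrite z absz0 muln0 => /eqP.
  by rewrite muln_eq0 absz_eq0 (negPf Lk) orbF -Ltop absz_eq0 (negPf Ltop0).
split=> //; have := congr1 (logn p) e.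
by rewrite !lognM ?expn_gt0 ?p_gt0 ?absz_gt0 // !lognq.
Qed.

Let v_ge0 k : 0 <= v k.
Proof. by rewrite vE divr_ge0 ?ler0n. Qed.

Let v_fe k : (k <= 2 * g)%N -> L`_k != 0 ->
  L`_(2 * g - k) != 0 /\ g%:R + v k = k%:R + v (2 * g - k).
Proof.
move=> le Lk; have [Lk' e] := w_fe le Lk; split=> //.
have := congr1 (fun n => n%:R : rat) e; rewrite /= !natrD !natrM !vE => e'.
apply: (mulfI m0); rewrite !mulrDr !(mulrCA m%:R _ m%:R^-1) !mulfV // !mulr1.
exact: e'.
Qed.

Let v_ge k : L`_k != 0 -> k%:R - g%:R <= v k.
Proof.
move=> Lk; have le : (k <= 2 * g)%N.
  by rewrite leqNgt; apply: contra Lk => /L_big ->.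
have [_ e] := v_fe le Lk; have := v_ge0 (2 * g - k).
lra.
Qed.

Let v0 : v 0 = 0.
Proof. by rewrite vE /w L0 logn1 mul0r. Qed.

Let vtop : v (2 * g) = g%:R.
Proof.
have L00 : L`_0 != 0 by rewrite L0.
by have [_] := v_fe (leq0n _) L00; rewrite subn0 v0; lra.
Qed.

(** The points satisfy v_k >= max(0, k - g), with equality at 0, g and 2g. An edge ending at or
    before g must be flat and one starting at or after g has slope 1; an edge strictly across g
    would have slope at most 0 and height at most 0 at g, yet end at a positive height. *)
Lemma slopes_of_unit : ~~ (p%:Z %| L`_g)%Z ->
  forall s, newton_slope p q L s -> s = 0 \/ s = 1.
Proof.
move=> ndv s [i [j [lt_ij Li Lj]]]; rewrite -/(v i) -/(v j) => Dj below.
have Lg : L`_g != 0 by apply: contraNneq ndv => ->; rewrite dvdz0.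
have vg : v g = 0.
  rewrite vE /w logn_coprime ?mul0r // prime_coprime //.
have bel k : L`_k != 0 -> v i + s * (k%:R - i%:R) <= v k by apply: below.
have b0 := bel 0%N; rewrite v0 L0 oner_eq0 in b0; have {}b0 := b0 isT.
have bg := bel g Lg; rewrite vg in bg.
have bt := bel _ Ltop0; rewrite vtop natrM in bt.
have ltr_ij : i%:R < j%:R :> rat by rewrite ltr_nat.
have jt : j%:R <= 2%:R * g%:R :> rat.
  rewrite -natrM ler_nat leqNgt; apply: contra Lj => /L_big ->; exact: eqxx.
have i0 : 0 <= i%:R :> rat by rewrite ler0n.
have [vi vj] := (v_ge0 i, v_ge0 j).
have [vi' vj'] := (v_ge Li, v_ge Lj).
move: {below bel} ltr_ij jt i0 vi vj vi' vj' bt bg b0 Dj.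
move: (v i) (v j) (i%:R : rat) (j%:R : rat) (g%:R : rat) => vi vj I J G.
move=> ltIJ Jt I0 vi0 vj0 vi1 vj1 bt bg b0 Dj; subst vj.
have [leJ|ltJ] := lerP J G; first left.
  have [s0|s0|//] := ltgtP s 0; exfalso.
    have : s * (I - J) > 0 by rewrite nmulr_rgt0 // subr_lt0.
    have : s * I <= 0 by rewrite nmulr_rle0.
    by move: b0 vj0 vi0; rewrite !mulrBr mulr0; lra.
  have : 0 < s * (G - I) by rewrite pmulr_rgt0 // subr_gt0 (lt_le_trans ltIJ).
  by move: bg vi0; lra.
have [leI|ltI] := lerP G I; first right.
  have [s1|s1|//] := ltgtP s 1; exfalso.
    have h1 : 0 < (1 - s) * (J - I) by rewrite pmulr_rgt0 subr_gt0.
    have h2 : 0 <= (1 - s) * (I - G) by rewrite pmulr_rge0 ?subr_gt0 ?subr_ge0.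
    by nra.
  have h1 : 0 < (s - 1) * (2 * G - I) by rewrite pmulr_rgt0 subr_gt0 // (lt_le_trans ltIJ).
  by nra.
exfalso; have s0 : s <= 0.
  rewrite leNgt; apply/negP => s0.
  have : 0 < s * (G - I) by rewrite pmulr_rgt0 // subr_gt0.
  by lra.
have : s * (J - G) <= 0 by rewrite mulr_le0_ge0 // subr_ge0 ltW.
by nra.
Qed.

(** Let r be the last index with v_r = 0; it is below g because p divides L_k for all k >= g. The
    line from (r, 0) of least slope to a later point supports the polygon, and that slope is
    positive and at most g / (2g - r) < 1. *)
Lemma slope_of_nonunit : (p%:Z %| L`_g)%Z ->
  exists2 s, newton_slope p q L s & 0 < s < 1.
Proof.
move=> dv.
have w_gt0 k : (g <= k)%N -> L`_k != 0 -> (0 < w k)%N.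
  move=> gk Lk; rewrite logn_gt0 mem_primes p_pr absz_gt0 Lk /=.
  have [<-|ne] := eqVneq g k; first exact: dv.
  apply: L_mod; rewrite ltn_neqAle ne gk /= leqNgt.
  by apply: contra Lk => /L_big ->.
pose P k := (L`_k != 0) && (w k == 0%N).
have P0 : exists k, P k by exists 0%N; rewrite /P /w L0 logn1.
have Pb k : P k -> (k <= g)%N.
  case/andP => Lk /eqP wk; rewrite leqNgt; apply/negP => /ltnW/w_gt0/(_ Lk).
  by rewrite wk.
have [r /andP[Lr /eqP wr] rmax] := ex_maxnP P0 Pb.
have lt_rg : (r < g)%N.
  rewrite ltnNge; apply/negP => /w_gt0/(_ Lr); by rewrite wr.
have ltrg : r%:R < g%:R :> rat by rewrite ltr_nat.
pose Q (k : 'I_(2 * g).+1) := (r < k)%N && (L`_k != 0).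
have Qtop : Q ord_max by rewrite /Q /= Ltop0 andbT; lia.
pose sl (k : 'I_(2 * g).+1) : rat := v k / (k%:R - r%:R).
have [j /andP[rj Lj] jmin] := arg_minP sl Qtop.
have pos k : (r < k)%N -> 0 < k%:R - r%:R :> rat by rewrite subr_gt0 ltr_nat.
have vpos k : (r < k)%N -> L`_k != 0 -> 0 < v k.
  move=> rk Lk; rewrite vE divr_gt0 ?ltr0n // lt0n; apply/eqP => wk.
  by have := rmax k; rewrite /P Lk wk leqNgt rk => /(_ isT).
have vr : v r = 0 by rewrite vE wr mul0r.
have s0 : 0 < sl j by rewrite divr_gt0 ?pos ?vpos.
exists (sl j); last first.
  rewrite s0 /=; apply: le_lt_trans (jmin _ Qtop) _.
  rewrite /sl /= vtop ltr_pdivrMr; last by apply: pos; lia.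
  by rewrite natrM; lra.
exists r, j; split=> //; rewrite -/(v j) -/(v r) vr ?add0r.
  by rewrite /sl divfK // lt0r_neq0 // pos.
move=> k Lk; rewrite -/(v k); have [rk|kr] := ltnP r k.
  rewrite add0r -ler_pdivlMr ?pos //.
  have kb : (k < (2 * g).+1)%N.
    by rewrite ltnS leqNgt; apply: contra Lk => /L_big ->.
  by have := jmin (Ordinal kb); apply; rewrite /Q rk.
rewrite add0r (le_trans _ (v_ge0 k)) // mulr_ge0_le0 ?(ltW s0) // subr_le0 ler_nat.
exact: kr.
Qed.

Lemma ordinary_slopes_iff :
  (forall s, newton_slope p q L s -> s = 0 \/ s = 1) <-> ~~ (p%:Z %| L`_g)%Z.
Proof.
split=> [H|]; last exact: slopes_of_unit.
apply/negP => /slope_of_nonunit[s /H[] ->]; rewrite ?ltxx ?andbF //.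
Qed.

End Slopes.

(** * The numerator of the zeta function *)

Lemma prod_reversed_roots (K : closedFieldType) (P : {poly K}) N :
  P`_0 = 1 -> size P = N.+1 ->
  exists b : 'I_N -> K, P = \prod_i (1 - b i *: 'X).
Proof.
move=> P0 szP; have [r Dr] := closed_field_poly_normal P.
have Pn0 : P != 0 by rewrite -size_poly_eq0 szP.
have szr : size r = N.
  apply: succn_inj; rewrite -szP Dr size_scale ?lead_coef_eq0 //.
  by rewrite size_prod_XsubC.
have r0 z : z \in r -> z != 0.
  move=> zr; apply: contra_eqN P0 => /eqP z0.
  have : root P z by rewrite Dr rootZ ?lead_coef_eq0 // root_prod_XsubC.
  by rewrite z0 rootE horner_coef0 => /eqP ->; rewrite eq_sym oner_eq0.
exists (fun i => (r`_i)^-1).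
have -> : \prod_(i < N) (1 - (r`_i)^-1 *: 'X) = \prod_(z <- r) (1 - z^-1 *: 'X).
  by rewrite (big_nth 0) szr big_mkord.
have fact : \prod_(z <- r) ('X - z%:P) =
    (\prod_(z <- r) (- z)) *: \prod_(z <- r) (1 - z^-1 *: 'X).
  rewrite -mul_polyC rmorph_prod -big_split /= big_seq [RHS]big_seq.
  apply: eq_bigr => z /r0 z0; rewrite mulrBr mulr1 polyCN mulNr opprK.
  by rewrite mul_polyC scalerA divff // scale1r addrC.
rewrite {1}Dr fact scalerA.
have e : (\prod_(z <- r) (1 - z^-1 *: 'X))`_0 = 1.
  by rewrite -horner_coef0 horner_prod big1 // => z _; rewrite !(hornerE, mulr0, oppr0, addr0).
suff -> : lead_coef P * \prod_(z <- r) - z = 1 by rewrite scale1r.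
by rewrite -[RHS]P0 [in RHS]Dr fact scalerA coefZ e mulr1.
Qed.

Section Zeta.

Variables (F : finFieldType) (n' : nat) (C : 'M[F]_n'.+1) (g : nat).
Local Notation d := n'.+1.
Local Notation f := (char_poly C).
Hypotheses (F2 : 2%:R != 0 :> F) (gd : genus_degree g d).

Lemma hyperelliptic_cardE (K : finFieldType) (iota : {rmorphism F -> K}) :
  (hyperelliptic_card g (map_poly iota f))%:Z =
    #|K|%:Z + 1 + (\sum_x qchar (map_poly iota f).[x] + (~~ odd d)%:Z).
Proof.
have K2 : 2%:R != 0 :> K by rewrite -(rmorph_nat iota) fmorph_eq0.
rewrite /hyperelliptic_card PoszD card_sqrt //.
have -> : qchar (map_poly iota f)`_(2 * g + 2) = (~~ odd d)%:Z.
  case: gd => Dd.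
    rewrite nth_default ?size_map_poly ?size_char_poly; first by rewrite qchar0 Dd oddD oddM.
    by rewrite Dd; lia.
  have <- : lead_coef (map_poly iota f) = (map_poly iota f)`_(2 * g + 2).
    by rewrite lead_coefE size_map_poly size_char_poly -Dd.
  have /monicP -> : map_poly iota f \is monic by rewrite map_monic char_poly_monic.
  by rewrite qchar1 Dd oddD oddM.
have -> : #|[set P : K * K | (P.2 ^+ 2 == (map_poly iota f).[P.1])%R]|%:Z =
    \sum_x (1 + qchar (map_poly iota f).[x]).
  transitivity (\sum_(x : K) #|[set v : K | (v ^+ 2 == (map_poly iota f).[x])%R]|)%N%:Z.
    congr Posz; rewrite -sum1_card; under [RHS]eq_bigr do rewrite -sum1_card.
    by rewrite [RHS]pair_big_dep /=; apply: eq_bigl => P; rewrite !inE.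
  rewrite (big_morph Posz PoszD (erefl _)); apply: eq_bigr => x _.
  exact: card_sqrt.
rewrite big_split /= sumr_const -mulr_natl mulr1 natz; ring.
Qed.

Hypotheses (sepf : coprimep f f^`()) (gq : (g <= #|F|)%N) (g_gt0 : (0 < g)%N).
Hypothesis p_big : forall n, (0 < n <= 2 * g)%N -> n%:R != 0 :> F.

Local Notation q := #|F|.

Let intr_nat (K : numDomainType) n : (n%:Z)%:~R = n%:R :> K.
Proof. by rewrite -pmulrn. Qed.

(** Over [algC] Newton's identities determine L from the power sums, hence from the point counts;
    conversely the polynomial with coefficients a factors over [algC] and its power sums are forced.
    The match on g supplies the form N.+1 of the matrix size that [rev_char_poly_coef] asks for. *)
Lemma Lpoly_spec : exists a : nat -> int,
  [/\ a 0%N = 1,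
      forall k, (2 * g < k)%N -> a k = 0,
      forall k, (k <= 2 * g)%N -> a (2 * g)%N * a k = (q ^ k)%:Z * a (2 * g - k)%N,
      forall n, (n <= 2 * g)%N -> (a n)%:~R =
        (if g is g'.+1 then
           rev_char_poly_coef (hasse_witt g'.+1 q (f ^+ (q.-1./2))) n else 0) :> F
    & forall L, is_Lpoly g f L <-> forall k, L`_k = a k].
Proof.
have [a [S [a0 a_big a_fe a_rec HS]]] := L_coefficients F2 sepf.
have D2 : (d + odd d - 2 = 2 * g)%N by case: gd => ->; rewrite oddD oddM; lia.
rewrite D2 in a_big a_fe.
have card_curve n (K : finFieldType) (iota : {rmorphism F -> K}) : (0 < n)%N ->
    #|K| = (q ^ n)%N ->
    (hyperelliptic_card g (map_poly iota f))%:Z = (q ^ n)%:Z + 1 + (S n + (~~ odd d)%:Z).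
  by move=> n0 cK; rewrite hyperelliptic_cardE (HS n) // cK.
have a_newton n : (a n)%:~R *+ n =
    - \sum_(1 <= j < n.+1) (- (S j + ~~ odd d)%:~R) * (a (n - j)%N)%:~R :> algC.
  rewrite -rmorphMn a_rec rmorph_sum -sumrN; apply: eq_bigr => j _.
  by rewrite rmorphM /= mulNr opprK.
have power_sums L (b : 'I_(2 * g) -> algC) n :
    map_poly intr L = \prod_(i < 2 * g) (1 - b i *: 'X) ->
    (L`_n)%:~R *+ n =
    - \sum_(1 <= j < n.+1) (\sum_i b i ^+ j) * (L`_(n - j)%N)%:~R :> algC.
  move=> DL; have cL k : (L`_k)%:~R = (\prod_(z <- codom b) (1 - z *: 'X))`_k :> algC.
    by rewrite big_image /= -DL coef_map.
  rewrite cL newton_prod; congr (- _); apply: eq_bigr => j _.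
  by rewrite big_image cL.
exists a; split=> //.
- case: (g) gd gq p_big g_gt0 => [|g'] gd' gq' p_big' // _.
  exact: (coefficients_mod F2 gd' gq' p_big' a0 a_rec HS).
- move=> L; split=> [[b [DL Hb]] k|La].
    have L0 : L`_0 = 1.
      have : (L`_0)%:~R = 1 :> algC.
        rewrite -coef_map DL -horner_coef0 horner_prod big1 // => i _.
        by rewrite !(hornerE, mulr0, oppr0, addr0).
      by move/eqP; rewrite -[1 in X in X -> _]/(1%:~R) eqr_int => /eqP.
    apply: (@intr_inj algC).
    apply: (@newton_unique _ (fun k => (L`_k)%:~R) (fun k => (a k)%:~R)
      (fun j => \sum_i b i ^+ j) k _ _ _ _ k (leqnn k)).
    - move=> n /andP[n0 _] x y; apply: mulfI; by rewrite pnatr_eq0 -lt0n.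
    - by rewrite L0 a0.
    - by move=> n _; apply: power_sums.
    - move=> n _; rewrite a_newton; congr (- _); apply: eq_big_nat => j /andP[j0 _].
      congr (_ * _); have [K [iota cK]] := finField_extension F j0.
      have := Hb j K iota j0 cK; have := card_curve j K iota j0 cK.
      move/(congr1 (fun x : int => x%:~R : algC)); rewrite /= !rmorphD /= rmorph1 !intr_nat.
      by move=> -> /addrI e; rewrite e opprK.
have DL : L = \poly_(i < (2 * g).+1) a i.
  by apply/polyP => k; rewrite La coef_poly; case: ltnP => // lt; rewrite a_big.
(* A nonzero top coefficient gives exactly 2g reciprocal roots, as many as [is_Lpoly] requires. *)
have top : a (2 * g)%N != 0.
  have := a_fe _ (leqnn (2 * g)%N); rewrite subnn a0 mulr1 => e.
  apply: contra_eq_neq e => ->; rewrite mul0r eq_sym.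
  by rewrite eqz_nat expn_eq0 negb_and -lt0n (ltn_trans _ (finNzRing_gt1 F)).
have szL : size (map_poly intr L : {poly algC}) = (2 * g).+1.
  rewrite size_map_inj_poly ?rmorph0 //; last exact: intr_inj.
  by rewrite DL size_poly_eq.
have [|b Db] := prod_reversed_roots _ szL; first by rewrite coef_map La a0.
exists b; split=> // n K iota n0 cK.
have := card_curve n K iota n0 cK.
move/(congr1 (fun x : int => x%:~R : algC)); rewrite /= !rmorphD /= rmorph1 !intr_nat => ->.
congr (_ + _); apply: oppr_inj; rewrite opprK.
have := @newton_unique_power_sums _ (fun k => (a k)%:~R : algC)
  (fun j => \sum_i b i ^+ j) (fun j => - (S j + ~~ odd d)%:~R) n.
move=> E; rewrite E ?a0 ?n0 ?leqnn //.
- by rewrite rmorphD /= intr_nat.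
- by move=> k _; have := power_sums L b k Db; rewrite !La; under eq_bigr do rewrite La.
Qed.

End Zeta.

Theorem ordinary_hasse_witt (p : nat) (F : finFieldType) n' (C : 'M[F]_n'.+1) g :
  prime p -> p \in [pchar F] -> (2 * g < p)%N -> (0 < g)%N ->
  genus_degree g n'.+1 -> coprimep (char_poly C) (char_poly C)^`() ->
  ordinary p g (char_poly C) <->
    \det (hasse_witt g #|F| (char_poly C ^+ (#|F|.-1./2))) != 0.
Proof.
move=> p_pr chp pg g_gt0 gd sepf.
have p_big n : (0 < n <= 2 * g)%N -> n%:R != 0 :> F.
  move=> /andP[n0 ng]; rewrite -(dvdn_pcharf chp) gtnNdvd //.
  exact: leq_ltn_trans ng pg.
have F2 : 2%:R != 0 :> F by apply: p_big; lia.
have [m m_gt0 cF] := card_finField_pchar chp.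
have gq : (g <= #|F|)%N.
  rewrite cF (leq_trans _ (leq_pexp2l (prime_gt0 p_pr) m_gt0)) // expn1; lia.
have [a [a0 a_big a_fe a_mod Luniq]] := Lpoly_spec F2 gd sepf gq g_gt0 p_big.
case: g => // g' in pg g_gt0 gd p_big gq a_big a_fe a_mod Luniq *.
have dvE (x : int) : (p%:Z %| x)%Z = (x%:~R == 0 :> F).
  rewrite dvdzE absz_nat (dvdn_pcharf chp); case: x => n; first by rewrite -pmulrn.
  by rewrite NegzE mulrNz oppr_eq0 abszN -pmulrn.
have spec : forall L : {poly int}, (forall k, L`_k = a k) ->
   (forall s, newton_slope p #|F| L s -> s = 0 \/ s = 1) <-> ~~ (p%:Z %| a g'.+1)%Z.
  move=> L La; rewrite -(La g'.+1) cF.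
  apply: ordinary_slopes_iff => //; rewrite ?La //.
  - by move=> k lt; rewrite La a_big.
  - by move=> k le; rewrite !La a_fe // cF.
  - move=> k /andP[gk kg]; rewrite La dvE a_mod // /rev_char_poly_coef leqNgt gk /=.
    by rewrite eqxx.
(* The coefficient of T^g in det(1 - TA) is (-1)^g det A. *)
have detE : ~~ (p%:Z %| a g'.+1)%Z =
    (\det (hasse_witt g'.+1 #|F| (char_poly C ^+ (#|F|.-1./2))) != 0).
  rewrite dvE a_mod; last by rewrite leq_pmull.
  rewrite /rev_char_poly_coef leqnn subnn char_poly_det mulf_eq0 expf_eq0 oppr_eq0.
  by rewrite oner_eq0 andbF.
rewrite -detE; split=> [[L [/Luniq La Ls]]|nd]; first by apply/(spec L La).
pose L := \poly_(k < (2 * g'.+1).+1) a k.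
have La k : L`_k = a k by rewrite coef_poly; case: ltnP => // lt; rewrite a_big.
by exists L; split; [apply/Luniq | apply/(spec L La)].
Qed.

(** * Generic invertibility of the Hasse-Witt matrix *)

Section TrinomialPower.

Variables (R : comNzRingType) (D : nat) (a : R).
Hypothesis D_gt0 : (0 < D)%N.

Lemma coef_XaddC_exp M A : (('X + a%:P) ^+ M)`_A = a ^+ (M - A) *+ 'C(M, A).
Proof.
rewrite addrC exprDn coef_sum.
rewrite (eq_bigr (fun i : 'I_M.+1 =>
    if (i : nat) == A then a ^+ (M - A) *+ 'C(M, A) else 0)); last first.
  move=> i _; rewrite coefMn -rmorphXn coefCM coefXn eq_sym.
  by case: eqVneq => [->|_]; rewrite ?mulr1 // mulr0 mul0rn.
have [le|lt] := leqP A M; last first.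
  rewrite bin_small // mulr0n big1 // => i _; by case: ifP.
by rewrite -big_mkcond (big_pred1 (inord A)) // => i; rewrite /= -val_eqE /= inordK.
Qed.

Lemma coef_binomial_exp M n :
  (('X^(D.+1) + a *: 'X) ^+ M)`_n =
    if (M <= n)%N && (D %| n - M)%N
    then a ^+ (M - (n - M) %/ D) *+ 'C(M, (n - M) %/ D) else 0.
Proof.
have -> : 'X^(D.+1) + a *: 'X = (('X + a%:P) \Po 'X^D) * 'X :> {poly R}.
  by rewrite comp_polyD comp_polyX comp_polyC mulrDl -exprSr mul_polyC.
rewrite exprMn -rmorphXn /= coefMXn ltnNge; case: leqP => //= le.
by rewrite coef_comp_poly_Xn //; case: ifP => // _; rewrite coef_XaddC_exp.
Qed.

(** Once the exponent c of t is chosen, the remaining factor is x^(N-c) (x^D + a)^(N-c), in which at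
    most one binomial term has exponent n: every coefficient is a single monomial in a times a
    multinomial coefficient. *)
Lemma coef_trinomial_exp N n c :
  ((trinomial D.+1 a%:P 'X ^+ N)`_n)`_c =
    if [&& c <= N, N - c <= n & D %| n - (N - c)]%N
    then a ^+ (N - c - (n - (N - c)) %/ D)
         *+ ('C(N, c) * 'C(N - c, (n - (N - c)) %/ D))
    else 0.
Proof.
rewrite /trinomial exprDn !coef_sum.
have -> : 'X^(D.+1) + a%:P *: 'X = map_poly polyC ('X^(D.+1) + a *: 'X).
  by rewrite rmorphD /= map_polyXn map_polyZ /= map_polyX.
rewrite (eq_bigr (fun k : 'I_N.+1 => if (k : nat) == c then
    (('X^(D.+1) + a *: 'X) ^+ (N - c))`_n *+ 'C(N, c) else 0)); last first.
  move=> k _; rewrite coefMn -rmorphXn -[_%:P ^+ _]rmorphXn /= coefMC coef_map /=.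
  rewrite coefMn coefCM coefXn eq_sym.
  by case: eqVneq => [->|_]; rewrite ?mulr1 // mulr0 mul0rn.
case: leqP => [le|lt]; last first.
  by rewrite big1 // => k _; case: eqP => // e; move: (ltn_ord k); rewrite e ltnS leqNgt lt.
rewrite -big_mkcond (big_pred1 (inord c)); last first.
  by move=> k; rewrite /= -val_eqE /= inordK.
rewrite coef_binomial_exp /=; case: ifP => _; last by rewrite mul0rn.
by rewrite -mulrnA mulnC.
Qed.

End TrinomialPower.

(* If [t ^ r_i * E_ij = t ^ k_j * M_ij] with [M(0)] invertible then [det E] is
   a monomial times [det M]; [W = M(0)] is made of the lowest coefficients. *)
Lemma det_lowest_terms (F : fieldType) n (E : 'M[{poly F}]_n) (W : 'M[F]_n)
    (r k : 'I_n -> nat) :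
  (forall i j c, (c + r i < k j)%N -> (E i j)`_c = 0) ->
  (forall i j, W i j = if (r i <= k j)%N then (E i j)`_(k j - r i) else 0) ->
  \det W != 0 -> \det E != 0.
Proof.
move=> low HW dW.
pose M := \matrix_(i, j) (('X^(r i) * E i j) %/ 'X^(k j)).
have ME i j : 'X^(r i) * E i j = 'X^(k j) * M i j.
  rewrite mxE mulrC [RHS]mulrC divpK //.
  apply/modp_eq0P; rewrite mulrC.
  have -> : 'X^(r i) * E i j = 'X^(k j) * \poly_(c < size ('X^(r i) * E i j))
      ('X^(r i) * E i j)`_(c + k j).
    apply/polyP => c; rewrite !coefXnM coef_poly; case: (ltnP c (k j)) => [lt|le].
      case: (ltnP c (r i)) => // le'; apply: low; by rewrite subnK.
    case: (ltnP (c - k j)) => [_|ge]; first by rewrite subnK // coefXnM.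
    have : ('X^(r i) * E i j)`_c = 0 by rewrite nth_default // (leq_trans ge) ?leq_subr.
    by rewrite coefXnM.
  by rewrite modp_mulr.
have MW : map_mx (horner_eval 0) M = W.
  apply/matrixP => i j; rewrite mxE HW horner_evalE horner_coef0.
  have := congr1 (fun p : {poly F} => p`_(k j)) (ME i j).
  rewrite /= !coefXnM ltnn subnn => <-; rewrite ltnNge.
  by case: leqP.
have detM : \det M != 0.
  apply: contraNneq dW => dM0; rewrite -MW (det_map_mx (horner_eval (0 : F))) /= dM0.
  by rewrite horner_evalE horner0.
have key : (\prod_i 'X^(r i)) * \det E = (\prod_j 'X^(k j)) * \det M :> {poly F}.
  have -> : (\prod_i 'X^(r i)) * \det E = \det (diag_mx (\row_i 'X^(r i)) *m E).
    by rewrite det_mulmx det_diag; congr (_ * _); apply: eq_bigr => i _; rewrite mxE.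
  have -> : (\prod_j 'X^(k j)) * \det M = \det (M *m diag_mx (\row_i 'X^(k i))).
    by rewrite det_mulmx det_diag mulrC; congr (_ * _); apply: eq_bigr => i _; rewrite mxE.
  congr (\det _); apply/matrixP => i j.
  rewrite mul_diag_mx mul_mx_diag [LHS]mxE [RHS]mxE.
  by rewrite [X in X * _ = _]mxE [X in _ = _ * X]mxE ME mulrC.
apply: contraNneq detM => dE; move: key; rewrite dE mulr0 => /esym/eqP.
rewrite mulf_eq0 => /orP[|//]; rewrite prodf_seq_eq0 => /hasP[j _] /=.
by rewrite -size_poly_eq0 size_polyXn.
Qed.

(** For m > n both sides contain a zero factor. The identity allows falling factorials to be read as
    values of polynomials over a field. *)
Lemma ffact_natr (R : comNzRingType) n m :
  (n ^_ m)%:R = \prod_(i < m) (n%:R - i%:R) :> R.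
Proof.
rewrite ffact_prod.
have [le|lt] := leqP m n.
  rewrite natr_prod; apply: eq_bigr => i _; rewrite natrB //.
  by rewrite (leq_trans _ le) // ltnW.
rewrite (bigD1 (Ordinal lt)) //= subnn mul0n.
by rewrite (bigD1 (Ordinal lt)) //= subrr mul0r.
Qed.

(** * Arithmetic consequences of the bound P^+ *)

Section Arithmetic.
Local Open Scope nat_scope.

Variables g d p : nat.
Hypotheses (g2 : 2 <= g) (gd : genus_degree g d) (p_pr : prime p) (Pp : Pplus d < p).

Lemma Pplus_odd_bound : d = 2 * g + 1 -> 4 * (g * g) <= 4 * g + p.
Proof.
move=> Dd; move: Pp; rewrite /Pplus Dd oddD oddM /= expnS expn1.
have : (2 * g + 1) * (2 * g + 1) = 4 * (g * g) + 4 * g + 1 by ring.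
lia.
Qed.

Lemma Pplus_even_bound : d = 2 * g + 2 -> 2 * (g * g) + g < p.
Proof.
move=> Dd; move: Pp; rewrite /Pplus Dd oddD oddM /= expnS expn1.
have -> : ((2 * g + 2) * (2 * g + 2) - 3 * (2 * g + 2) + 2)./2 = 2 * (g * g) + g.
  rewrite (_ : _ + 2 = (2 * (g * g) + g).*2) ?doubleK //.
  have : (2 * g + 2) * (2 * g + 2) = 4 * (g * g) + 8 * g + 4 by ring.
  by have : g * 2 <= g * g; [rewrite leq_mul2l g2 orbT | lia].
by [].
Qed.

Lemma gg_ge : 2 * g <= g * g. Proof. by rewrite leq_mul2r g2 orbT. Qed.

Lemma degree_lt_p : d < p.
Proof.
have gg := gg_ge; case: gd => Dd.
  by have := Pplus_odd_bound Dd; lia.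
by have := Pplus_even_bound Dd; lia.
Qed.

Lemma p_odd : odd p.
Proof.
have := degree_lt_p; have : 4 < d by case: gd => ->; lia.
by case: (even_prime p_pr) => [->|//]; lia.
Qed.

Local Notation N := (p.-1./2).
Local Notation D := (d.-1).
Local Notation s := (D.-1 - g).

Lemma p_half : p = 2 * N + 1.
Proof.
by have := p_odd; case: (p) => // n /= on; rewrite mul2n even_halfK ?addn1.
Qed.

(* In row [I] the exponents of [t] in column [J] are congruent to [J - rho]
   modulo [D], where [rho = hw_rem I - s] is the representative of [p I - N]
   modulo [D] in [[-s, g]]; the choice of this window makes [t^(J - rho)] the
   lowest possible power. *)
Definition hw_quot I := (p * I - N + s) %/ D.
Definition hw_rem I := (p * I - N + s) %% D.

Lemma D_gt0 : 0 < D. Proof. by case: gd => ->; lia. Qed.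

Lemma hw_rem_lt I : hw_rem I < D. Proof. by rewrite ltn_mod D_gt0. Qed.

Lemma hw_quot_rem I : p * I - N + s = D * hw_quot I + hw_rem I.
Proof. by rewrite /hw_quot /hw_rem [D * _]mulnC -divn_eq. Qed.

Lemma hw_rem_inj I J : 0 < I <= g -> 0 < J <= g -> hw_rem I = hw_rem J -> I = J.
Proof.
wlog le : I J / I <= J.
  by move=> H; have [/H//|/ltnW/H h hI hJ e] := leqP I J; rewrite h.
move=> /andP[I0 Ig] /andP[J0 Jg] e; apply/eqP; rewrite eqn_leq le /=.
have leN X : 0 < X -> N <= p * X.
  by move=> X0; apply: leq_trans (leq_pmulr p X0); have := p_half; lia.
have : D %| p * (J - I).
  have -> : p * (J - I) = (p * J - N + s) - (p * I - N + s).
    rewrite mulnBr; have := leN I I0; have := leN J J0.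
    by have : p * I <= p * J by [rewrite leq_mul2l le orbT]; lia.
  by rewrite -eqn_mod_dvd ?leq_add2r ?leq_sub2r ?leq_mul2l ?le ?orbT //; apply/eqP.
rewrite Gauss_dvdr; last first.
  rewrite coprime_sym prime_coprime //; apply/negP => /(dvdn_leq D_gt0).
  by have := degree_lt_p; have := D_gt0; lia.
case: (posnP (J - I)) => [|pos /(dvdn_leq pos)]; first by lia.
by case: gd => ->; lia.
Qed.

(* The excluded prime in the extreme case [I = g], [hw_rem g = 0] is
   [p = (2g-1)(2g+1)]. *)
Lemma hw_quot_bound I : 0 < I <= g -> hw_quot I + s + 1 <= N + hw_rem I.
Proof.
move=> /andP[I0 Ig]; rewrite addn1 ltnNge; apply/negP => contra.
have Dp := p_half; have gg := gg_ge.
have leN : N <= p * I.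
  by apply: leq_trans (leq_pmulr p I0); lia.
have T := hw_quot_rem I.
have H : D * N + D * hw_rem I <= D * hw_quot I + D * s.
  by rewrite -!mulnDr leq_mul2l contra orbT.
have pI : p * I = 2 * (N * I) + I by rewrite {1}Dp; ring.
have [ltI|geI] := ltnP I g.
  have NI : N * I <= N * g - N.
    by rewrite -[X in _ - X]muln1 -mulnBr leq_mul2l; apply/orP; right; lia.
  have Ng : N <= N * g by rewrite leq_pmulr; lia.
  case: gd => Dd.
    have := Pplus_odd_bound Dd.
    have eD X : D * X = 2 * (g * X) by rewrite Dd addn1 /= mulnA.
    rewrite !eD in H T; rewrite Dd /= in H T.
    have es : (2 * g + 1).-1.-1 - g = g - 1 by lia.
    rewrite es in H T; have : g * (g - 1) = g * g - g by rewrite mulnBr muln1.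
    by rewrite (mulnC g N) in H; lia.
  have := Pplus_even_bound Dd.
  have eD X : D * X = 2 * (g * X) + X by rewrite Dd addn2 /=; ring.
  rewrite !eD in H T; rewrite Dd /= in H T.
  have es : (2 * g + 2).-1.-1 - g = g by lia.
  by rewrite es (mulnC g N) in H T *; lia.
have eI : I = g by apply/eqP; rewrite eqn_leq Ig geI.
rewrite eI in T H pI leN contra *.
case: gd => Dd.
  have B := Pplus_odd_bound Dd.
  have eD X : D * X = 2 * (g * X) by rewrite Dd addn1 /= mulnA.
  have es : s = g - 1 by rewrite Dd; lia.
  (* Beyond P^+ the size estimate leaves only remainder 0; then 2g divides N + 1, and the range of N
     leaves N + 1 = 2g^2, that is p = 4g^2 - 1. *)
  have [r0|r1] := posnP (hw_rem g); last first.
    have : g <= g * hw_rem g by rewrite leq_pmulr.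
    rewrite !eD es in H T; have : g * (g - 1) = g * g - g by rewrite mulnBr muln1.
    by rewrite (mulnC g N) in H; lia.
  have dv : D %| (N + 1) * (2 * g - 1).
    apply/dvdnP; exists (hw_quot g).
    have T' : D * hw_quot g = p * g - N + s by rewrite T r0 addn0.
    rewrite [hw_quot g * D]mulnC T' es.
    have : N + 1 <= (N + 1) * g by rewrite leq_pmulr //; lia.
    have -> : (N + 1) * (2 * g - 1) = 2 * (N * g + g) - (N + 1).
      by rewrite mulnBr muln1; congr (_ - _); ring.
    by rewrite mulnDl mul1n in H *; lia.
  have cop : coprime D (2 * g - 1).
    rewrite Dd addn1 /= -[X in coprime X _](subnK (_ : 1 <= 2 * g)); last by lia.
    by rewrite addn1 coprimeSn.
  rewrite Gauss_dvdl // in dv; case/dvdnP: dv => k Dk'.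
  have {Dk'}Dk : N + 1 = k * (2 * g) by rewrite Dk' Dd addn1.
  rewrite !eD es r0 in H T; rewrite (mulnC g N) in H.
  have e1 : g * (g - 1) = g * g - g by rewrite mulnBr muln1.
  have leN1 : N + 1 <= 2 * (g * g) by lia.
  have kg : k <= g.
    by rewrite -(leq_pmul2r (_ : 0 < 2 * g)) -?Dk; [lia | lia].
  have kg' : g <= k.
    rewrite leqNgt; apply/negP => lt.
    have : k * (2 * g) <= (g - 1) * (2 * g) by rewrite leq_mul2r; apply/orP; right; lia.
    have -> : (g - 1) * (2 * g) = 2 * (g * g) - 2 * g by rewrite mulnBl mul1n; congr (_ - _); ring.
    by rewrite -Dk; lia.
  have ek : k = g by apply/eqP; rewrite eqn_leq kg kg'.
  have fac : p = (2 * g - 1) * (2 * g + 1).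
    rewrite {1}Dp mulnDr muln1 mulnBl mul1n.
    have -> : 2 * g * (2 * g) = 4 * (g * g) by ring.
    have : k * (2 * g) = 2 * (g * g) by rewrite ek; ring.
    by lia.
  have : 2 * g - 1 %| p by rewrite fac dvdn_mulr.
  case/primeP: p_pr => _ nt /nt /orP[/eqP|/eqP]; first by lia.
  have : 2 * g - 1 < p by rewrite fac ltn_Pmulr; lia.
  by lia.
have B := Pplus_even_bound Dd.
have eD X : D * X = 2 * (g * X) + X by rewrite Dd addn2 /=; ring.
have es : s = g by rewrite Dd; lia.
(* With a positive remainder the estimate gives p <= 2g^2 + g - 1; with remainder 0, D = 2g + 1
   would divide p (2g - 1), although D is prime to p and larger than 2g - 1. *)
have [r0|r1] := posnP (hw_rem g); last first.
  have : g <= g * hw_rem g by rewrite leq_pmulr.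
  by rewrite !eD es (mulnC g N) in H T; lia.
have dv : D %| p * (2 * g - 1).
  have : D %| p * (2 * g - 1) + D.
    apply/dvdnP; exists (2 * hw_quot g).
    have : p <= p * (2 * g) by rewrite leq_pmulr; lia.
    rewrite mulnBr muln1 -mulnA (mulnC _ D) -[D * hw_quot g]addn0 -r0 -T es.
    rewrite mulnCA; move: (p * g) leN => X; rewrite Dd; lia.
  by rewrite dvdn_addl.
rewrite Gauss_dvdr in dv.
  by have := dvdn_leq _ dv; rewrite Dd; lia.
rewrite coprime_sym prime_coprime //; apply/negP => /(dvdn_leq D_gt0).
by have := degree_lt_p; have := D_gt0; lia.
Qed.

(** Modulo p these are 2D times the second kind of factors of the pivots below. The largest, at K =
    g and m = 1, is d (2g - 3) + 2, which for d = 2g + 1 is P^+(d); for d even the integer is even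
    and its half is compared with p. *)
Lemma pivot_nonzero K m : 0 < m < K -> K <= g ->
  ~~ (p %| d * (2 * (K - m) - 1) + 2 * m).
Proof.
move=> /andP[m0 mK] Kg; have [u Du] : exists u, u = K - m by exists (K - m).
have gg := gg_ge; rewrite -Du; have ug : u <= g - 1 by lia.
have le1 : g * (2 * u - 1) <= g * (2 * (g - 1) - 1) by rewrite leq_mul2l; lia.
have e1 : g * (2 * (g - 1) - 1) = 2 * (g * g) - 3 * g.
  have -> : 2 * (g - 1) - 1 = 2 * g - 3 by lia.
  by rewrite mulnBr mulnCA (mulnC g 3).
apply/negP => dv; case: gd => Dd.
  have B := Pplus_odd_bound Dd.
  have E : d * (2 * u - 1) + 2 * m = 2 * (g * (2 * u - 1)) + (2 * u - 1) + 2 * m.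
    by rewrite Dd; ring.
  rewrite E in dv; rewrite e1 in le1.
  have X0 : 0 < 2 * (g * (2 * u - 1)) + (2 * u - 1) + 2 * m.
    by rewrite addn_gt0 muln_gt0 m0 orbT.
  by have := dvdn_leq X0 dv; clear dv; lia.
have B := Pplus_even_bound Dd.
have E : d * (2 * u - 1) + 2 * m = 2 * ((g * (2 * u - 1)) + (2 * u - 1) + m).
  by rewrite Dd; ring.
rewrite E Gauss_dvdr in dv; last by rewrite coprimen2 p_odd.
rewrite e1 in le1.
have X0 : 0 < g * (2 * u - 1) + (2 * u - 1) + m by rewrite addn_gt0 m0 orbT.
by have := dvdn_leq X0 dv; clear dv; lia.
Qed.

End Arithmetic.

(* The multinomial coefficient [N! / (a! b! c!)], up to factors depending only on
   the row, is polynomial in the row parameter. *)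
Lemma multinomial_ffact (N a r s g j : nat) :
  (j < g)%N -> (r <= g + s)%N -> (a + s + 1 <= N + r)%N ->
  let beta := (N + r - (a + s + 1))%N in
  let c := (j.+1 + s - r)%N in
  ((g + s - r)`! * beta`! * a`! *
     (if r <= j.+1 + s then 'C(N, c) * 'C(N - c, a) else 0)
   = N`! * ((g + s - r) ^_ (g - j.+1) * beta ^_ j))%N.
Proof.
move=> jg rgs le beta c; case: leqP => [ler|ltr]; last first.
  have -> : ((g + s - r) ^_ (g - j.+1) = 0)%N by rewrite ffact_small; lia.
  by rewrite !muln0.
have [jb|bj] := leqP j beta; last first.
  have -> : (beta ^_ j = 0)%N by rewrite ffact_small.
  rewrite !muln0.
  have [cN|Nc] := leqP c N; last by rewrite bin_small // mul0n muln0.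
  have -> : ('C(N - c, a) = 0)%N by apply: bin_small; rewrite /c /beta in bj cN *; lia.
  by rewrite !muln0.
have [cN aN] : (c <= N /\ a <= N - c)%N by rewrite /c /beta in jb *; lia.
have e1 := bin_fact cN; have e2 := bin_fact aN.
have le3 : (g - j.+1 <= g + s - r)%N by lia.
have e3 := ffact_fact le3; have e4 := ffact_fact jb.
have e5 : (g + s - r - (g - j.+1) = c)%N by rewrite /c; lia.
have e6 : (N - c - a = beta - j)%N by rewrite /c /beta in jb *; lia.
rewrite e5 in e3; rewrite e6 in e2.
by rewrite -e3 -e4 -e1 -e2; ring.
Qed.

(** * Nonvanishing of the determinant of lowest terms *)

Section InterpolationDeterminant.

Variables (F : fieldType) (g : nat) (pol : 'I_g -> {poly F}) (x y : 'I_g -> F).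
Hypotheses (x_inj : injective x) (size_pol : forall j, (size (pol j) <= g)%N).
Hypothesis pol_below : forall j k : 'I_g, (j < k)%N -> (pol j).[y k] = 0.
Hypothesis pol_pivot : forall j, (pol j).[y j] != 0.

(** A linear relation between the columns gives a combination of the polynomials, of degree less
    than g, that vanishes at g distinct points, hence identically. Evaluating it at the y k for
    decreasing k kills the coefficients one after the other, by triangularity. *)
Lemma interpolation_det : \det (\matrix_(i, j) (pol j).[x i]) != 0.
Proof.
rewrite -det_tr; apply/negP => /det0P[v v0 /rowP vA]; case/negP: v0.
pose G := \sum_j v 0 j *: pol j.
have Gx i : root G (x i).
  apply/eqP; have := vA i; rewrite [RHS]mxE mxE => <-; rewrite horner_sum.
  by apply: eq_bigr => j _; rewrite hornerZ !mxE.
have G0 : G = 0.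
  apply: (@roots_geq_poly_eq0 _ _ (codom x)).
  - by apply/allP => _ /codomP[i ->].
  - by rewrite map_inj_uniq ?enum_uniq.
  - rewrite size_codom card_ord; apply: leq_trans (size_sum _ _ _) _.
    by apply/bigmax_leqP => j _; apply: leq_trans (size_scale_leq _ _) _.
apply/eqP/rowP => j; rewrite mxE.
have [n] := ubnP (g - j); elim: n j => // n IH j lt.
have := congr1 (fun p : {poly F} => p.[y j]) G0; rewrite /= horner0 horner_sum.
rewrite (bigD1 j) //= big1 ?addr0 => [|l ne].
  by rewrite hornerZ => /eqP; rewrite mulf_eq0 (negPf (pol_pivot j)) orbF => /eqP.
rewrite hornerZ; have [lj|jl] := ltnP l j; first by rewrite pol_below ?mulr0.
rewrite IH ?mul0r //; have := ltn_ord l.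
have : (j < l)%N by rewrite ltn_neqAle jl andbT eq_sym.
by move: lt; lia.
Qed.

End InterpolationDeterminant.

Section NonVanishing.

Variables (F : fieldType) (g d p : nat) (a : F).
Hypotheses (g2 : (2 <= g)%N) (gd : genus_degree g d) (p_pr : prime p).
Hypotheses (Pp : (Pplus d < p)%N) (chp : p \in [pchar F]) (a0 : a != 0).

Local Notation N := (p.-1./2).
Local Notation D := (d.-1).
Local Notation s := (D.-1 - g)%N.
Local Notation r i := (hw_rem g d p i).
Local Notation qt i := (hw_quot g d p i).
Local Notation u := (trinomial d a%:P 'X).

Let DS : d = D.+1. Proof. by case: gd => ->; rewrite ?addn1 ?addn2. Qed.
Let D0 : (0 < D)%N := D_gt0 g2 gd p_pr Pp.
Let dp : (d < p)%N := degree_lt_p g2 gd p_pr Pp.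
Let ph : p = (2 * N + 1)%N := p_half g2 gd p_pr Pp.
Let Ds : D = (g + s).+1. Proof. by case: gd => ->; lia. Qed.

(** With j counted from 0, the lowest term of an entry in column j contains x^d, t and a x with the
    exponents [qt], j + 1 + s - [r] and [beta] - j. *)
Let beta i := (N + r i - (qt i + s + 1))%N.

Let leN I : (0 < I)%N -> (N <= p * I)%N.
Proof. by move=> I0; apply: leq_trans (leq_pmulr p I0); rewrite [X in (_ <= X)%N]ph; lia. Qed.

(** The exponents of t that occur are congruent to j + 1 + s - r modulo D; those below this value
    are negative, because j + 1 <= g and D = g + s + 1. *)
Let low_coef (i j : 'I_g) c : (c + r i.+1 < j.+1 + s)%N ->
  ((u ^+ N)`_(p * i.+1 - j.+1))`_c = 0.
Proof.
move=> lt; rewrite [in u]DS coef_trinomial_exp //.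
case: ifP => // /and3P[cN Nn /dvdnP[A DA]]; exfalso.
have T := @hw_quot_rem g d p i.+1; have Nle := leN (ltn0Sn i).
have jg := ltn_ord j; have jp : (j.+1 <= p * i.+1)%N.
  by rewrite (leq_trans _ (leq_pmulr p _)) //; lia.
have lt' : (A * D < D * qt i.+1)%N by lia.
have le' : (A * D + D <= D * qt i.+1)%N.
  by rewrite addnC -mulSn mulnC leq_mul2l -(ltn_pmul2l D0) [(D * A)%N]mulnC lt' orbT.
by rewrite Ds in lt T DA le' *; lia.
Qed.

Let top_coef (i j : 'I_g) : (r i.+1 <= j.+1 + s)%N ->
  let c := (j.+1 + s - r i.+1)%N in
  ((u ^+ N)`_(p * i.+1 - j.+1))`_c =
    a ^+ (N - c - qt i.+1) *+ ('C(N, c) * 'C(N - c, qt i.+1)).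
Proof.
move=> le c; rewrite [in u]DS coef_trinomial_exp //.
have [cN|Nc] := leqP c N; last by rewrite bin_small // mul0n mulr0n.
have T := @hw_quot_rem g d p i.+1; have Nle := leN (ltn0Sn i).
have jg := ltn_ord j; have jp : (j.+1 <= p * i.+1)%N.
  by rewrite (leq_trans _ (leq_pmulr p _)) //; lia.
have Nn : (N - c <= p * i.+1 - j.+1)%N by rewrite /c in cN *; lia.
have E : (p * i.+1 - j.+1 - (N - c) = D * qt i.+1)%N by rewrite /c in cN Nn *; lia.
by rewrite Nn E dvdn_mulr // mulKn.
Qed.

Let pF : p%:R = 0 :> F. Proof. exact: pcharf0. Qed.

Let natF n : (0 < n < p)%N -> n%:R != 0 :> F.
Proof. by move=> /andP[n0 np]; rewrite -(dvdn_pcharf chp) gtnNdvd. Qed.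

Let DF : D%:R != 0 :> F. Proof. by apply: natF; rewrite D0 (leq_ltn_trans (leq_pred _) dp). Qed.

Let NF : 2%:R * N%:R = -1 :> F.
Proof. by apply/eqP; rewrite -addr_eq0 -natrM -(natrD _ _ 1) -ph pF. Qed.

(** In F the division identity reads D qt = s - N - r, so [beta] becomes an affine function of the
    remainder r, and this is that function. *)
Let B : {poly F} := (d%:R / D%:R) *: ('X + (N%:R - s%:R)%:P) - 1.

Let B_horner z : D%:R * B.[z] = d%:R * (z + N%:R - s%:R) - D%:R.
Proof. by rewrite /B -polyC1 !(hornerD, hornerN, hornerZ, hornerX, hornerC); field. Qed.

Let betaE (i : 'I_g) : (beta i.+1)%:R = B.[(r i.+1)%:R].
Proof.
have le := hw_quot_bound g2 gd p_pr Pp (_ : 0 < i.+1 <= g)%N.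
apply: (mulfI DF); rewrite B_horner natrB ?le ?ltn_ord //.
have := congr1 (fun n => n%:R : F) (@hw_quot_rem g d p i.+1).
rewrite /= !natrD natrB ?leN // !natrM pF mul0r sub0r => T.
have -> : d%:R = D%:R + 1 :> F by rewrite natr1 -DS.
rewrite mulrBr !mulrDr mulr1; have -> : D%:R * (qt i.+1)%:R = - N%:R + s%:R - (r i.+1)%:R :> F.
  by rewrite T addrK.
ring.
Qed.

(** The product of falling factorials in [multinomial_ffact], as a polynomial of degree at most g -
    1 in the remainder. *)
Let pol (j : 'I_g) : {poly F} :=
  (\prod_(t < g - j.+1) ((g + s)%:R%:P - 'X - t%:R%:P)) * \prod_(t < j) (B - t%:R%:P).

Let polE (i j : 'I_g) :
  (pol j).[(r i.+1)%:R] = ((g + s - r i.+1) ^_ (g - j.+1) * beta i.+1 ^_ j)%:R.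
Proof.
rewrite natrM !ffact_natr hornerM !horner_prod; congr (_ * _); apply: eq_bigr => t _.
  rewrite !(hornerD, hornerN, hornerX, hornerC) natrB //.
  by have := hw_rem_lt g2 gd p_pr Pp i.+1; rewrite [in X in (_ < X)%N]Ds ltnS.
by rewrite hornerD hornerN hornerC betaE.
Qed.

Let size_pol j : (size (pol j) <= g)%N.
Proof.
have bound n (h : 'I_n -> {poly F}) : (forall t, (size (h t) <= 2)%N) ->
    (size (\prod_t h t)%R <= n.+1)%N.
  move=> Hh; elim: n h Hh => [|n IH] h Hh; first by rewrite big_ord0 size_poly1.
  rewrite big_ord_recr /=; apply: leq_trans (size_polyMleq _ _) _.
  have ar b c : (b <= n.+1 -> c <= 2 -> (b + c).-1 <= n.+2)%N by lia.
  by apply: ar (IH _ _) (Hh _) => t; apply: Hh.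
apply: leq_trans (size_polyMleq _ _) _.
set A := \prod_(t < _) _; set A' := \prod_(t < j) _.
have hA : (size A <= (g - j.+1).+1)%N.
  apply: bound => t.
  have -> : (g + s)%:R%:P - 'X - t%:R%:P = - ('X + (t%:R - (g + s)%:R)%:P) :> {poly F}.
    by rewrite polyCB; ring.
  by rewrite size_polyN size_XaddC.
have hA' : (size A' <= j.+1)%N.
  apply: bound => t; rewrite /B -addrA -opprD -polyC1 -polyCD.
  apply: leq_trans (size_polyD _ _) _; rewrite size_polyN geq_max; apply/andP; split.
    apply: leq_trans (size_scale_leq _ _) _.
    by rewrite size_XaddC.
  by rewrite size_polyC; case: (_ != 0).
have ar b c : (b <= (g - j.+1).+1 -> c <= j.+1 -> (b + c).-1 <= g)%N.
  by have := ltn_ord j; lia.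
exact: ar.
Qed.

(** At this point the first product in [pol j] has a zero factor exactly when j < k, which makes the
    evaluations triangular. *)
Let y (k : 'I_g) : F := (k.+1 + s)%:R.

Let pol_below (j k : 'I_g) : (j < k)%N -> (pol j).[y k] = 0.
Proof.
move=> jk; rewrite hornerM horner_prod.
have lt : (g - k.+1 < g - j.+1)%N by have := ltn_ord k; move: jk; lia.
rewrite (bigD1 (Ordinal lt)) //= !(hornerD, hornerN, hornerX, hornerC) /y.
have -> : (g + s)%:R = (k.+1 + s)%:R + (g - k.+1)%:R :> F.
  by rewrite -natrD; congr (_%:R); have := ltn_ord k; lia.
have z (u v : F) : u + v - u - v = 0 by ring.
by rewrite z !mul0r.
Qed.

Let pol_pivot k : (pol k).[y k] != 0.
Proof.
rewrite hornerM !horner_prod mulf_neq0 //; apply/prodf_neq0 => t _.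
  rewrite !(hornerD, hornerN, hornerX, hornerC) /y.
  have -> : (g + s)%:R = (k.+1 + s)%:R + (g - k.+1)%:R :> F.
    by rewrite -natrD; congr (_%:R); have := ltn_ord k; lia.
  have z (u v w : F) : u + v - u - w = v - w by ring.
  rewrite z -natrB; last exact: ltnW.
  apply: natF; rewrite subn_gt0 ltn_ord /=.
  by have := ltn_ord t; move: dp; rewrite DS Ds; lia.
rewrite hornerD hornerN hornerC; apply: contraTneq isT => E.
have tk := ltn_ord t; have kg := ltn_ord k.
have mK : (0 < t.+1 < k.+1)%N by rewrite !ltnS.
(* A zero factor means B(y k) = t; multiplied by 2D, and with 2N = -1, this says that p divides d (2
   (K - m) - 1) + 2m for K = k + 1 and m = t + 1. *)
have /negP[] := pivot_nonzero g2 gd p_pr Pp mK kg.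
have e : B.[y k] = t%:R by apply/eqP; rewrite -subr_eq0 E.
rewrite (dvdn_pcharf chp) natrD !natrM natrB; last by rewrite muln_gt0 subn_gt0 /= ltnS tk.
rewrite natrM natrB; last by rewrite ltnS ltnW.
have := B_horner (y k); rewrite e /y natrD addrAC addrK => E2.
have {}E2 : 2%:R * (D%:R * t%:R) = d%:R * (2%:R * k.+1%:R - 1) - 2%:R * D%:R :> F.
  by rewrite E2 -NF; ring.
have dD : d%:R = D%:R + 1 :> F by rewrite natr1 -DS.
apply/eqP; transitivity (d%:R * (2%:R * k.+1%:R - 1) - 2%:R * D%:R - 2%:R * (D%:R * t%:R) : F).
  by rewrite dD -[t.+1]addn1 natrD; ring.
by rewrite E2 subrr.
Qed.

Lemma det_hasse_witt_trinomial : \det (hasse_witt g p (u ^+ N)) != 0.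
Proof.
pose W : 'M[F]_g := \matrix_(i, j)
  (if (r i.+1 <= j.+1 + s)%N then ((u ^+ N)`_(p * i.+1 - j.+1))`_(j.+1 + s - r i.+1) else 0).
apply: (@det_lowest_terms _ _ _ W (fun i => r i.+1) (fun j => (j.+1 + s)%N)).
- by move=> i j c lt; rewrite mxE low_coef.
- by move=> i j; rewrite !mxE.
pose x (i : 'I_g) : F := (r i.+1)%:R.
have x_inj : injective x.
  move=> i j; wlog le : i j / (r i.+1 <= r j.+1)%N.
    by move=> H; have [/H//|/ltnW/H h e] := leqP (r i.+1) (r j.+1); rewrite h.
  move=> /esym/eqP; rewrite -subr_eq0 /x -natrB // -(dvdn_pcharf chp).
  have rj := hw_rem_lt g2 gd p_pr Pp j.+1; rewrite /dvdn modn_small; last first.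
    by rewrite (leq_ltn_trans (leq_subr _ _)) // (ltn_trans rj) // (leq_ltn_trans (leq_pred _) dp).
  rewrite subn_eq0 => le'.
  have e : r i.+1 = r j.+1 by apply/eqP; rewrite eqn_leq le.
  have {}e : i.+1 = j.+1 by apply: (hw_rem_inj g2 gd p_pr Pp) e; rewrite /= ltn_ord.
  by apply/val_inj/succn_inj.
have dP := interpolation_det x_inj size_pol pol_below pol_pivot.
set P := \matrix_(i, j) _ in dP.
(* The factorials of [multinomial_ffact] clear the row denominators, and the powers of a split into
   a row part a^beta and a column part a^j. On the right N! and a are nonzero, so the determinant of
   W cannot vanish. *)
pose uu : 'rV[F]_g := \row_i ((g + s - r i.+1)`! * (beta i.+1)`! * (qt i.+1)`!)%:R.
pose ww : 'rV[F]_g := \row_i (N`!%:R * a ^+ beta i.+1).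
have key : diag_mx uu *m (W *m diag_mx (\row_j a ^+ j)) = diag_mx ww *m P.
  rewrite mul_mx_diag !mul_diag_mx; apply/matrixP => i j.
  have le := hw_quot_bound g2 gd p_pr Pp (_ : 0 < i.+1 <= g)%N.
  have rgs : (r i.+1 <= g + s)%N.
    by have := hw_rem_lt g2 gd p_pr Pp i.+1; rewrite [in X in (_ < X)%N]Ds ltnS.
  have := multinomial_ffact (ltn_ord j) rgs (le (ltn_ord i)).
  rewrite !mxE polE -/(beta i.+1); set c := (j.+1 + s - r i.+1)%N => M.
  rewrite mulrAC -natrM -M.
  case: leqP => [ler|ltr]; last by rewrite muln0 !(mul0r, mulr0).
  rewrite top_coef // -/c [in RHS]natrM -[X in _ * (X * _)]mulr_natl.
  rewrite -!mulrA -exprD; congr (_ * _).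
  have [cN|Nc] := leqP c N; last by rewrite bin_small // mul0n !mul0r.
  have [qN|Nq] := leqP (qt i.+1) (N - c); last first.
    by rewrite [X in (_ * X)%N]bin_small // muln0 !mul0r.
  congr (_ * a ^+ _); rewrite /c /beta in cN qN *; have := le (ltn_ord i); lia.
apply: contraNneq dP => dW.
have := congr1 (@determinant _ _) key.
rewrite !det_mulmx dW mul0r mulr0 det_diag => /esym/eqP; rewrite mulf_eq0.
case/orP => //; rewrite prodf_seq_eq0 => /hasP[i _]; rewrite /= mxE mulf_eq0.
rewrite expf_eq0 (negPf a0) andbF orbF -(dvdn_pcharf chp) => dv; exfalso.
have : (p %| N`!)%N -> (p <= N)%N.
  elim: (N) => [|n IH]; first by rewrite dvdn1 => /eqP e; move: p_pr; rewrite e.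
  rewrite factS Euclid_dvdM // => /orP[/dvdn_leq->//|/IH]; exact: leqW.
by move=> /(_ dv); rewrite [X in (X <= _)%N]ph; lia.
Qed.

End NonVanishing.

(** * The trinomial family *)

Lemma det_hasse_witt_pow (F : fieldType) p g (f : {poly F}) m :
  p \in [pchar F] -> odd p -> (g <= p)%N -> (size f <= 2 * g + 3)%N -> (0 < m)%N ->
  (\det (hasse_witt g (p ^ m) (f ^+ ((p ^ m).-1./2))) != 0) =
  (\det (hasse_witt g p (f ^+ (p.-1./2))) != 0).
Proof.
move=> chp op gp szf; case: m => // m _; elim: m => [|m IH]; first by rewrite expn1.
have p_pr := pcharf_prime chp; have p_gt0 := prime_gt0 p_pr.
have gpm : (g <= p ^ m.+1)%N by rewrite (leq_trans gp) // -{1}(expn1 p) leq_pexp2l.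
rewrite expnS hasse_wittM ?oddX ?op ?orbT //; last first.
  by rewrite (eq_pnat _ (pcharf_eq chp)) pnat_id.
rewrite det_mulmx -[map_mx _ _]/(map_mx (pFrobenius_aut chp) _) det_map_mx /=.
by rewrite mulf_eq0 negb_or fmorph_eq0 IH andbb.
Qed.

Section Trinomial.

Lemma size_trinomial (R : nzRingType) d (a t : R) : (2 <= d)%N ->
  size (trinomial d a t) = d.+1.
Proof.
move=> d2; rewrite /trinomial -addrA size_polyDl size_polyXn // ltnS.
apply: leq_trans (size_polyD _ _) _; rewrite geq_max size_polyC.
apply/andP; split; last by case: (_ != 0) => //=; apply: ltnW.
by apply: leq_trans (size_scale_leq _ _) _; rewrite size_polyX.
Qed.

Lemma trinomial_monic (R : nzRingType) d (a t : R) : (2 <= d)%N ->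
  trinomial d a t \is monic.
Proof.
move=> d2; rewrite monicE lead_coefE size_trinomial //= /trinomial !coefD coefXn eqxx.
rewrite coefZ coefX coefC.
by case: d d2 => [|[|d]] //= _; rewrite mulr0 !addr0.
Qed.

Lemma map_trinomial (R S : nzRingType) (h : {rmorphism R -> S}) d a t :
  map_poly h (trinomial d a t) = trinomial d (h a) (h t).
Proof.
by rewrite /trinomial !rmorphD /= map_polyXn map_polyZ /= map_polyX map_polyC.
Qed.

(** The resultant of f and f' commutes with specialization because the leading coefficients 1 and d
    stay nonzero in F; it vanishes exactly when f and f' have a common factor. *)
Lemma base_point_separable d (alpha : int) (F : finFieldType) (t : F) :
  (2 <= d)%N -> d%:R != 0 :> F ->
  base_point d alpha t =
    (2%:R != 0 :> F) &&
    coprimep (trinomial d alpha%:~R t) (trinomial d alpha%:~R t)^`().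
Proof.
move=> d2 dF; rewrite /base_point; congr (_ && _).
pose h : {rmorphism {poly int} -> F} := horner_eval t \o map_poly intr.
rewrite -[(map_poly _ _).[t]]/(h (Dpoly d alpha)) /Dpoly /monic_disc.
set f := trinomial _ _ _.
have lf : lead_coef f = 1 by apply/eqP; rewrite -monicE trinomial_monic.
have ld : lead_coef f^`() = d%:R.
  have szd : size f^`() = d.
    apply/eqP; rewrite eqn_leq; apply/andP; split.
      have := lt_size_deriv (_ : f != 0); rewrite -size_poly_eq0 size_trinomial //.
      by rewrite ltnS; apply.
    rewrite leqNgt; apply/negP => lt.
    have le : (size f^`() <= d.-1)%N by rewrite -ltnS prednK // ltnW.
    have := nth_default 0 le.
    rewrite coef_deriv prednK ?(ltnW d2) //.
    have -> : f`_d = 1 by rewrite -lf lead_coefE size_trinomial.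
    by move/eqP; rewrite -polyC_natr polyC_eq0 pnatr_eq0 => /eqP e; rewrite e in d2.
  rewrite lead_coefE szd coef_deriv prednK ?(ltnW d2) //.
  by have -> : f`_d = 1 by rewrite -lf lead_coefE size_trinomial.
rewrite rmorphM rmorphXn rmorphN1 mulf_eq0 expf_eq0 oppr_eq0 oner_eq0 andbF orFb.
rewrite (@map_resultant _ _ h) ?lf ?ld ?rmorph1 ?rmorph_nat ?oner_eq0 //.
rewrite -deriv_map map_trinomial resultant_eq0.
have -> : h alpha%:P = alpha%:~R by rewrite /h /= map_polyC /= horner_evalE hornerC.
have -> : h 'X = t by rewrite /h /= map_polyX horner_evalE hornerX.
set u := trinomial _ _ _.
have g0 : (0 < size (gcdp u u^`()))%N.
  by rewrite size_poly_gt0 gcdp_eq0 negb_and monic_neq0 ?trinomial_monic.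
by rewrite /coprimep -leqNgt eqn_leq g0 andbT.
Qed.

End Trinomial.

Section GenericOrdinarity.

Variables (g d p : nat) (alpha : int).
Hypotheses (g2 : (2 <= g)%N) (gd : genus_degree g d) (p_pr : prime p).
Hypotheses (Pp : (Pplus d < p)%N) (pa : ~~ (p%:Z %| alpha)%Z).

Let d2 : (2 <= d)%N. Proof. by case: gd => ->; lia. Qed.
Let dp : (d < p)%N := degree_lt_p g2 gd p_pr Pp.
Let op : odd p := p_odd g2 gd p_pr Pp.

Definition hasse_poly : {poly 'F_p} :=
  \det (hasse_witt g p (trinomial d (alpha%:~R)%:P 'X ^+ (p.-1./2))).

Section Fiber.

Variables (F : finFieldType) (iota : {rmorphism 'F_p -> F}).

Let chp : p \in [pchar F].
Proof. by rewrite (fmorph_pchar iota) pchar_Fp. Qed.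

Let dF : d%:R != 0 :> F.
Proof. by rewrite -(dvdn_pcharf chp) gtnNdvd // ltnW. Qed.

Lemma hasse_poly_eval (t : F) : (map_poly iota hasse_poly).[t] =
  \det (hasse_witt g p (trinomial d alpha%:~R t ^+ (p.-1./2))).
Proof.
pose h : {rmorphism {poly 'F_p} -> F} := horner_eval t \o map_poly iota.
rewrite -[LHS]/(h hasse_poly) /hasse_poly -det_map_mx map_hasse_witt rmorphXn /=.
rewrite map_trinomial /= map_polyC map_polyX /= !horner_evalE hornerC hornerX.
by rewrite rmorph_int.
Qed.

Lemma ordinary_hasse_poly (t : F) : base_point d alpha t ->
  ordinary p g (trinomial d alpha%:~R t) <-> (map_poly iota hasse_poly).[t] != 0.
Proof.
rewrite base_point_separable // => /andP[F2 sep]; rewrite hasse_poly_eval.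
have szf := size_trinomial (alpha%:~R : F) t d2.
have [C DC] := exists_companion (trinomial_monic (alpha%:~R : F) t d2) szf.
case: d gd dp d2 C DC szf sep => // n' gd' dp' d2' C DC szf sep.
rewrite -DC in sep szf *.
have pg : (2 * g < p)%N by case: gd' => e; move: dp'; rewrite e; lia.
have [m m0 cF] := card_finField_pchar chp.
rewrite ordinary_hasse_witt //; last by lia.
rewrite cF det_hasse_witt_pow //; first by lia.
by rewrite szf; case: gd' => ->; lia.
Qed.

End Fiber.

Let chp : p \in [pchar 'F_p]. Proof. by rewrite pchar_Fp. Qed.

Let alpha0 : alpha%:~R != 0 :> 'F_p.
Proof.
apply: contraNneq pa => a0; rewrite dvdzE absz_nat (dvdn_pcharf chp).
case: alpha a0 => n; first by rewrite -pmulrn => ->.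
by rewrite NegzE mulrNz abszN -pmulrn => /eqP; rewrite oppr_eq0.
Qed.

Lemma hasse_poly_neq0 : hasse_poly != 0.
Proof. exact: det_hasse_witt_trinomial. Qed.

(** This point shows that D_alpha does not vanish identically modulo p. Since x u' - d u = (1 - d)
    alpha x and p does not divide d - 1, gcd(u, u') divides x and then the constant alpha. *)
Lemma base_point_0 : base_point d alpha (0 : 'F_p).
Proof.
have nat0 n : (0 < n < p)%N -> n%:R != 0 :> 'F_p.
  by move=> /andP[n0 np]; rewrite -(dvdn_pcharf chp) gtnNdvd.
rewrite base_point_separable //; last by apply: nat0; rewrite dp andbT ltnW.
apply/andP; split; first by apply: nat0; apply: leq_ltn_trans d2 dp.
have a0 := alpha0; set al : 'F_p := alpha%:~R in a0 *; set u := trinomial _ _ _.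
have d1 : 1 - d%:R != 0 :> 'F_p.
  rewrite -opprB oppr_eq0 -(natrB _ (ltnW d2)); apply: nat0.
  by rewrite subn_gt0 d2 (leq_ltn_trans (leq_subr _ _) dp).
have Du : u = 'X^d + al *: 'X by rewrite /u /trinomial polyC0 addr0.
have Du' : u^`() = d%:R *: 'X^(d.-1) + al%:P.
  by rewrite Du derivD derivXn derivZ derivX scaler_nat alg_polyC.
have dvX : gcdp u u^`() %| 'X.
  rewrite -(dvdpZr _ _ (mulf_neq0 d1 a0)).
  have <- : 'X * u^`() - d%:R *: u = ((1 - d%:R) * al) *: 'X.
    rewrite Du' Du mulrDr -scalerAr -exprS prednK ?(ltnW d2) // scalerDr opprD.
    by rewrite addrACA subrr add0r mulrC mul_polyC scalerA -scalerBl mulrBl mul1r.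
  by rewrite dvdp_sub // ?dvdp_mull ?dvdpZr ?nat0 ?(ltnW d2) ?dvdp_gcdr ?dvdp_gcdl.
have dva : gcdp u u^`() %| al%:P.
  have -> : al%:P = u^`() - d%:R *: 'X^(d.-1) by rewrite Du' addrAC subrr add0r.
  rewrite dvdp_sub ?dvdp_gcdr // dvdpZr ?nat0 ?(ltnW d2) //.
  by rewrite (dvdp_trans dvX) // -(prednK (_ : 0 < d.-1)%N) ?exprS ?dvdp_mulr // -ltnS prednK // ltnW.
have al0 : al%:P != 0 by rewrite polyC_eq0.
have := dvdp_leq al0 dva; rewrite size_polyC a0 /coprimep => le.
rewrite eqn_leq le size_poly_gt0 gcdp_eq0 negb_and monic_neq0 //.
exact: trinomial_monic.
Qed.

(** All elements of F_p may be roots of [hasse_poly] or of D_alpha, so a point is sought in an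
    extension with more elements than their product has roots. *)
Lemma generic_point : exists (F : finFieldType) (iota : {rmorphism 'F_p -> F}) (t : F),
  base_point d alpha t /\ (map_poly iota hasse_poly).[t] != 0.
Proof.
pose P := hasse_poly * map_poly intr (Dpoly d alpha).
have P0 : P != 0.
  rewrite mulf_neq0 ?hasse_poly_neq0 //.
  case/andP: base_point_0 => _; by apply: contraNneq => ->; rewrite horner0.
have [F [iota cF]] := @finField_extension 'F_p (size P).+1 isT.
have lt : (size P < #|F|)%N.
  rewrite cF; apply: leq_trans (ltn_expl _ _) => //.
  by rewrite card_Fp // prime_gt1.
case: (pickP (fun t : F => ~~ root (map_poly iota P) t)) => [t|all0]; last first.
  have := @max_poly_roots _ (map_poly iota P) (enum F).
  rewrite map_poly_eq0 P0 enum_uniq -cardE size_map_poly => /(_ isT).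
  rewrite ltnNge (ltnW lt) => H; exfalso.
  suff /H : all (root (map_poly iota P)) (enum F) by move/(_ isT).
  by apply/allP => t _; have /negbFE := all0 t.
rewrite /P rmorphM rootM negb_or /= => /andP[nh nD].
exists F, iota, t; split=> //; case/andP: base_point_0 => F2 _.
rewrite /base_point -(rmorph_nat iota) fmorph_eq0 F2 /=.
move: nD; rewrite rootE -map_poly_comp /=.
by rewrite (eq_map_poly (fun n : int => rmorph_int iota n)).
Qed.

Theorem generically_ordinary_trinomial : generically_ordinary g d alpha p.
Proof.
split.
  exists hasse_poly => F iota t bp; rewrite -ordinary_hasse_poly //.
  by split=> [[]|].
have [F [iota [t [bp ht]]]] := generic_point.
by exists F, iota, t; split=> //; apply/(ordinary_hasse_poly iota bp).
Qed.

End GenericOrdinarity.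

Theorem corollary4p2 (g d : nat) (hg : (2 <= g)%N)
    (hd : d = (2 * g + 1)%N \/ d = (2 * g + 2)%N) :
  (forall alpha : int, alpha <> 0%R ->
     forall p : nat, prime p -> (Pplus d < p)%N -> ~~ (p%:Z %| alpha)%Z ->
       generically_ordinary g d alpha p) /\
  (forall p : nat, prime p -> (Pplus d < p)%N ->
     generically_ordinary g d (- d%:Z)%R p).
Proof.
split=> [alpha _ p p_pr Pp pa|p p_pr Pp].
  exact: generically_ordinary_trinomial.
apply: generically_ordinary_trinomial => //.
rewrite dvdzE abszN !absz_nat gtnNdvd //; last exact: (degree_lt_p hg hd p_pr Pp).
by case: hd => ->; rewrite ?addn1 ?addn2.
Qed.
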